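(* Let $a<b$ be positive integers with $\gcd(a,b)=1$. Then, as $T\to\infty$, $$I_{a,b,a}(T)\sim\zeta\Big(\frac{a+b}{2}\Big)T\log T.$$
   Context: $\zeta$ is the Riemann zeta function and, for $a,b,c\in\mathbb{R}^+$ and $T>1$, $$I_{a,b,c}(T)=\int_0^T\zeta(1/2+ait)\,\zeta(1/2-bit)\,\zeta(1/2-cit)\,dt,$$ so $I_{a,b,a}(T)$ is the case $c=a$. *)

(* Defs.v *)
From Stdlib Require Import Reals.
From Coquelicot Require Import Coquelicot.

Local Open Scope C_scope.

(* The principal power x^s = e^(s ln x) of a positive real x. *)
Definition Rpow_C (x : R) (s : C) : C :=
  exp (Re s * ln x) * (cos (Im s * ln x), sin (Im s * ln x)).

Definition C_analytic_at (f : C -> C) (s0 : C) : Prop :=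
  exists (c : nat -> C) (r : posreal),
    forall h : C, Cmod h < r ->
      is_pseries (K := C_AbsRing) (V := C_NormedModule) c h (f (s0 + h)).

(* The Riemann zeta function is the analytic continuation to C \ {1} of the
   Dirichlet series sum_(n >= 1) n^(-s).  This determines its values away
   from s = 1; its value at the pole is arbitrary. *)
Definition is_Riemann_zeta (zeta : C -> C) : Prop :=
  (forall s : C, (1 < Re s)%R ->
     is_series (K := C_AbsRing) (V := C_NormedModule)
       (fun n : nat => Rpow_C (INR (S n)) (- s)) (zeta s)) /\
  (forall s : C, s <> 1 -> C_analytic_at zeta s).

Definition zeta_moment (zeta : C -> C) (a b c T : R) : C :=
  RInt (V := C_R_CompleteNormedModule)
    (fun t : R => zeta (1 / 2 + Ci * a * t) *
                  zeta (1 / 2 - Ci * b * t) *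
                  zeta (1 / 2 - Ci * c * t)) 0 T.

(* Main.v *)
Require Import Defs.
From Stdlib Require Import Reals ZArith Lra Lia Classical_Prop.
From Coquelicot Require Import Coquelicot.
Open Scope R_scope.

(* For T^(3/5) <= t <= T and fixed c <= b, zeta (1/2 + ict) differs by O(T^(-1/10)) from the
   Dirichlet polynomial of length M = bT + O(1) (second-order expansion of the terms, then
   Kusmin-Landau); smaller t are negligible.  So the moment is, up to o(T log T), the sum over n <= M
   of n^(-1/2) times the integral of |zeta (1/2 + iat)|^2 n^(ibt).

   Large n: expanding the polynomials gives the frequencies a ln k + b ln n - a ln m.  Iterated
   averaging of the end points of the integral makes all triples with frequency bounded away from 0
   negligible; it costs only the size of the integrand near the ends, where Weyl's bound
   zeta (1/2 + it) << t^(3/10) suffices.  In the remaining triples m is comparable to k n^(b/a); for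
   given n they contribute O(n^(-1/2 - b/(2a)) T log T), which is summable over n because b > a.

   Fixed n: the integral is dominated by the pairs with m within delta of k n^(b/a).  If n = l^a this
   forces m = k l^b and gives l^(-b/2) T log T.  Otherwise, as gcd (a, b) = 1, n^(b/a) is irrational,
   and the k for which k n^(b/a) is within delta of an integer are widely spaced, so the integral is
   o(T log T).  Summing l^(-a/2) l^(-b/2) over l gives zeta ((a + b) / 2). *)

(* RInt_ext and is_derive leave equalities in canonical-structure carriers, which ring rejects. *)
Ltac eqR := match goal with |- ?x = ?y => change (@eq R x y) end.
Ltac fld := field; repeat split; apply Rgt_not_eq; nra.

(** Polynomials as long as [t] come from the series of zeta alone, without a functional equation,
    but they leave some [T^3] triples [(n, k, m)]. The oscillating ones, each with a bounded
    integral, still add up to [T^(3/2)] in absolute value, which is why the end points have to be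
    smoothed. All sizes are powers of [v] with [T = v^40]: the fractional exponents become integers,
    and a logarithm of [T] is at most [40 v]. The budget is as follows: each polynomial is
    [O(v^12)], three of them are [O(v^36)], and averages that reach [O(v^2)] beyond the end points
    therefore cost [O(v^38)]. *)

Fixpoint rsum (f : nat -> R) (n : nat) : R :=
  match n with O => 0 | S p => rsum f p + f (S p) end.

Fixpoint csum (f : nat -> C) (n : nat) : C :=
  match n with O => 0%C | S p => (csum f p + f (S p))%C end.

Lemma rsum_S f n : rsum f (S n) = rsum f n + f (S n).
Proof. reflexivity. Qed.

Lemma csum_S f n : csum f (S n) = (csum f n + f (S n))%C.
Proof. reflexivity. Qed.

Lemma rsum_ext f g n :
  (forall i, (1 <= i <= n)%nat -> f i = g i) -> rsum f n = rsum g n.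
Proof.
  induction n as [|n IH]; intros H; simpl; [reflexivity|].
  rewrite IH, H; [reflexivity|lia|intros; apply H; lia].
Qed.

Lemma rsum_le f g n :
  (forall i, (1 <= i <= n)%nat -> f i <= g i) -> rsum f n <= rsum g n.
Proof.
  induction n as [|n IH]; intros H; simpl; [lra|].
  apply Rplus_le_compat; [apply IH; intros; apply H; lia|apply H; lia].
Qed.

Lemma rsum_plus f g n : rsum (fun i => f i + g i) n = rsum f n + rsum g n.
Proof. induction n as [|n IH]; simpl; [|rewrite IH]; ring. Qed.

Lemma rsum_scal c f n : rsum (fun i => c * f i) n = c * rsum f n.
Proof. induction n as [|n IH]; simpl; [|rewrite IH]; ring. Qed.

Lemma rsum_scal_r c f n : rsum (fun i => f i * c) n = rsum f n * c.
Proof. induction n as [|n IH]; simpl; [|rewrite IH]; ring. Qed.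

Lemma rsum_const c n : rsum (fun _ => c) n = INR n * c.
Proof.
  induction n as [|n IH]; [simpl; ring|]. rewrite S_INR. simpl rsum. rewrite IH. ring.
Qed.

Lemma rsum_ge0 f n : (forall i, (1 <= i <= n)%nat -> 0 <= f i) -> 0 <= rsum f n.
Proof.
  intros H. replace 0 with (rsum (fun _ => 0) n) by (rewrite rsum_const; ring).
  apply rsum_le; auto.
Qed.

Lemma rsum_incr f n m :
  (forall i, 0 <= f i) -> (n <= m)%nat -> rsum f n <= rsum f m.
Proof.
  intros H; induction 1 as [|m Hm IH]; simpl; [lra|]. specialize (H (S m)). lra.
Qed.

Lemma rsum_first f n : rsum f (S n) = f 1%nat + rsum (fun i => f (S i)) n.
Proof.
  induction n as [|n IH]; [simpl; ring|].
  change (rsum f (S (S n))) with (rsum f (S n) + f (S (S n))). rewrite IH. simpl. ring.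
Qed.

Lemma rsum_add f n m : rsum f (n + m) = rsum f n + rsum (fun i => f (n + i)%nat) m.
Proof.
  induction m as [|m IH]; [rewrite Nat.add_0_r; simpl; ring|].
  rewrite Nat.add_succ_r. simpl. rewrite IH, Nat.add_succ_r. ring.
Qed.

Lemma rsum_swap (f : nat -> nat -> R) n m :
  rsum (fun i => rsum (fun j => f i j) m) n = rsum (fun j => rsum (fun i => f i j) n) m.
Proof.
  induction n as [|n IH]; simpl.
  - rewrite rsum_const; ring.
  - rewrite IH, <- rsum_plus. reflexivity.
Qed.

Lemma rsum_mult f g n m :
  rsum f n * rsum g m = rsum (fun i => rsum (fun j => f i * g j) m) n.
Proof.
  rewrite <- rsum_scal_r. apply rsum_ext; intros. rewrite rsum_scal. reflexivity.
Qed.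

Lemma rsum_le_term f n i :
  (forall i, 0 <= f i) -> (1 <= i <= n)%nat -> f i <= rsum f n.
Proof.
  intros H Hi. apply Rle_trans with (rsum f i).
  - destruct i as [|i]; [lia|]. simpl. assert (0 <= rsum f i) by (apply rsum_ge0; auto). lra.
  - apply rsum_incr; [auto|lia].
Qed.

Lemma csum_ext f g n :
  (forall i, (1 <= i <= n)%nat -> f i = g i) -> csum f n = csum g n.
Proof.
  induction n as [|n IH]; intros H; simpl; [reflexivity|].
  rewrite IH, H; [reflexivity|lia|intros; apply H; lia].
Qed.

Lemma csum_plus f g n : csum (fun i => f i + g i)%C n = (csum f n + csum g n)%C.
Proof. induction n as [|n IH]; simpl; [|rewrite IH]; ring. Qed.

Lemma csum_minus f g n : csum (fun i => f i - g i)%C n = (csum f n - csum g n)%C.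
Proof. induction n as [|n IH]; simpl; [|rewrite IH]; ring. Qed.

Lemma csum_scal c f n : csum (fun i => c * f i)%C n = (c * csum f n)%C.
Proof. induction n as [|n IH]; simpl; [|rewrite IH]; ring. Qed.

Lemma csum_scal_r c f n : csum (fun i => f i * c)%C n = (csum f n * c)%C.
Proof. induction n as [|n IH]; simpl; [|rewrite IH]; ring. Qed.

Lemma csum_zero n : csum (fun _ => 0%C) n = 0%C.
Proof. induction n as [|n IH]; simpl; [|rewrite IH]; ring. Qed.

Lemma csum_add f n m : csum f (n + m) = (csum f n + csum (fun i => f (n + i)%nat) m)%C.
Proof.
  induction m as [|m IH]; [rewrite Nat.add_0_r; simpl; ring|].
  rewrite Nat.add_succ_r. simpl. rewrite IH, Nat.add_succ_r. ring.
Qed.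

Lemma csum_swap (f : nat -> nat -> C) n m :
  csum (fun i => csum (fun j => f i j) m) n = csum (fun j => csum (fun i => f i j) n) m.
Proof.
  induction n as [|n IH]; simpl.
  - rewrite csum_zero; reflexivity.
  - rewrite IH, <- csum_plus. reflexivity.
Qed.

Lemma csum_mult f g n m :
  (csum f n * csum g m)%C = csum (fun i => csum (fun j => f i * g j)%C m) n.
Proof.
  rewrite <- csum_scal_r. apply csum_ext; intros. rewrite csum_scal. reflexivity.
Qed.

Lemma Cmod_csum f n : Cmod (csum f n) <= rsum (fun i => Cmod (f i)) n.
Proof.
  induction n as [|n IH]; simpl; [rewrite Cmod_0; lra|].
  eapply Rle_trans; [apply Cmod_triangle|]. lra.
Qed.

Lemma Cmod_csum_le f g n :
  (forall i, (1 <= i <= n)%nat -> Cmod (f i) <= g i) -> Cmod (csum f n) <= rsum g n.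
Proof. intros H. eapply Rle_trans; [apply Cmod_csum|apply rsum_le; auto]. Qed.

Lemma csum_conj f n : Cconj (csum f n) = csum (fun i => Cconj (f i)) n.
Proof.
  induction n as [|n IH]; simpl; [|rewrite <- IH];
  unfold Cconj; apply injective_projections; simpl; ring.
Qed.

Lemma Re_csum f n : Re (csum f n) = rsum (fun i => Re (f i)) n.
Proof. induction n as [|n IH]; simpl; [reflexivity|]. rewrite <- IH. reflexivity. Qed.

Lemma Im_csum f n : Im (csum f n) = rsum (fun i => Im (f i)) n.
Proof. induction n as [|n IH]; simpl; [reflexivity|]. rewrite <- IH. reflexivity. Qed.

Lemma csum_RtoC f n : csum (fun i => RtoC (f i)) n = RtoC (rsum f n).
Proof. induction n as [|n IH]; simpl; [reflexivity|]. rewrite IH, RtoC_plus. reflexivity. Qed.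

(** * Elementary inequalities *)

Lemma INR_S_pos n : 0 < INR (S n).
Proof. apply lt_0_INR; lia. Qed.

Lemma INR_ge1 n : (1 <= n)%nat -> 1 <= INR n.
Proof. intros H. apply (le_INR 1) in H. exact H. Qed.

Lemma ln_le_sub x : 0 < x -> ln x <= x - 1.
Proof.
  intros H. destruct (Req_dec x 1) as [->|Hx]; [rewrite ln_1; lra|].
  pose proof (exp_ineq1 (ln x)) as E. rewrite exp_ln in E by lra.
  assert (ln x <> 0). { intros E0. apply Hx. apply ln_inv; [lra|lra|]. rewrite ln_1; lra. }
  specialize (E H0). lra.
Qed.

Lemma ln_ge_sub x : 0 < x -> 1 - / x <= ln x.
Proof.
  intros H. pose proof (ln_le_sub (/ x) (Rinv_0_lt_compat _ H)) as E.
  rewrite ln_Rinv in E by lra. lra.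
Qed.

Lemma ln_nonneg x : 1 <= x -> 0 <= ln x.
Proof. intros H. rewrite <- ln_1. apply ln_le; lra. Qed.

Lemma ln_sub_ge x y : 0 < x -> 0 < y -> Rabs (x - y) / Rmax x y <= Rabs (ln x - ln y).
Proof.
  assert (W : forall x y, 0 < x -> x <= y -> Rabs (x - y) / Rmax x y <= Rabs (ln x - ln y)).
  { intros u v Hu Huv. rewrite Rmax_right by lra.
    rewrite Rabs_left1 by lra.
    assert (ln u <= ln v) by (apply ln_le; lra).
    rewrite Rabs_left1 by lra.
    pose proof (ln_ge_sub (v / u)) as E.
    unfold Rdiv in E. rewrite ln_mult, ln_Rinv, Rinv_mult, Rinv_inv in E; try lra.
    - assert (0 < v * / u) by (apply Rmult_lt_0_compat; [lra|apply Rinv_0_lt_compat; lra]).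
      specialize (E H0). unfold Rdiv. replace (- (u - v) * / v) with (1 - / v * u); [lra|].
      fld.
    - apply Rinv_0_lt_compat; lra. }
  intros Hx Hy. destruct (Rle_dec x y).
  - apply W; lra.
  - rewrite Rmax_comm, Rabs_minus_sym, (Rabs_minus_sym (ln x)). apply W; lra.
Qed.

Definition harmonic n := rsum (fun i => / INR i) n.

Lemma harmonic_ge0 n : 0 <= harmonic n.
Proof.
  apply rsum_ge0. intros i Hi. apply Rlt_le, Rinv_0_lt_compat, lt_0_INR; lia.
Qed.

Lemma harmonic_upper n : (1 <= n)%nat -> harmonic n <= 1 + ln (INR n).
Proof.
  induction 1 as [|n Hn IH]; [unfold harmonic; simpl; rewrite ln_1; lra|].
  unfold harmonic in *. rewrite rsum_S.
  assert (0 < INR n) by (apply lt_0_INR; lia).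
  assert (E := ln_ge_sub (INR (S n) / INR n)).
  rewrite S_INR in *. unfold Rdiv in E. rewrite ln_mult, ln_Rinv in E; try lra.
  - assert (0 < (INR n + 1) * / INR n) by (apply Rmult_lt_0_compat; [lra|apply Rinv_0_lt_compat; lra]).
    specialize (E H0).
    replace (1 - / ((INR n + 1) * / INR n)) with (/ (INR n + 1)) in E by fld. lra.
  - apply Rinv_0_lt_compat; lra.
Qed.

(** With [S n] inside the logarithm the bound includes [n = 0] and fits floors: for [j = N / alpha]
    in [nat], the integer [S j] exceeds the real quotient. *)
Lemma harmonic_lower n : ln (INR (S n)) <= harmonic n.
Proof.
  induction n as [|n IH]; [unfold harmonic; simpl; rewrite ln_1; lra|].
  unfold harmonic in *. rewrite rsum_S. pose proof (INR_S_pos n).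
  assert (E := ln_le_sub (INR (S (S n)) / INR (S n))).
  rewrite (S_INR (S n)) in *. unfold Rdiv in E. rewrite ln_mult, ln_Rinv in E; try lra.
  - assert (0 < (INR (S n) + 1) * / INR (S n)) by (apply Rmult_lt_0_compat; [lra|apply Rinv_0_lt_compat; lra]).
    specialize (E H0).
    replace ((INR (S n) + 1) * / INR (S n) - 1) with (/ INR (S n)) in E by fld. lra.
  - apply Rinv_0_lt_compat; lra.
Qed.

Lemma harmonic_diff n m : (1 <= n <= m)%nat ->
  harmonic m - harmonic n <= ln (INR m) - ln (INR n).
Proof.
  intros [H1 H2]. induction H2 as [|m Hm IH]; [lra|].
  unfold harmonic in *. rewrite rsum_S.
  assert (0 < INR m) by (apply lt_0_INR; lia).
  assert (E := ln_ge_sub (INR (S m) / INR m)).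
  rewrite S_INR in *. unfold Rdiv in E. rewrite ln_mult, ln_Rinv in E; try lra.
  - assert (0 < (INR m + 1) * / INR m) by (apply Rmult_lt_0_compat; [lra|apply Rinv_0_lt_compat; lra]).
    specialize (E H0).
    replace (1 - / ((INR m + 1) * / INR m)) with (/ (INR m + 1)) in E by fld. lra.
  - apply Rinv_0_lt_compat; lra.
Qed.

(* One of the two extreme indices lies at distance at least (n-1)/2 from y; remove it. *)
Lemma rsum_dist_le (g : R -> R) (y : R) (n : nat) :
  (forall u v, 0 <= u -> u <= v -> g v <= g u) ->
  rsum (fun m => g (Rabs (INR m - y))) n <= rsum (fun i => g ((INR i - 1) / 2)) n.
Proof.
  intros Hg. revert y. induction n as [|n IH]; intros y; [simpl; lra|].
  assert (Hn := pos_INR n).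
  destruct (Rle_dec (INR n / 2) (Rabs (INR (S n) - y))) as [H|H].
  - rewrite rsum_S. apply Rplus_le_compat; [apply IH|]. apply Hg.
    + rewrite S_INR; lra.
    + rewrite S_INR at 1. lra.
  - rewrite rsum_first. rewrite (rsum_S _ n). rewrite Rplus_comm.
    apply Rplus_le_compat.
    + eapply Rle_trans; [|apply (IH (y - 1))]. apply Req_le, rsum_ext; intros.
      rewrite S_INR. f_equal. f_equal. ring.
    + apply Hg; [rewrite S_INR; lra|].
      rewrite S_INR in *. simpl INR.
      assert (Rabs (INR n + 1 - y) < INR n / 2) by lra.
      apply Rabs_def2 in H0.
      unfold Rabs. destruct Rcase_abs; lra.
Qed.

(** The bound is uniform in the real centre [y], which will be [k n^(b/a)]; the integers on both
    sides of it are handled at once. *)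
Lemma rsum_inv_dist y n : rsum (fun m => / (1 + Rabs (INR m - y))) n <= 2 * harmonic n.
Proof.
  eapply Rle_trans; [apply (rsum_dist_le (fun x => / (1 + x)))|].
  - intros u v Hu Huv. apply Rinv_le_contravar; lra.
  - unfold harmonic. rewrite <- rsum_scal. apply rsum_le. intros i Hi.
    pose proof (INR_ge1 i ltac:(lia)).
    replace (2 * / INR i) with (/ (INR i / 2)) by fld.
    apply Rinv_le_contravar; lra.
Qed.

Lemma rsum_inv_sq n : rsum (fun i => / (INR i * INR i)) n <= 2.
Proof.
  (* The sharper bound [2 - 1/n] is what the induction can carry: consecutive bounds differ by
     [1 / (n (n + 1))]. *)
  enough (forall n, rsum (fun i => / (INR i * INR i)) (S n) <= 2 - / INR (S n)).
  { destruct n; [simpl; lra|]. specialize (H n).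
    pose proof (Rinv_0_lt_compat _ (INR_S_pos n)). lra. }
  clear n. induction n as [|n IH]; [simpl; lra|].
  change (rsum (fun i => / (INR i * INR i)) (S n) + / (INR (S (S n)) * INR (S (S n))) <= 2 - / INR (S (S n))).
  pose proof (INR_S_pos n) as P. rewrite (S_INR (S n)) in *.
  enough (/ ((INR (S n) + 1) * (INR (S n) + 1)) <= / INR (S n) - / (INR (S n) + 1)) by lra.
  replace (/ INR (S n) - / (INR (S n) + 1)) with (/ (INR (S n) * (INR (S n) + 1))) by fld.
  apply Rinv_le_contravar; nra.
Qed.

Lemma rsum_inv_dist_sq y n :
  rsum (fun m => / ((1 + Rabs (INR m - y)) * (1 + Rabs (INR m - y)))) n <= 8.
Proof.
  eapply Rle_trans; [apply (rsum_dist_le (fun x => / ((1 + x) * (1 + x))))|].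
  - intros u v Hu Huv. apply Rinv_le_contravar; nra.
  - eapply Rle_trans with (rsum (fun i => 4 * / (INR i * INR i)) n).
    + apply rsum_le. intros i Hi. pose proof (INR_ge1 i ltac:(lia)).
      replace (4 * / (INR i * INR i)) with (/ (INR i / 2 * (INR i / 2))) by fld.
      apply Rinv_le_contravar; nra.
    + rewrite rsum_scal. pose proof (rsum_inv_sq n). lra.
Qed.

Lemma rsum_indicator x n : 0 <= x ->
  rsum (fun k => if Rle_dec (INR k) x then 1 else 0) n <= x.
Proof.
  intros Hx. induction n as [|n IH]; [simpl; lra|].
  rewrite rsum_S. destruct Rle_dec as [H|H]; [|lra].
  apply Rle_trans with (INR (S n)); [|exact H].
  rewrite S_INR. apply Rplus_le_compat_r.
  rewrite <- (Rmult_1_r (INR n)), <- rsum_const. apply rsum_le; intros.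
  destruct Rle_dec; lra.
Qed.

Lemma rsum_inv_sqrt n : rsum (fun i => / sqrt (INR i)) n <= 2 * sqrt (INR n).
Proof.
  induction n as [|n IH]; [simpl; rewrite sqrt_0; lra|].
  rewrite rsum_S. pose proof (pos_INR n). rewrite S_INR in *.
  set (x := sqrt (INR n)) in *. set (y := sqrt (INR n + 1)).
  assert (x * x = INR n) by (apply sqrt_sqrt; lra).
  assert (y * y = INR n + 1) by (apply sqrt_sqrt; lra).
  assert (0 < y) by (apply sqrt_lt_R0; lra).
  enough (/ y <= 2 * (y - x)) by lra.
  apply (Rmult_le_reg_l y); [lra|]. rewrite Rinv_r by lra. nra.
Qed.

(** * Unit complex numbers and integrals of complex-valued functions *)

Definition cis (u : R) : C := (cos u, sin u).

Lemma cis_0 : cis 0 = 1%C.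
Proof. unfold cis. rewrite cos_0, sin_0. reflexivity. Qed.

Lemma cis_plus u v : cis (u + v) = (cis u * cis v)%C.
Proof.
  unfold cis. rewrite cos_plus, sin_plus.
  apply injective_projections; simpl; ring.
Qed.

Lemma Cmod_cis u : Cmod (cis u) = 1.
Proof.
  unfold Cmod, cis; simpl. transitivity (sqrt 1); [f_equal|apply sqrt_1].
  transitivity ((sin u)² + (cos u)²); [unfold Rsqr; ring|apply sin2_cos2].
Qed.

Lemma cis_conj u : Cconj (cis u) = cis (- u).
Proof. unfold Cconj, cis; simpl. rewrite cos_neg, sin_neg. reflexivity. Qed.

Lemma Cmod_RtoC_mult r z : 0 <= r -> Cmod (RtoC r * z) = r * Cmod z.
Proof. intros H. rewrite Cmod_mult, Cmod_R, Rabs_pos_eq; [reflexivity|exact H]. Qed.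

Lemma Cmod_sqr z : Cmod z * Cmod z = Re z * Re z + Im z * Im z.
Proof.
  unfold Cmod. rewrite sqrt_sqrt; [unfold Re, Im; ring|]. simpl; nra.
Qed.

Lemma Im_le_Cmod_abs z : Rabs (Im z) <= Cmod z.
Proof.
  pose proof (Cmod_sqr z). pose proof (Cmod_ge_0 z).
  apply Rabs_le. split; nra.
Qed.

Lemma Cmod_minus_le x y : Cmod (x - y) <= Cmod x + Cmod y.
Proof. eapply Rle_trans; [apply Cmod_triangle|]. rewrite Cmod_opp. lra. Qed.

Lemma Cmod_minus_sym x y : Cmod (x - y) = Cmod (y - x).
Proof. rewrite <- (Cmod_opp (x - y)). f_equal. ring. Qed.

Lemma Cmod_le_via x y : Cmod x <= Cmod y + Cmod (x - y).
Proof. replace x with (y + (x - y))%C at 1 by ring. apply Cmod_triangle. Qed.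

(** Continuity on the whole line, so that integrability never depends on the end points. *)
Definition cont (f : R -> R) := forall t, continuous f t.

Definition ccont (f : R -> C) :=
  cont (fun t => fst (f t)) /\ cont (fun t => snd (f t)).

Lemma cont_const c : cont (fun _ => c).
Proof. intros t. apply continuous_const. Qed.

Lemma cont_id : cont (fun t => t).
Proof. intros t. apply continuous_id. Qed.

Lemma cont_plus f g : cont f -> cont g -> cont (fun t => f t + g t).
Proof. intros Hf Hg t. apply (continuous_plus f g); auto. Qed.

Lemma cont_minus f g : cont f -> cont g -> cont (fun t => f t - g t).
Proof. intros Hf Hg t. apply (continuous_minus f g); auto. Qed.

Lemma cont_mult f g : cont f -> cont g -> cont (fun t => f t * g t).
Proof. intros Hf Hg t. apply (continuous_mult f g); auto. Qed.

Lemma cont_comp f g : cont f -> cont g -> cont (fun t => g (f t)).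
Proof. intros Hf Hg t. apply continuous_comp; auto. Qed.

Lemma cont_cos : cont cos.
Proof. intros t. apply continuous_cos. Qed.

Lemma cont_sin : cont sin.
Proof. intros t. apply continuous_sin. Qed.

Lemma cont_sqrt f : (forall t, 0 <= f t) -> cont f -> cont (fun t => sqrt (f t)).
Proof.
  intros Hf Cf t. apply continuity_pt_filterlim.
  apply (continuity_pt_comp f sqrt); [apply continuity_pt_filterlim, Cf|].
  apply continuity_pt_sqrt; auto.
Qed.

Lemma ccont_const c : ccont (fun _ => c).
Proof. split; apply cont_const. Qed.

Lemma ccont_plus f g : ccont f -> ccont g -> ccont (fun t => f t + g t)%C.
Proof. intros [F1 F2] [G1 G2]; split; apply cont_plus; auto. Qed.

Lemma ccont_minus f g : ccont f -> ccont g -> ccont (fun t => f t - g t)%C.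
Proof. intros [F1 F2] [G1 G2]; split; apply cont_minus; auto. Qed.

Lemma ccont_mult f g : ccont f -> ccont g -> ccont (fun t => f t * g t)%C.
Proof.
  intros [F1 F2] [G1 G2]; split.
  - apply cont_minus; apply cont_mult; auto.
  - apply cont_plus; apply cont_mult; auto.
Qed.

Lemma ccont_cis f : cont f -> ccont (fun t => cis (f t)).
Proof. intros F; split; apply cont_comp; auto using cont_cos, cont_sin. Qed.

Lemma ccont_csum (f : nat -> R -> C) n :
  (forall i, ccont (f i)) -> ccont (fun t => csum (fun i => f i t) n).
Proof.
  intros H; induction n as [|n IH]; simpl; [apply ccont_const|].
  apply ccont_plus; auto.
Qed.

Lemma ccont_comp f g : cont f -> ccont g -> ccont (fun t => g (f t)).
Proof.
  intros F [G1 G2]; split.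
  - apply (cont_comp f (fun t => fst (g t))); auto.
  - apply (cont_comp f (fun t => snd (g t))); auto.
Qed.

Lemma cont_Cmod f : ccont f -> cont (fun t => Cmod (f t)).
Proof.
  intros [F1 F2]. apply cont_sqrt; [intros; nra|].
  simpl. apply cont_plus; repeat apply cont_mult; auto using cont_const.
Qed.

Lemma cont_ex_RInt f a b : cont f -> ex_RInt f a b.
Proof. intros H. apply (ex_RInt_continuous (V := R_CompleteNormedModule)). auto. Qed.

(** Working by components makes the real integration lemmas available; [CInt_RInt] leads back to the
    integral of the theorem. *)
Definition CInt (f : R -> C) (a b : R) : C :=
  (RInt (fun t => fst (f t)) a b, RInt (fun t => snd (f t)) a b).

Lemma CInt_RInt f a b : ccont f ->
  RInt (V := C_R_CompleteNormedModule) f a b = CInt f a b.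
Proof.
  intros [F1 F2]. apply is_RInt_unique.
  apply (is_RInt_fct_extend_pair (U := R_NormedModule) (V := R_NormedModule) f);
    apply (RInt_correct (V := R_CompleteNormedModule)), cont_ex_RInt; auto.
Qed.

Lemma CInt_ext f g a b : (forall t, f t = g t) -> CInt f a b = CInt g a b.
Proof. intros H. unfold CInt. f_equal; apply RInt_ext; intros; rewrite H; reflexivity. Qed.

Lemma CInt_plus f g a b : ccont f -> ccont g ->
  CInt (fun t => f t + g t)%C a b = (CInt f a b + CInt g a b)%C.
Proof.
  intros [F1 F2] [G1 G2]. apply injective_projections; simpl;
  apply (RInt_plus (V := R_CompleteNormedModule)); apply cont_ex_RInt; auto.
Qed.

Lemma RInt_scalR f c a b : cont f -> RInt (fun t => c * f t) a b = c * RInt f a b.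
Proof.
  intros F. apply (RInt_scal (V := R_CompleteNormedModule)). apply cont_ex_RInt; auto.
Qed.

Lemma RInt_plusR f g a b : cont f -> cont g ->
  RInt (fun t => f t + g t) a b = RInt f a b + RInt g a b.
Proof. intros F G. apply (RInt_plus (V := R_CompleteNormedModule)); apply cont_ex_RInt; auto. Qed.

Lemma RInt_minusR f g a b : cont f -> cont g ->
  RInt (fun t => f t - g t) a b = RInt f a b - RInt g a b.
Proof. intros F G. apply (RInt_minus (V := R_CompleteNormedModule)); apply cont_ex_RInt; auto. Qed.

Lemma CInt_scal c f a b : ccont f ->
  CInt (fun t => c * f t)%C a b = (c * CInt f a b)%C.
Proof.
  intros [F1 F2]. apply injective_projections; simpl.
  - rewrite RInt_minusR, !RInt_scalR; auto using cont_mult, cont_const.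
  - rewrite RInt_plusR, !RInt_scalR; auto using cont_mult, cont_const.
Qed.

Lemma CInt_minus f g a b : ccont f -> ccont g ->
  CInt (fun t => f t - g t)%C a b = (CInt f a b - CInt g a b)%C.
Proof.
  intros [F1 F2] [G1 G2]. apply injective_projections; simpl;
  apply RInt_minusR; auto.
Qed.

Lemma CInt_csum (f : nat -> R -> C) n a b : (forall i, ccont (f i)) ->
  CInt (fun t => csum (fun i => f i t) n) a b = csum (fun i => CInt (f i) a b) n.
Proof.
  intros H; induction n as [|n IH]; simpl.
  - unfold CInt; simpl. rewrite (RInt_const (V := R_CompleteNormedModule)).
    apply injective_projections; simpl; apply Rmult_0_r.
  - rewrite CInt_plus, IH; auto using ccont_csum.
Qed.

Lemma RInt_rsum (f : nat -> R -> R) n a b : (forall i, cont (f i)) ->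
  RInt (fun t => rsum (fun i => f i t) n) a b = rsum (fun i => RInt (f i) a b) n.
Proof.
  intros H; induction n as [|n IH]; simpl.
  - rewrite (RInt_const (V := R_CompleteNormedModule)). apply Rmult_0_r.
  - rewrite RInt_plusR, IH; auto.
    clear IH. induction n; simpl; [apply cont_const|apply cont_plus; auto].
Qed.

Lemma CInt_Chasles f a b c : ccont f -> (CInt f a b + CInt f b c)%C = CInt f a c.
Proof.
  intros [F1 F2]. apply injective_projections; simpl;
  apply (RInt_Chasles (V := R_CompleteNormedModule)); apply cont_ex_RInt; auto.
Qed.

Lemma RInt_ChaslesR f a b c : cont f -> RInt f a b + RInt f b c = RInt f a c.
Proof. intros F. apply (RInt_Chasles (V := R_CompleteNormedModule)); apply cont_ex_RInt; auto. Qed.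

Lemma RInt_leR f g a b : cont f -> cont g -> a <= b ->
  (forall t, a <= t <= b -> f t <= g t) -> RInt f a b <= RInt g a b.
Proof.
  intros F G Hab H. apply RInt_le; auto using cont_ex_RInt.
  intros; apply H; lra.
Qed.

(* Rotate so that the integral becomes real and nonnegative. *)
Lemma Cmod_CInt_le f g a b : ccont f -> cont g -> a <= b ->
  (forall t, a <= t <= b -> Cmod (f t) <= g t) -> Cmod (CInt f a b) <= RInt g a b.
Proof.
  intros F G Hab H.
  set (z := CInt f a b).
  assert (Hg : 0 <= RInt g a b).
  { replace 0 with (RInt (fun _ => 0) a b).
    - apply RInt_leR; auto using cont_const. intros t Ht.
      eapply Rle_trans; [apply Cmod_ge_0|apply H; exact Ht].
    - rewrite (RInt_const (V := R_CompleteNormedModule)). apply Rmult_0_r. }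
  destruct (Req_dec (Cmod z) 0) as [E|E]; [lra|].
  pose proof (Cmod_ge_0 z) as P.
  assert (Q : Cmod z * Cmod z <= Cmod z * RInt g a b).
  { rewrite Cmod_sqr. rewrite <- RInt_scalR by auto.
    replace (Re z * Re z + Im z * Im z) with (Re (CInt (fun t => Cconj z * f t)%C a b)).
    - unfold Re; simpl. apply RInt_leR; auto using cont_mult, cont_const.
      + apply (ccont_mult (fun _ => Cconj z) f); auto using ccont_const.
      + intros t Ht.
        apply Rle_trans with (Cmod (Cconj z * f t)).
        * pose proof (re_le_Cmod (Cconj z * f t)) as R1.
          apply Rabs_le_between in R1. apply R1.
        * rewrite Cmod_mult, Cmod_conj. apply Rmult_le_compat_l; auto.
    - rewrite CInt_scal by auto. fold z. unfold Re, Im, Cconj. simpl. ring. }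
  nra.
Qed.

Lemma Cmod_CInt_const f B a b : ccont f -> a <= b ->
  (forall t, a <= t <= b -> Cmod (f t) <= B) -> Cmod (CInt f a b) <= B * (b - a).
Proof.
  intros F Hab H.
  eapply Rle_trans; [apply (Cmod_CInt_le f (fun _ => B)); auto using cont_const|].
  rewrite (RInt_const (V := R_CompleteNormedModule)).
  apply Req_le. unfold scal; simpl. unfold mult; simpl. ring.
Qed.

Lemma RInt_antideriv (F f : R -> R) a b :
  (forall t, is_derive F t (f t)) -> cont f -> RInt f a b = F b - F a.
Proof.
  intros H Hf. apply is_RInt_unique. apply (is_RInt_derive (V := R_CompleteNormedModule) F f); auto.
Qed.

Lemma CInt_cis u a b : u <> 0 ->
  CInt (fun t => cis (u * t)) a b = ((cis (u * b) - cis (u * a)) / (Ci * RtoC u))%C.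
Proof.
  intros Hu. unfold CInt. simpl.
  rewrite (RInt_antideriv (fun t => sin (u * t) / u)).
  2: { intros t. auto_derive; auto. field; auto. }
  2: { apply (cont_comp (fun t => u * t)); auto using cont_mult, cont_const, cont_id, cont_cos. }
  rewrite (RInt_antideriv (fun t => - cos (u * t) / u)).
  2: { intros t. auto_derive; auto. field; auto. }
  2: { apply (cont_comp (fun t => u * t)); auto using cont_mult, cont_const, cont_id, cont_sin. }
  apply injective_projections; simpl; field; auto.
Qed.

Lemma CInt_cis_0 a b : CInt (fun t => cis (0 * t)) a b = RtoC (b - a).
Proof.
  unfold CInt. simpl.
  rewrite (RInt_ext _ (fun _ => 1)), (RInt_ext (fun t => sin _) (fun _ => 0)).
  - rewrite !(RInt_const (V := R_CompleteNormedModule)).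
    unfold scal; simpl; unfold mult; simpl. apply injective_projections; simpl; ring.
  - intros; rewrite Rmult_0_l; apply sin_0.
  - intros; rewrite Rmult_0_l; apply cos_0.
Qed.

Lemma ccont_cis_lin u : ccont (fun t => cis (u * t)).
Proof. apply ccont_cis. apply cont_mult; auto using cont_const, cont_id. Qed.

Lemma Cmod_CInt_cis_T u a b : a <= b -> Cmod (CInt (fun t => cis (u * t)) a b) <= b - a.
Proof.
  intros H. rewrite <- (Rmult_1_l (b - a)).
  apply Cmod_CInt_const; auto using ccont_cis_lin. intros; rewrite Cmod_cis; lra.
Qed.

Lemma Cmod_Ci_R u : Cmod (Ci * RtoC u) = Rabs u.
Proof.
  rewrite Cmod_mult, Cmod_R. replace (Cmod Ci) with 1; [ring|].
  unfold Cmod, Ci; simpl. symmetry. transitivity (sqrt 1); [f_equal; ring|apply sqrt_1].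
Qed.

Lemma Cmod_CInt_cis_u u a b : u <> 0 ->
  Cmod (CInt (fun t => cis (u * t)) a b) <= 2 / Rabs u.
Proof.
  intros Hu. rewrite CInt_cis by auto.
  pose proof (Rabs_pos_lt u Hu).
  rewrite Cmod_div, Cmod_Ci_R.
  - apply Rmult_le_compat_r; [apply Rlt_le, Rinv_0_lt_compat; auto|].
    eapply Rle_trans; [apply Cmod_minus_le|]. rewrite !Cmod_cis; lra.
  - intros E. apply (f_equal Cmod) in E. rewrite Cmod_Ci_R, Cmod_0 in E. lra.
Qed.

(* Apply the real mean value theorem to Re (conj (f y - f x) * f). *)
Lemma Cmod_mvt (f df : R -> C) (B x y : R) : x <= y ->
  (forall t, x <= t <= y -> is_derive (fun u => fst (f u)) t (fst (df t)) /\
     is_derive (fun u => snd (f u)) t (snd (df t)) /\ Cmod (df t) <= B) ->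
  Cmod (f y - f x) <= B * (y - x).
Proof.
  intros Hxy H. set (z := (f y - f x)%C).
  assert (HB : 0 <= B).
  { destruct (H x ltac:(lra)) as [_ [_ E]]. pose proof (Cmod_ge_0 (df x)). lra. }
  set (g := fun t => fst z * fst (f t) + snd z * snd (f t)).
  assert (Hd : forall t, x <= t <= y -> is_derive g t (Re (Cconj z * df t))).
  { intros t Ht. destruct (H t Ht) as [D1 [D2 _]].
    replace (Re (Cconj z * df t)) with (fst z * fst (df t) + snd z * snd (df t))
      by (unfold Re, Cconj; simpl; ring).
    apply (is_derive_plus (fun u => fst z * fst (f u)) (fun u => snd z * snd (f u)));
      apply is_derive_scal; auto. }
  destruct (MVT_gen g x y (fun t => Re (Cconj z * df t))) as [c [Hc Ec]];
    rewrite ?Rmin_left, ?Rmax_right in * by lra.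
  { intros t Ht; apply Hd; lra. }
  { intros t Ht. apply continuity_pt_filterlim, (ex_derive_continuous (V := R_NormedModule)).
    eexists; apply Hd; lra. }
  assert (Hg : g y - g x <= Cmod z * B * (y - x)).
  { rewrite Ec. apply Rmult_le_compat_r; [lra|].
    destruct (H c Hc) as [_ [_ D3]].
    eapply Rle_trans; [apply Rle_abs|]. eapply Rle_trans; [apply re_le_Cmod|].
    rewrite Cmod_mult, Cmod_conj. apply Rmult_le_compat_l; auto. apply Cmod_ge_0. }
  assert (E : g y - g x = Cmod z * Cmod z).
  { rewrite Cmod_sqr. unfold g, Re, Im. unfold z. simpl. ring. }
  rewrite E in Hg.
  pose proof (Cmod_ge_0 z). destruct (Req_dec (Cmod z) 0) as [E0|E0].
  - fold z. rewrite E0. nra.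
  - apply (Rmult_le_reg_l (Cmod z)); [lra|]. fold z. lra.
Qed.

(** * Exponential sums *)

Lemma abel_identity (z c : nat -> C) n :
  csum (fun i => c i * z i)%C (S n) =
  (csum z (S n) * c (S n) + csum (fun i => csum z i * (c i - c (S i)))%C n)%C.
Proof.
  induction n as [|n IH]; [simpl; ring|].
  rewrite csum_S, IH. rewrite (csum_S z (S n)).
    rewrite (csum_S (fun i => csum z i * (c i - c (S i)))%C n). ring.
Qed.

(** The bound [B] depends on the index because the partial sums of [cis (t ln m)] beyond [t] are
    only known to be [O(m / t)]. *)
Lemma abel_bound (z c : nat -> C) (B : nat -> R) n :
  (forall i, (1 <= i <= S n)%nat -> Cmod (csum z i) <= B i) ->
  Cmod (csum (fun i => c i * z i)%C (S n)) <=
  B (S n) * Cmod (c (S n)) + rsum (fun i => B i * Cmod (c i - c (S i))) n.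
Proof.
  intros H. rewrite abel_identity.
  eapply Rle_trans; [apply Cmod_triangle|]. apply Rplus_le_compat.
  - rewrite Cmod_mult. apply Rmult_le_compat_r; [apply Cmod_ge_0|apply H; lia].
  - apply Cmod_csum_le. intros i Hi. rewrite Cmod_mult.
    apply Rmult_le_compat_r; [apply Cmod_ge_0|apply H; lia].
Qed.

Lemma sin_ge_half x : 0 <= x <= 1 -> x / 2 <= sin x.
Proof.
  intros [H0 H1]. destruct (Req_dec x 0) as [->|Hx]; [rewrite sin_0; lra|].
  destruct (MVT_gen sin 0 x cos) as [c [Hc E]].
  - intros; auto_derive; auto; ring.
  - intros; apply continuity_sin.
  - rewrite Rmin_left, Rmax_right in Hc by lra. rewrite sin_0 in E.
    enough (1 / 2 <= cos c) by nra.
    (* The mean value point is at most 1, which is below [pi / 3]. *)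
    rewrite <- cos_PI3. pose proof PI2_3_2.
    apply cos_decr_1; lra.
Qed.

(* The solution of c * (1 - cis theta) = 1, that is 1/2 + (i/2) cot (theta/2). *)
Definition kl_cot theta := cos (theta / 2) / sin (theta / 2).
Definition kl_coef theta : C := (1 / 2, kl_cot theta / 2).

Lemma kl_coef_spec theta : 0 < theta <= 1 -> (kl_coef theta * (1 - cis theta))%C = 1%C.
Proof.
  intros H. assert (S : 0 < sin (theta / 2)) by (pose proof (sin_ge_half (theta / 2)); lra).
  unfold kl_coef, kl_cot, cis.
  replace theta with (2 * (theta / 2)) at 3 4 by field.
  rewrite cos_2a, sin_2a.
  set (s := sin (theta / 2)) in *. set (c := cos (theta / 2)).
  assert (E : c * c = 1 - s * s).
  { pose proof (sin2_cos2 (theta / 2)) as E. unfold Rsqr in E. fold s c in E. lra. }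
  apply injective_projections; simpl.
  - replace (1 / 2 * (1 + - (c * c - s * s)) - c / s / 2 * (0 + - (2 * s * c)))
      with (1 / 2 * (1 - c * c + s * s) + c * c) by fld.
    rewrite E. field.
  - replace (1 / 2 * (0 + - (2 * s * c)) + c / s / 2 * (1 + - (c * c - s * s)))
      with (c / s / 2 * (1 - s * s - c * c)) by fld.
    rewrite E. ring.
Qed.

Lemma kl_cot_bound theta : 0 < theta <= 1 -> 0 <= kl_cot theta <= 4 / theta.
Proof.
  intros H. pose proof (sin_ge_half (theta / 2) ltac:(lra)) as S.
  pose proof PI2_3_2.
  assert (0 <= cos (theta / 2)) by (apply cos_ge_0; lra).
  pose proof (COS_bound (theta / 2)).
  unfold kl_cot. split.
  - apply Rmult_le_pos; [lra|apply Rlt_le, Rinv_0_lt_compat; lra].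
  - apply Rmult_le_reg_r with (sin (theta / 2)); [lra|].
    unfold Rdiv at 1. rewrite Rmult_assoc, Rinv_l by lra.
    apply Rle_trans with (4 / theta * (theta / 2 / 2)).
    + replace (4 / theta * (theta / 2 / 2)) with 1 by (field; lra). lra.
    + apply Rmult_le_compat_l; [|lra].
      apply Rmult_le_pos; [lra|apply Rlt_le, Rinv_0_lt_compat; lra].
Qed.

Lemma kl_cot_mono u v : 0 < v -> v <= u -> u <= 1 -> kl_cot u <= kl_cot v.
Proof.
  intros H1 H2 H3.
  pose proof (sin_ge_half (u / 2) ltac:(lra)). pose proof (sin_ge_half (v / 2) ltac:(lra)).
  pose proof (sin_ge_half (u / 2 - v / 2) ltac:(lra)) as S. rewrite sin_minus in S.
  unfold kl_cot.
  set (su := sin (u / 2)) in *. set (sv := sin (v / 2)) in *.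
  set (cu := cos (u / 2)) in *. set (cv := cos (v / 2)) in *.
  enough (0 <= cv / sv - cu / su) by lra.
  replace (cv / sv - cu / su) with ((su * cv - cu * sv) / (su * sv)) by fld.
  apply Rmult_le_pos; [lra|apply Rlt_le, Rinv_0_lt_compat; nra].
Qed.

Lemma Cmod_kl_coef theta : 0 < theta <= 1 -> Cmod (kl_coef theta) <= 1 / 2 + kl_cot theta / 2.
Proof.
  intros H. pose proof (kl_cot_bound theta H).
  pose proof (Cmod_sqr (kl_coef theta)) as E. unfold kl_coef, Re, Im in E; simpl in E.
  fold (kl_coef theta) in E. nra.
Qed.

(* Partial summation against kl_coef of the increments, whose imaginary parts are monotone. *)
Lemma kusmin_landau (phi : nat -> R) (delta : R) n :
  0 < delta ->
  (forall i, (1 <= i <= n)%nat -> delta <= phi (S i) - phi i <= 1) ->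
  (forall i, (1 <= i < n)%nat -> phi (S (S i)) - phi (S i) <= phi (S i) - phi i) ->
  Cmod (csum (fun i => cis (phi i)) n) <= 7 / delta.
Proof.
  intros Hd H1 H2. set (th := fun i => phi (S i) - phi i) in *.
  assert (Pinv : 0 < / delta) by (apply Rinv_0_lt_compat; auto).
  destruct n as [|n]; [simpl; rewrite Cmod_0; unfold Rdiv; nra|].
  (* Each term is [kl_coef] times a difference of consecutive terms, which prepares a telescoping
     sum. *)
  assert (K : forall i, (1 <= i <= S n)%nat ->
    cis (phi i) = (kl_coef (th i) * (cis (phi i) - cis (phi (S i))))%C).
  { intros i Hi. specialize (H1 i Hi). fold (th i) in H1.
    replace (phi (S i)) with (th i + phi i) by (unfold th; ring).
    rewrite cis_plus.
    replace (kl_coef (th i) * (cis (phi i) - cis (th i) * cis (phi i)))%C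
      with (kl_coef (th i) * (1 - cis (th i)) * cis (phi i))%C by ring.
    rewrite kl_coef_spec by lra. ring. }
  (* All coefficients have real part 1/2, so consecutive ones differ by a purely imaginary number;
     its sign is constant because the increments decrease, and the moduli of the differences
     telescope. *)
  assert (I : forall m, (m <= n)%nat ->
    Cmod (csum (fun i => cis (phi i)) (S m) + kl_coef (th (S m)) * cis (phi (S (S m)))) <=
    Cmod (kl_coef (th 1%nat)) + (kl_cot (th (S m)) - kl_cot (th 1%nat)) / 2).
  { induction m as [|m IH]; intros Hm.
    - simpl csum. rewrite (K 1%nat) at 1 by lia.
      replace (0 + kl_coef (th 1%nat) * (cis (phi 1%nat) - cis (phi 2%nat)) +
        kl_coef (th 1%nat) * cis (phi 2%nat))%C with (kl_coef (th 1%nat) * cis (phi 1%nat))%C by ring.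
      rewrite Cmod_mult, Cmod_cis. lra.
    - rewrite csum_S. rewrite (K (S (S m))) at 1 by lia.
      replace (csum (fun i => cis (phi i)) (S m) +
        kl_coef (th (S (S m))) * (cis (phi (S (S m))) - cis (phi (S (S (S m))))) +
        kl_coef (th (S (S m))) * cis (phi (S (S (S m)))))%C with
        (csum (fun i => cis (phi i)) (S m) + kl_coef (th (S m)) * cis (phi (S (S m))) +
         (kl_coef (th (S (S m))) - kl_coef (th (S m))) * cis (phi (S (S m))))%C by ring.
      eapply Rle_trans; [apply Cmod_triangle|].
      specialize (IH ltac:(lia)).
      rewrite Cmod_mult, Cmod_cis, Rmult_1_r.
      assert (E : kl_cot (th (S m)) <= kl_cot (th (S (S m)))).
      { pose proof (H1 (S m) ltac:(lia)). pose proof (H1 (S (S m)) ltac:(lia)).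
        pose proof (H2 (S m) ltac:(lia)).
        apply kl_cot_mono; unfold th; lra. }
      replace (kl_coef (th (S (S m))) - kl_coef (th (S m)))%C with
        (Ci * RtoC ((kl_cot (th (S (S m))) - kl_cot (th (S m))) / 2))%C.
      + rewrite Cmod_Ci_R, Rabs_pos_eq by lra. lra.
      + unfold kl_coef. apply injective_projections; simpl; field. }
  specialize (I n (le_n n)).
  assert (B : forall i, (1 <= i <= S n)%nat -> Cmod (kl_coef (th i)) <= 1 / 2 + 2 / delta /\
     0 <= kl_cot (th i) <= 4 / delta).
  { intros i Hi. specialize (H1 i Hi). fold (th i) in H1.
    pose proof (kl_cot_bound (th i) ltac:(lra)).
    pose proof (Cmod_kl_coef (th i) ltac:(lra)).
    assert (4 / th i <= 4 / delta).
    { apply Rmult_le_compat_l; [lra|]. apply Rinv_le_contravar; lra. }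
    unfold Rdiv in *. split; [lra|split; lra]. }
  destruct (B 1%nat ltac:(lia)) as [B1 B2]. destruct (B (S n) ltac:(lia)) as [B3 B4].
  specialize (H1 1%nat ltac:(lia)).
  (* The three contributions add up to [1 + 6 / delta], and [delta <= 1] absorbs the 1. *)
  assert (1 <= / delta) by (rewrite <- Rinv_1; apply Rinv_le_contravar; lra).
  replace (csum (fun i => cis (phi i)) (S n)) with
    (csum (fun i => cis (phi i)) (S n) + kl_coef (th (S n)) * cis (phi (S (S n)))
     - kl_coef (th (S n)) * cis (phi (S (S n))))%C by ring.
  eapply Rle_trans; [apply Cmod_minus_le|].
  rewrite (Cmod_mult (kl_coef _)), Cmod_cis. unfold Rdiv in *. lra.
Qed.

(** * Dirichlet polynomials on the critical line *)

Definition dpoly (M : nat) (t : R) : C :=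
  csum (fun m => RtoC (/ sqrt (INR m)) * cis (- (t * ln (INR m))))%C M.

Lemma dpoly_conj M t : Cconj (dpoly M t) = dpoly M (- t).
Proof.
  unfold dpoly. rewrite csum_conj. apply csum_ext; intros i Hi.
  unfold Cconj, cis; apply injective_projections; simpl.
  - rewrite !cos_neg. rewrite <- Ropp_mult_distr_l, cos_neg. ring.
  - rewrite <- Ropp_mult_distr_l, Ropp_involutive, sin_neg. ring.
Qed.

Lemma Cmod_dpoly_trivial M t : Cmod (dpoly M t) <= 2 * sqrt (INR M).
Proof.
  eapply Rle_trans; [|apply rsum_inv_sqrt]. apply Cmod_csum_le; intros i Hi.
  rewrite Cmod_mult, Cmod_cis, Cmod_R, Rmult_1_r.
  rewrite Rabs_pos_eq; [lra|]. apply Rlt_le, Rinv_0_lt_compat, sqrt_lt_R0, lt_0_INR; lia.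
Qed.

Lemma ln_step x : 0 < x -> / (x + 1) <= ln (x + 1) - ln x <= / x.
Proof.
  intros H. rewrite <- ln_div by lra.
  assert (0 < (x + 1) / x) by (apply Rdiv_lt_0_compat; lra).
  pose proof (ln_le_sub _ H0). pose proof (ln_ge_sub _ H0).
  replace ((x + 1) / x - 1) with (/ x) in * by fld.
  replace (1 - / ((x + 1) / x)) with (/ (x + 1)) in * by fld. lra.
Qed.

(** Beyond [t] the phase [t ln x] advances by at most 1 per step, by at least [t] over the last
    index, and ever more slowly: Kusmin-Landau applies directly. *)
Lemma zsum_long (t : R) (p n : nat) : 0 < t -> t <= INR p -> (1 <= p)%nat ->
  Cmod (csum (fun i => cis (t * ln (INR (p + i)))) n) <= 14 * INR (p + n) / t.
Proof.
  intros Ht Hp Hp1.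
  destruct n as [|n].
  { simpl. rewrite Cmod_0. pose proof (pos_INR (p + 0)).
    apply Rmult_le_pos; [lra|apply Rlt_le, Rinv_0_lt_compat, Ht]. }
  eapply Rle_trans.
  - apply (kusmin_landau (fun i => t * ln (INR (p + i))) (t / (INR (p + S n) + 1))).
    + apply Rdiv_lt_0_compat; [lra|]. pose proof (pos_INR (p + S n)); lra.
    + intros i Hi. rewrite (Nat.add_succ_r p i), S_INR.
      rewrite <- Rmult_minus_distr_l.
      pose proof (lt_0_INR (p + i) ltac:(lia)) as P.
      pose proof (ln_step _ P) as [L1 L2].
      assert (INR (p + i) <= INR (p + S n)) by (apply le_INR; lia).
      assert (INR p <= INR (p + i)) by (apply le_INR; lia).
      split.
      * apply Rmult_le_compat_l; [lra|]. eapply Rle_trans; [|exact L1].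
        apply Rinv_le_contravar; lra.
      * apply Rle_trans with (t * / INR (p + i)); [apply Rmult_le_compat_l; lra|].
        apply (Rmult_le_reg_r (INR (p + i))); [lra|]. rewrite Rmult_assoc, Rinv_l; lra.
    + intros i Hi. rewrite !(Nat.add_succ_r p), !S_INR.
      pose proof (lt_0_INR (p + i) ltac:(lia)) as P.
      rewrite <- !Rmult_minus_distr_l. apply Rmult_le_compat_l; [lra|].
      rewrite <- !ln_div by lra. apply ln_le; [apply Rdiv_lt_0_compat; lra|].
      set (x := INR (p + i)) in *. unfold Rdiv.
      replace ((x + 1 + 1) * / (x + 1)) with (1 + / (x + 1)) by fld.
      replace ((x + 1) * / x) with (1 + / x) by fld.
      apply Rplus_le_compat_l, Rinv_le_contravar; lra.
  - assert (1 <= INR (p + S n)) by (apply INR_ge1; lia).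
    replace (7 / (t / (INR (p + S n) + 1))) with (7 * (INR (p + S n) + 1) / t) by fld.
    apply Rmult_le_compat_r; [apply Rlt_le, Rinv_0_lt_compat, Ht|]. lra.
Qed.

Lemma csum_cis_neg (f : nat -> R) n :
  Cmod (csum (fun i => cis (- f i)) n) = Cmod (csum (fun i => cis (f i)) n).
Proof.
  rewrite <- (Cmod_conj (csum (fun i => cis (f i)) n)), csum_conj.
  f_equal. apply csum_ext; intros. rewrite cis_conj. reflexivity.
Qed.

Lemma inv_sqrt_step x : 0 < x ->
  0 <= / sqrt x - / sqrt (x + 1) <= / (2 * x * sqrt x).
Proof.
  intros H. assert (P : 0 < sqrt x) by (apply sqrt_lt_R0; lra).
  assert (Q : sqrt x <= sqrt (x + 1)) by (apply sqrt_le_1; lra).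
  assert (E : sqrt x * sqrt x = x) by (apply sqrt_sqrt; lra).
  assert (F : sqrt (x + 1) * sqrt (x + 1) = x + 1) by (apply sqrt_sqrt; lra).
  set (u := sqrt x) in *. set (v := sqrt (x + 1)) in *.
  assert (G : / u - / v = / (u * v * (u + v))).
  { apply (Rmult_eq_reg_r (u * v * (u + v))); [|apply Rgt_not_eq; nra].
    rewrite Rinv_l by (apply Rgt_not_eq; nra).
    replace ((/ u - / v) * (u * v * (u + v))) with (v * v - u * u) by fld. lra. }
  rewrite G. split.
  - apply Rlt_le, Rinv_0_lt_compat. nra.
  - apply Rinv_le_contravar; [nra|]. rewrite <- E. nra.
Qed.

Lemma dpoly_add p n t :
  dpoly (p + n) t = (dpoly p t +
    csum (fun i => RtoC (/ sqrt (INR (p + i))) * cis (- (t * ln (INR (p + i)))))%C n)%C.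
Proof. apply csum_add. Qed.

Lemma wsum_bound (t : R) (p n : nat) (B : nat -> R) : (1 <= p)%nat ->
  (forall i, (1 <= i <= S n)%nat -> Cmod (csum (fun i => cis (t * ln (INR (p + i)))) i) <= B i) ->
  Cmod (csum (fun i => RtoC (/ sqrt (INR (p + i))) * cis (- (t * ln (INR (p + i)))))%C (S n)) <=
  B (S n) * / sqrt (INR (p + S n)) +
  rsum (fun i => B i * (/ sqrt (INR (p + i)) - / sqrt (INR (p + S i)))) n.
Proof.
  intros Hp HB.
  eapply Rle_trans.
  - apply (abel_bound (fun i => cis (- (t * ln (INR (p + i)))))
     (fun i => RtoC (/ sqrt (INR (p + i)))) B).
    intros i Hi. rewrite csum_cis_neg. auto.
  - apply Req_le. f_equal.
    + rewrite Cmod_R. f_equal. apply Rabs_pos_eq.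
      apply Rlt_le, Rinv_0_lt_compat, sqrt_lt_R0, lt_0_INR; lia.
    + apply rsum_ext; intros i Hi.
      rewrite <- RtoC_minus, Cmod_R. f_equal.
      apply Rabs_pos_eq. rewrite (Nat.add_succ_r p i), S_INR.
      apply inv_sqrt_step, lt_0_INR; lia.
Qed.

(** Partial summation of [zsum_long] against [x^(-1/2)]. Half of the constant is the boundary term,
    the other half the sum of [7 / (t sqrt x)]. *)
Lemma dpoly_long (t : R) (p M : nat) : 0 < t -> t <= INR p -> (1 <= p <= M)%nat ->
  Cmod (dpoly M t - dpoly p t) <= 28 * sqrt (INR M) / t.
Proof.
  intros Ht Hp [Hp1 HM].
  replace M with (p + (M - p))%nat by lia. set (n := (M - p)%nat). clearbody n.
  rewrite dpoly_add.
  assert (Pt : 0 < / t) by (apply Rinv_0_lt_compat; auto).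
  replace (dpoly p t + csum (fun i => RtoC (/ sqrt (INR (p + i))) * cis (- (t * ln (INR (p + i)))))%C n - dpoly p t)%C
    with (csum (fun i => RtoC (/ sqrt (INR (p + i))) * cis (- (t * ln (INR (p + i)))))%C n) by ring.
  destruct n as [|n].
  { simpl. rewrite Cmod_0. apply Rmult_le_pos; [|lra].
    pose proof (sqrt_pos (INR (p + 0))); lra. }
  eapply Rle_trans.
  - apply wsum_bound with (B := fun i => 14 * INR (p + i) / t); [lia|].
    intros i Hi. apply zsum_long; auto.
  - assert (P : 0 < INR (p + S n)) by (apply lt_0_INR; lia).
    assert (Q : 0 < sqrt (INR (p + S n))) by (apply sqrt_lt_R0; auto).
    replace (28 * sqrt (INR (p + S n)) / t) with
      (14 * INR (p + S n) / t * / sqrt (INR (p + S n)) + 14 / t * sqrt (INR (p + S n))).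
    2: { rewrite <- (sqrt_sqrt (INR (p + S n))) at 1 by lra. fld. }
    apply Rplus_le_compat_l.
    apply Rle_trans with (7 / t * (rsum (fun i => / sqrt (INR (p + i))) n)).
    + rewrite <- rsum_scal. apply rsum_le; intros i Hi.
      assert (Pi : 0 < INR (p + i)) by (apply lt_0_INR; lia).
      pose proof (inv_sqrt_step _ Pi) as [S1 S2].
      rewrite (Nat.add_succ_r p i), S_INR.
      assert (Qi : 0 < sqrt (INR (p + i))) by (apply sqrt_lt_R0; auto).
      apply Rle_trans with (14 * INR (p + i) / t * / (2 * INR (p + i) * sqrt (INR (p + i)))).
      * apply Rmult_le_compat_l; [|lra]. unfold Rdiv. apply Rmult_le_pos; lra.
      * apply Req_le. fld.
    + assert (E : rsum (fun i => / sqrt (INR (p + i))) n <= 2 * sqrt (INR (p + n))).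
      { eapply Rle_trans; [|apply rsum_inv_sqrt]. rewrite rsum_add.
        enough (0 <= rsum (fun i => / sqrt (INR i)) p) by lra.
        apply rsum_ge0; intros. apply Rlt_le, Rinv_0_lt_compat, sqrt_lt_R0, lt_0_INR; lia. }
      assert (E2 : sqrt (INR (p + n)) <= sqrt (INR (p + S n))).
      { apply sqrt_le_1; [apply pos_INR|lra|apply le_INR; lia]. }
      unfold Rdiv. nra.
Qed.

Lemma rsum_cauchy_schwarz f n :
  rsum f n * rsum f n <= INR n * rsum (fun i => f i * f i) n.
Proof.
  induction n as [|n IH]; [simpl; lra|].
  rewrite S_INR, !rsum_S.
  set (s := rsum f n) in *. set (q := rsum (fun i => f i * f i) n) in *. set (x := f (S n)).
  destruct n as [|n].
  - unfold s, q. simpl. nra.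
  - pose proof (INR_S_pos n) as P. set (N := INR (S n)) in *.
    (* Times [N] this is the sum of [s^2 <= N q], known by induction, and [0 <= (N x - s)^2]. *)
    enough (2 * s * x <= q + N * (x * x)) by nra.
    apply (Rmult_le_reg_l N); [lra|].
    pose proof (Rle_0_sqr (N * x - s)) as R0. unfold Rsqr in R0. nra.
Qed.

(* The differenced phase t (ln (x + d) - ln x) has second difference about t d / x^2. *)
Lemma zsum_diff (t : R) (p L q q' : nat) : (1 <= p)%nat -> (q' < q)%nat -> (L + q + 1 <= 4 * p)%nat ->
  0 < t -> t * INR (q - q') <= INR p * INR p ->
  Cmod (csum (fun i => cis (t * (ln (INR (p + i + q)) - ln (INR (p + i + q'))))) L)
    <= 175 * (INR p * INR p / t) * / INR (q - q').
Proof.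
  intros Hp Hq HL Ht Hd.
  set (d := INR (q - q')) in *.
  assert (Pp : 1 <= INR p) by (apply INR_ge1; lia).
  assert (Pd1 : 1 <= d) by (apply INR_ge1; lia).
  (* The phase decreases in [i], whereas Kusmin-Landau wants positive increments; conjugation
     reverses its sign. *)
  rewrite <- csum_cis_neg.
  assert (F : forall i, (i <= L)%nat ->
    - (t * (ln (INR (p + S i + q)) - ln (INR (p + S i + q')))) -
    - (t * (ln (INR (p + i + q)) - ln (INR (p + i + q')))) =
    t * ln (1 + d / (INR (p + i + q') * (INR (p + i + q) + 1)))).
  { intros i Hi.
    replace (p + S i + q)%nat with (S (p + i + q)) by lia.
    replace (p + S i + q')%nat with (S (p + i + q')) by lia.
    rewrite !S_INR.
    assert (E : d = INR (p + i + q) - INR (p + i + q')).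
    { unfold d. rewrite minus_INR, !plus_INR by lia. ring. }
    rewrite E.
    assert (0 < INR (p + i + q')) by (apply lt_0_INR; lia).
    set (x := INR (p + i + q)) in *. set (y := INR (p + i + q')) in *.
    replace (1 + (x - y) / (y * (x + 1))) with (((y + 1) * x) / (y * (x + 1))) by fld.
    rewrite ln_div, !ln_mult by nra. ring. }
  (* 175 is 7 times 25: both factors in the denominators of the increments are at most [5 p], by
     [L + q + 1 <= 4 p]. *)
  replace (175 * (INR p * INR p / t) * / d) with (7 / (t * d / (25 * (INR p * INR p)))) by fld.
  apply (kusmin_landau (fun i => - (t * (ln (INR (p + i + q)) - ln (INR (p + i + q')))))).
  - apply Rdiv_lt_0_compat; nra.
  - intros i Hi. rewrite F by lia.
    assert (P1 : INR p <= INR (p + i + q')) by (apply le_INR; lia).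
    assert (P3 : INR (p + i + q) + 1 <= 5 * INR p).
    { rewrite <- S_INR. replace (5 * INR p) with (INR (5 * p)) by (rewrite mult_INR; simpl; ring).
      apply le_INR; lia. }
    assert (E : d = INR (p + i + q) - INR (p + i + q')).
    { unfold d. rewrite minus_INR, !plus_INR by lia. ring. }
    set (x := INR (p + i + q)) in *. set (y := INR (p + i + q')) in *.
    assert (Pr : 0 < d / (y * (x + 1))) by (apply Rdiv_lt_0_compat; nra).
    pose proof (ln_le_sub (1 + d / (y * (x + 1))) ltac:(lra)) as U.
    pose proof (ln_ge_sub (1 + d / (y * (x + 1))) ltac:(lra)) as V.
    replace (1 - / (1 + d / (y * (x + 1)))) with (d / ((y + 1) * x)) in V
      by (rewrite E; field; repeat split; apply Rgt_not_eq; nra).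
    split.
    + apply Rle_trans with (t * (d / ((y + 1) * x))); [|apply Rmult_le_compat_l; lra].
      unfold Rdiv. rewrite Rmult_assoc. apply Rmult_le_compat_l; [lra|].
      apply Rmult_le_compat_l; [lra|]. apply Rinv_le_contravar; nra.
    + apply Rle_trans with (t * (d / (y * (x + 1)))).
      * apply Rmult_le_compat_l; lra.
      * apply (Rmult_le_reg_r (y * (x + 1))); [nra|].
        replace (t * (d / (y * (x + 1))) * (y * (x + 1))) with (t * d) by fld. nra.
  - intros i Hi. rewrite !F by lia. apply Rmult_le_compat_l; [lra|].
    assert (P1 : INR p <= INR (p + i + q')) by (apply le_INR; lia).
    assert (P2 : INR p <= INR (p + i + q)) by (apply le_INR; lia).
    replace (p + S i + q)%nat with (S (p + i + q)) by lia.
    replace (p + S i + q')%nat with (S (p + i + q')) by lia.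
    rewrite !S_INR.
    set (x := INR (p + i + q)) in *. set (y := INR (p + i + q')) in *.
    apply ln_le.
    + assert (0 < d / ((y + 1) * (x + 1 + 1))) by (apply Rdiv_lt_0_compat; nra). lra.
    + apply Rplus_le_compat_l. unfold Rdiv. apply Rmult_le_compat_l; [lra|].
      apply Rinv_le_contravar; nra.
Qed.

(** A shift by [q] trades [q] terms at the start for [q] terms at the end. *)
Lemma csum_shift_diff (f : nat -> C) L q : (forall i, Cmod (f i) <= 1) ->
  Cmod (csum f L - csum (fun i => f (i + q)%nat) L) <= 2 * INR q.
Proof.
  intros H.
  assert (E : (csum f L + csum (fun i => f (L + i)%nat) q)%C =
    (csum f q + csum (fun i => f (q + i)%nat) L)%C).
  { rewrite <- !csum_add. f_equal. lia. }
  assert (E2 : csum (fun i => f (i + q)%nat) L = csum (fun i => f (q + i)%nat) L).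
  { apply csum_ext; intros; f_equal; lia. }
  replace (csum f L - csum (fun i => f (i + q)%nat) L)%C with
    (csum f q - csum (fun i => f (L + i)%nat) q)%C.
  2: { rewrite E2. replace (csum f L) with ((csum f L + csum (fun i => f (L + i)%nat) q) -
         csum (fun i => f (L + i)%nat) q)%C by ring. rewrite E. ring. }
  eapply Rle_trans; [apply Cmod_minus_le|].
  assert (B : forall g : nat -> C, (forall i, Cmod (g i) <= 1) -> Cmod (csum g q) <= INR q).
  { intros g Hg. rewrite <- (Rmult_1_r (INR q)), <- rsum_const. apply Cmod_csum_le; auto. }
  pose proof (B f H). pose proof (B (fun i => f (L + i)%nat) (fun i => H _)). lra.
Qed.

(** Expand the square and sum over [i] first; the inner sums are the differenced exponential sums of
    van der Corput. *)
Lemma rsum_Cmod_sqr (w : nat -> nat -> C) L Q :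
  rsum (fun i => Cmod (csum (w i) Q) * Cmod (csum (w i) Q)) L <=
  rsum (fun q => rsum (fun q' => Cmod (csum (fun i => w i q * Cconj (w i q'))%C L)) Q) Q.
Proof.
  assert (E : RtoC (rsum (fun i => Cmod (csum (w i) Q) * Cmod (csum (w i) Q)) L) =
    csum (fun q => csum (fun q' => csum (fun i => w i q * Cconj (w i q'))%C L) Q) Q).
  { rewrite <- csum_RtoC.
    transitivity (csum (fun i => csum (fun q => csum (fun q' => w i q * Cconj (w i q'))%C Q) Q) L).
    - apply csum_ext; intros i Hi. rewrite <- csum_mult, <- csum_conj.
      rewrite Cmod_sqr. unfold Re, Im, Cconj. apply injective_projections; simpl; ring.
    - rewrite csum_swap. apply csum_ext; intros q Hq. rewrite csum_swap. reflexivity. }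
  eapply Rle_trans; [apply Rle_abs|]. rewrite <- Cmod_R, E.
  apply Cmod_csum_le; intros q Hq. apply Cmod_csum.
Qed.

(** Van der Corput differencing with [t = r^2] and about [p / r] shifts. In the square of the sum
    the diagonal shifts cost [p^2 / Q], of size [p r]; because [p <= 2 t], the others cost only a
    logarithm more. *)
Lemma weyl_block (r : R) (p L : nat) : 1 <= r -> r <= INR p -> INR p <= 2 * (r * r) ->
  (L <= 2 * p)%nat ->
  Cmod (csum (fun i => cis ((r * r) * ln (INR (p + i)))) L) <=
    80 * (3 + ln (r * r)) * sqrt (INR p * r).
Proof.
  intros Hr Hp Hp2 HL.
  set (t := r * r) in *.
  destruct (nfloor_ex (INR p / r)) as [Q [Q1 Q2]].
  { apply Rlt_le, Rdiv_lt_0_compat; lra. }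
  assert (Pr1 : 1 <= INR p / r).
  { apply (Rmult_le_reg_r r); [lra|]. unfold Rdiv. rewrite Rmult_assoc, Rinv_l; lra. }
  assert (HQ1 : (1 <= Q)%nat).
  { destruct Q; [simpl in Q2; lra|lia]. }
  assert (HQ : 1 <= INR Q) by (apply INR_ge1; auto).
  assert (Q3 : INR Q * r <= INR p).
  { replace (INR p) with (INR p / r * r) by fld. apply Rmult_le_compat_r; lra. }
  assert (Q4 : INR p <= 2 * INR Q * r).
  { replace (INR p) with (INR p / r * r) by fld. apply Rmult_le_compat_r; lra. }
  assert (HQp : (Q <= p)%nat) by (apply INR_le; nra).
  assert (Hp1 : (1 <= p)%nat) by lia.
  set (P := INR p) in *. set (q_ := INR Q) in *.
  set (z := fun i => cis (t * ln (INR (p + i)))).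
  set (S := csum z L).
  set (w := fun i q => z (i + q)%nat).
  set (Y := csum (fun i => csum (w i) Q) L).
  assert (T0 : 1 <= t) by (unfold t; nra).
  (* Each of the [Q] shifts alters the sum by at most [2 Q], an error which stays below the final
     bound (see [A8]). *)
  assert (A1 : Cmod (RtoC q_ * S - Y) <= q_ * (2 * q_)).
  { unfold Y. rewrite csum_swap.
    replace (RtoC q_ * S)%C with (csum (fun q => S) Q).
    - rewrite <- csum_minus. unfold q_. rewrite <- rsum_const.
      apply Cmod_csum_le. intros q Hq.
      eapply Rle_trans; [apply (csum_shift_diff z)|].
      + intros; unfold z; rewrite Cmod_cis; lra.
      + apply Rmult_le_compat_l; [lra|]. apply le_INR; lia.
    - unfold q_. clear. induction Q as [|Q IH].
      + simpl; ring.
      + rewrite csum_S, IH, S_INR, RtoC_plus. ring. }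
  set (W := rsum (fun i => Cmod (csum (w i) Q) * Cmod (csum (w i) Q)) L).
  assert (A2 : Cmod Y * Cmod Y <= 2 * P * W).
  { apply Rle_trans with (INR L * W).
    - apply Rle_trans with (rsum (fun i => Cmod (csum (w i) Q)) L * rsum (fun i => Cmod (csum (w i) Q)) L).
      + apply Rmult_le_compat; auto using Cmod_ge_0; apply Cmod_csum.
      + apply (rsum_cauchy_schwarz (fun i => Cmod (csum (w i) Q))).
    - apply Rmult_le_compat_r.
      + apply rsum_ge0; intros. apply Rle_0_sqr.
      + unfold P. replace 2 with (INR 2) by reflexivity. rewrite <- mult_INR. apply le_INR; lia. }
  assert (A3 : W <= q_ * (16 * P + 700 * (P * P / t) * harmonic Q)).
  { eapply Rle_trans; [apply rsum_Cmod_sqr|].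
    unfold q_. rewrite <- rsum_const. apply rsum_le; intros q Hq.
    (* The diagonal term is dominated by a summable majorant concentrated at [q' = q], so the case
       distinction disappears before summing over [q']. *)
    apply Rle_trans with (rsum (fun q' => 2 * P * / ((1 + Rabs (INR q' - INR q)) * (1 + Rabs (INR q' - INR q)))
       + 350 * (P * P / t) * / (1 + Rabs (INR q' - INR q))) Q).
    - apply rsum_le; intros q' Hq'.
      assert (PP : 0 < P * P / t) by (apply Rdiv_lt_0_compat; nra).
      assert (D : forall u v, (1 <= u <= Q)%nat -> (1 <= v < u)%nat ->
        Cmod (csum (fun i => cis (t * (ln (INR (p + i + u)) - ln (INR (p + i + v))))) L) <=
        350 * (P * P / t) * / (1 + Rabs (INR v - INR u))).
      { intros u v Hu Hv. eapply Rle_trans; [apply zsum_diff; try lia; try lra|].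
        - apply Rle_trans with (t * q_).
          + apply Rmult_le_compat_l; [lra|]. apply le_INR; lia.
          + unfold t. fold P. nra.
        - fold P.
          assert (1 <= INR (u - v)) by (apply INR_ge1; lia).
          rewrite Rabs_left1, minus_INR by (try lia; assert (INR v <= INR u) by (apply le_INR; lia); lra).
          rewrite minus_INR in H by lia.
          replace (350 * (P * P / t)) with (175 * (P * P / t) * 2) by ring.
          rewrite !(Rmult_assoc (175 * (P * P / t))). apply Rmult_le_compat_l; [lra|].
          replace (1 + - (INR v - INR u)) with (1 + (INR u - INR v)) by ring.
          set (d := INR u - INR v) in *.
          replace (2 * / (1 + d)) with (/ ((1 + d) / 2)) by fld.
          apply Rinv_le_contravar; lra. }
      assert (Ew : Cmod (csum (fun i => w i q * Cconj (w i q'))%C L) =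
        Cmod (csum (fun i => cis (t * (ln (INR (p + i + q)) - ln (INR (p + i + q'))))) L)).
      { f_equal. apply csum_ext; intros i Hi. unfold w, z.
        rewrite cis_conj, <- cis_plus, !Nat.add_assoc. f_equal. ring. }
      rewrite Ew.
      assert (P0 : 0 <= 2 * P * / ((1 + Rabs (INR q' - INR q)) * (1 + Rabs (INR q' - INR q)))).
      { apply Rmult_le_pos; [lra|]. apply Rlt_le, Rinv_0_lt_compat. pose proof (Rabs_pos (INR q' - INR q)). nra. }
      assert (P1 : 0 <= 350 * (P * P / t) * / (1 + Rabs (INR q' - INR q))).
      { apply Rmult_le_pos; [lra|]. apply Rlt_le, Rinv_0_lt_compat. pose proof (Rabs_pos (INR q' - INR q)). lra. }
      destruct (Nat.lt_trichotomy q' q) as [C|[C|C]].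
      + eapply Rle_trans; [apply D; lia|]. lra.
      + subst q'. eapply Rle_trans; [apply Cmod_csum|].
        rewrite (rsum_ext _ (fun _ => 1)) by (intros; apply Cmod_cis).
        rewrite rsum_const, Rmult_1_r. rewrite Rminus_diag, Rabs_R0 in *.
        apply Rle_trans with (2 * P).
        * unfold P. replace 2 with (INR 2) by reflexivity. rewrite <- mult_INR. apply le_INR; lia.
        * replace (2 * P * / ((1 + 0) * (1 + 0))) with (2 * P) by (field; lra). lra.
      + rewrite <- csum_cis_neg.
        rewrite (csum_ext _ (fun i => cis (t * (ln (INR (p + i + q')) - ln (INR (p + i + q)))))).
        * rewrite Rabs_minus_sym in *. eapply Rle_trans; [apply D; lia|]. lra.
        * intros. f_equal. ring.
    - rewrite rsum_plus, !rsum_scal.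
      pose proof (rsum_inv_dist (INR q) Q). pose proof (rsum_inv_dist_sq (INR q) Q).
      assert (PP : 0 < P * P / t) by (apply Rdiv_lt_0_compat; nra).
      assert (350 * (P * P / t) * rsum (fun m => / (1 + Rabs (INR m - INR q))) Q <=
         350 * (P * P / t) * (2 * harmonic Q)) by (apply Rmult_le_compat_l; lra).
      assert (2 * P * rsum (fun m => / ((1 + Rabs (INR m - INR q)) * (1 + Rabs (INR m - INR q)))) Q <= 2 * P * 8)
        by (apply Rmult_le_compat_l; lra).
      lra. }
  assert (A4 : harmonic Q <= 2 + ln t).
  { pose proof (harmonic_upper Q HQ1). fold q_ in H.
    assert (ln q_ <= 1 + ln t); [|lra].
    apply Rle_trans with (ln (2 * t)).
    - apply ln_le; [lra|]. apply Rle_trans with (q_ * r); [nra|lra].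
    - rewrite ln_mult by lra. pose proof (ln_le_sub 2). lra. }
  assert (L0 : 0 <= ln t) by (apply ln_nonneg; lra).
  set (l := 3 + ln t) in *.
  set (U := sqrt (P * r)).
  assert (HU : U * U = P * r) by (apply sqrt_sqrt; nra).
  assert (HU0 : 0 < U) by (apply sqrt_lt_R0; nra).
  pose proof (harmonic_ge0 Q) as H0.
  (* (|Y|/Q)^2 <= 5700 P r l *)
  assert (A5 : Cmod Y <= q_ * (76 * l * U)).
  { pose proof (Cmod_ge_0 Y).
    apply Rsqr_incr_0_var; [|apply Rmult_le_pos; [lra|unfold l; nra]].
    unfold Rsqr. eapply Rle_trans; [apply A2|].
    assert (B1 : P * P / t <= 2 * P).
    { apply (Rmult_le_reg_r t); [lra|]. replace (P * P / t * t) with (P * P) by fld. nra. }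
    assert (B2 : P * P / t * r <= 2 * P * r) by (apply Rmult_le_compat_r; lra).
    assert (B3 : W <= q_ * (16 * P + 700 * (2 * P) * (l - 1))).
    { eapply Rle_trans; [exact A3|]. apply Rmult_le_compat_l; [lra|].
      apply Rplus_le_compat_l. apply Rmult_le_compat; try lra.
      - apply Rmult_le_pos; [lra|]. apply Rlt_le, Rdiv_lt_0_compat; nra.
      - unfold l; lra. }
    assert (B3' : W <= q_ * (1400 * P * l)).
    { eapply Rle_trans; [exact B3|]. apply Rmult_le_compat_l; [lra|]. nra. }
    replace (q_ * (76 * l * U) * (q_ * (76 * l * U))) with (5776 * (q_ * q_) * (l * l) * (U * U)) by ring.
    rewrite HU.
    apply Rle_trans with (2 * P * (q_ * (1400 * P * l))).
    - apply Rmult_le_compat_l; lra.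
    - apply Rle_trans with (2 * P * (q_ * (1400 * (2 * q_ * r) * l))).
      + apply Rmult_le_compat_l; [lra|]. apply Rmult_le_compat_l; [lra|].
        apply Rmult_le_compat_r; [unfold l; lra|]. lra.
      + assert (0 <= P * (q_ * q_) * r) by (apply Rmult_le_pos; [|lra]; apply Rmult_le_pos; nra).
        assert (l <= l * l) by (unfold l in *; nra).
        replace (2 * P * (q_ * (1400 * (2 * q_ * r) * l))) with (5600 * (P * (q_ * q_) * r) * l) by ring.
        replace (5776 * (q_ * q_) * (l * l) * (P * r)) with (5776 * (P * (q_ * q_) * r) * (l * l)) by ring.
        apply Rmult_le_compat; unfold l in *; lra. }
  assert (A6 : q_ * Cmod S <= q_ * (2 * q_ + 76 * l * U)).
  { rewrite <- Cmod_RtoC_mult by lra.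
    eapply Rle_trans; [apply (Cmod_le_via _ Y)|]. lra. }
  assert (A7 : Cmod S <= 2 * q_ + 76 * l * U) by (apply Rmult_le_reg_l with q_; lra).
  assert (A8 : q_ <= 2 * U).
  { apply Rsqr_incr_0_var; [|lra]. unfold Rsqr.
    replace (2 * U * (2 * U)) with (4 * (U * U)) by ring. rewrite HU.
    assert (q_ * q_ * (r * r) <= P * P) by nra.
    apply Rmult_le_reg_r with (r * r); [nra|].
    apply Rle_trans with (P * P); [lra|]. fold t.
    apply Rle_trans with (P * (2 * t)); [apply Rmult_le_compat_l; lra|].
    assert (0 <= P * t) by nra. nra. }
  fold t. fold z. fold S. fold P. fold U. unfold l in *. nra.
Qed.

(** Decreasing weights telescope, so with a uniform bound partial summation loses only the first
    weight. *)
Lemma wsum_bound_const (t B : R) (p n : nat) : (1 <= p)%nat -> 0 <= B ->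
  (forall i, (i <= n)%nat -> Cmod (csum (fun i => cis (t * ln (INR (p + i)))) i) <= B) ->
  Cmod (csum (fun i => RtoC (/ sqrt (INR (p + i))) * cis (- (t * ln (INR (p + i)))))%C n) <=
  B / sqrt (INR p).
Proof.
  intros Hp HB H.
  assert (P : forall i, 0 < / sqrt (INR (p + i))).
  { intros; apply Rinv_0_lt_compat, sqrt_lt_R0, lt_0_INR; lia. }
  destruct n as [|n].
  { simpl. rewrite Cmod_0. apply Rmult_le_pos; auto. specialize (P 0%nat).
    rewrite Nat.add_0_r in P. lra. }
  eapply Rle_trans; [apply (wsum_bound t p n (fun _ => B)); auto; intros; apply H; lia|].
  rewrite rsum_scal.
  assert (E : forall m, rsum (fun i => / sqrt (INR (p + i)) - / sqrt (INR (p + S i))) m =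
    / sqrt (INR (p + 1)) - / sqrt (INR (p + S m))).
  { induction m as [|m IH]; [simpl; ring|]. rewrite rsum_S, IH. ring. }
  rewrite E.
  assert (E2 : / sqrt (INR (p + 1)) <= / sqrt (INR p)).
  { apply Rinv_le_contravar; [apply sqrt_lt_R0, lt_0_INR; lia|].
    apply sqrt_le_1; try apply pos_INR. apply le_INR; lia. }
  unfold Rdiv. nra.
Qed.

(** Halving [M]: the block from [M / 2] to [M] costs one [G], and [2 G ln] pays for it since
    [ln 2 > 1/2]. Below [4 r] the trivial bound is already [4 sqrt r]. *)
Lemma dpoly_dyadic (r : R) (M : nat) : 1 <= r -> (1 <= M)%nat -> INR M <= 2 * (r * r) ->
  Cmod (dpoly M (r * r)) <= 4 * sqrt r + 2 * (80 * (3 + ln (r * r)) * sqrt r) * ln (INR M).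
Proof.
  intros Hr.
  assert (L0 : 0 <= ln (r * r)) by (apply ln_nonneg; nra).
  assert (S0 : 0 < sqrt r) by (apply sqrt_lt_R0; lra).
  set (G := 80 * (3 + ln (r * r)) * sqrt r) in *.
  assert (G0 : 0 < G) by (unfold G; nra).
  induction M as [M IH] using (well_founded_ind Nat.lt_wf_0). intros HM1 HM.
  assert (LM : 0 <= ln (INR M)) by (apply ln_nonneg, INR_ge1; auto).
  destruct (Rle_dec (INR M) (4 * r)) as [H|H].
  - eapply Rle_trans; [apply Cmod_dpoly_trivial|].
    assert (sqrt (INR M) <= 2 * sqrt r).
    { apply Rsqr_incr_0_var; [|lra]. unfold Rsqr. rewrite sqrt_sqrt by apply pos_INR.
      replace (2 * sqrt r * (2 * sqrt r)) with (4 * (sqrt r * sqrt r)) by ring.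
      rewrite sqrt_sqrt by lra. lra. }
    nra.
  - set (p := (M / 2)%nat).
    assert (Hdiv : (2 * p <= M < 2 * p + 2)%nat).
    { unfold p. pose proof (Nat.div_mod_eq M 2). pose proof (Nat.mod_upper_bound M 2 ltac:(lia)). lia. }
    assert (HpM : INR M <= 2 * INR p + 1).
    { replace (2 * INR p + 1) with (INR (2 * p + 1)).
      - apply le_INR; lia.
      - rewrite plus_INR, mult_INR. simpl; ring. }
    assert (HpM2 : 2 * INR p <= INR M).
    { replace (2 * INR p) with (INR (2 * p)) by (rewrite mult_INR; simpl; ring). apply le_INR; lia. }
    assert (Hp1 : (1 <= p)%nat).
    { destruct p as [|p']; [|lia]. simpl in HpM. nra. }
    specialize (IH p ltac:(lia) Hp1 ltac:(lra)).
    replace M with (p + (M - p))%nat at 1 by lia.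
    rewrite dpoly_add. eapply Rle_trans; [apply Cmod_triangle|].
    eapply Rle_trans; [apply Rplus_le_compat; [exact IH|]|].
    + apply (wsum_bound_const (r * r) (80 * (3 + ln (r * r)) * sqrt (INR p * r))); auto.
      * apply Rmult_le_pos; [lra|apply sqrt_pos].
      * intros i Hi. apply weyl_block; auto; try lra. lia.
    + rewrite sqrt_mult by lra.
      assert (0 < sqrt (INR p)) by (apply sqrt_lt_R0; lra).
      replace (80 * (3 + ln (r * r)) * (sqrt (INR p) * sqrt r) / sqrt (INR p)) with G
        by (unfold G; fld).
      assert (ln (INR p) + ln 2 <= ln (INR M)).
      { rewrite <- ln_mult by lra. apply ln_le; lra. }
      pose proof ln_lt_2. nra.
Qed.

(** This absorbs logarithms into powers of [v]. The blocks give [t^(1/4) = v^10] with two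
    logarithms, hence [v^12], the exponent 3/10. *)
Lemma ln_pow40 v : 1 <= v -> 3 + ln (v ^ 40) <= 40 * v.
Proof.
  intros H. rewrite ln_pow by lra. pose proof (ln_le_sub v ltac:(lra)).
  replace (INR 40) with 40 by (simpl; ring). lra.
Qed.

Lemma nceil_ex x : 0 <= x -> exists n, x <= INR n <= x + 1.
Proof.
  intros H. destruct (nfloor_ex x H) as [n Hn]. exists (S n). rewrite S_INR. lra.
Qed.

(* |zeta(1/2 + it)| << t^(3/10) in terms of the 40th root of t; any exponent below 1/3 would do. *)
Lemma dpoly_bound : exists C, 0 < C /\ forall (v : R) (M : nat), 1 <= v ->
  Cmod (dpoly M (v ^ 40)) <= C * (v ^ 12 + sqrt (INR M) / v ^ 40).
Proof.
  exists 300000. split; [lra|]. intros v M Hv.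
  assert (P : forall n, 1 <= v ^ n) by (intros; apply pow_R1_Rle; auto).
  assert (E40 : v ^ 40 = v ^ 20 * v ^ 20) by (rewrite <- pow_add; reflexivity).
  assert (S20 : sqrt (v ^ 20) = v ^ 10).
  { replace (v ^ 20) with (v ^ 10 * v ^ 10) by (rewrite <- pow_add; reflexivity).
    apply sqrt_square. pose proof (P 10%nat); lra. }
  assert (Main : forall M, INR M <= 2 * v ^ 40 -> Cmod (dpoly M (v ^ 40)) <= 260000 * v ^ 12).
  { clear M. intros M HM. pose proof (P 12%nat) as P12. destruct M as [|M].
    { unfold dpoly; simpl csum. rewrite Cmod_0. lra. }
    rewrite E40. eapply Rle_trans; [apply dpoly_dyadic; auto; [lia|lra]|].
    rewrite <- E40, S20. pose proof (ln_pow40 v Hv) as L.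
    assert (L2 : ln (INR (S M)) <= 40 * v).
    { apply Rle_trans with (ln (2 * v ^ 40)).
      - apply ln_le; [apply INR_S_pos|lra].
      - rewrite ln_mult by (pose proof (P 40%nat); lra). pose proof (ln_le_sub 2). lra. }
    assert (L3 : 0 <= ln (INR (S M))) by (apply ln_nonneg, INR_ge1; lia).
    assert (L4 : 0 <= ln (v ^ 40)) by (apply ln_nonneg; auto).
    pose proof (P 10%nat) as P10.
    apply Rle_trans with (4 * v ^ 10 + 2 * (80 * (40 * v) * v ^ 10) * (40 * v)).
    - apply Rplus_le_compat_l.
      assert (Q : 80 * (3 + ln (v ^ 40)) * v ^ 10 <= 80 * (40 * v) * v ^ 10)
        by (apply Rmult_le_compat_r; lra).
      apply Rmult_le_compat; try lra.
      apply Rmult_le_pos; [lra|]. apply Rmult_le_pos; lra.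
    - replace (v ^ 12) with (v * v * v ^ 10) by (simpl; ring).
      assert (1 * v ^ 10 <= v * v * v ^ 10) by (apply Rmult_le_compat_r; nra).
      replace (2 * (80 * (40 * v) * v ^ 10) * (40 * v)) with (256000 * (v * v * v ^ 10)) by ring.
      lra. }
  pose proof (P 40%nat) as P40. pose proof (P 12%nat) as P12.
  assert (SM : 0 <= sqrt (INR M) / v ^ 40).
  { apply Rmult_le_pos; [apply sqrt_pos|]. apply Rlt_le, Rinv_0_lt_compat; lra. }
  destruct (Rle_dec (INR M) (2 * v ^ 40)) as [H|H].
  - specialize (Main M H). lra.
  (* Up to the first integer above [t] the dyadic bound applies; [dpoly_long] handles the remaining
     terms. *)
  - destruct (nceil_ex (v ^ 40) ltac:(lra)) as [p [Hp1 Hp2]].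
    assert (1 <= p <= M)%nat.
    { split; [destruct p; [simpl in Hp1; lra|lia]|]. apply INR_le; lra. }
    eapply Rle_trans; [apply (Cmod_le_via _ (dpoly p (v ^ 40)))|].
    pose proof (dpoly_long (v ^ 40) p M ltac:(lra) Hp1 H0).
    specialize (Main p ltac:(lra)). unfold Rdiv in *. lra.
Qed.

(** * Analytic continuation of zeta to the critical line *)

(** Convergence is expressed through the modulus, which reduces complex limits to squeezes of real
    sequences. *)
Definition cconv (u : nat -> C) (l : C) := is_lim_seq (fun n => Cmod (u n - l)) 0.

Lemma is_lim_seq_squeeze0 (u v : nat -> R) :
  (forall n, 0 <= u n <= v n) -> is_lim_seq v 0 -> is_lim_seq u 0.
Proof.
  intros H Hv. apply is_lim_seq_le_le with (fun _ => 0) v; auto. apply is_lim_seq_const.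
Qed.

Lemma cconv_ext u v l : (forall n, u n = v n) -> cconv u l -> cconv v l.
Proof. intros H. apply is_lim_seq_ext. intros; rewrite H; reflexivity. Qed.

Lemma cconv_const l : cconv (fun _ => l) l.
Proof.
  apply is_lim_seq_ext with (fun _ => 0); [|apply is_lim_seq_const].
  intros. replace (l - l)%C with (RtoC 0) by ring. rewrite Cmod_0; reflexivity.
Qed.

Lemma cconv_plus u v l m : cconv u l -> cconv v m -> cconv (fun n => u n + v n)%C (l + m)%C.
Proof.
  intros U V. apply is_lim_seq_squeeze0 with (fun n => Cmod (u n - l) + Cmod (v n - m)).
  - intros n. split; [apply Cmod_ge_0|].
    replace (u n + v n - (l + m))%C with ((u n - l) + (v n - m))%C by ring. apply Cmod_triangle.
  - replace (Finite 0) with (Finite (0 + 0)) by (f_equal; ring). apply is_lim_seq_plus'; auto.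
Qed.

Lemma cconv_scal c u l : cconv u l -> cconv (fun n => c * u n)%C (c * l)%C.
Proof.
  intros U. apply is_lim_seq_ext with (fun n => Cmod c * Cmod (u n - l)).
  - intros n. rewrite <- Cmod_mult. f_equal. ring.
  - replace (Finite 0) with (Finite (Cmod c * 0)) by (f_equal; ring).
    apply (is_lim_seq_scal_l _ (Cmod c) 0); auto.
Qed.

Lemma cconv_minus u v l m : cconv u l -> cconv v m -> cconv (fun n => u n - v n)%C (l - m)%C.
Proof.
  intros U V. apply cconv_ext with (fun n => u n + (-(1)) * v n)%C; [intros; ring|].
  replace (l - m)%C with (l + (-(1)) * m)%C by ring. apply cconv_plus, cconv_scal; auto.
Qed.

Lemma cconv_bound u l B : cconv u l -> (forall n, Cmod (u n) <= B) -> Cmod l <= B.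
Proof.
  intros U H.
  enough (Rbar_le (Cmod l) (B + 0)) by (simpl in H0; lra).
  apply is_lim_seq_le with (fun _ => Cmod l) (fun n => B + Cmod (u n - l)).
  - intros n. rewrite Cmod_minus_sym. pose proof (Cmod_le_via l (u n)). specialize (H n). lra.
  - apply is_lim_seq_const.
  - apply is_lim_seq_plus'; [apply is_lim_seq_const|exact U].
Qed.

Lemma cconv_unique u l m : cconv u l -> cconv u m -> l = m.
Proof.
  intros U V. pose proof (cconv_minus u u l m U V) as W.
  assert (E : Cmod (l - m) <= 0).
  { apply cconv_bound with (fun n => u n - u n)%C; auto. intros n.
    replace (u n - u n)%C with (RtoC 0) by ring. rewrite Cmod_0; lra. }
  assert (F : (l - m)%C = 0%C) by (apply Cmod_eq_0; pose proof (Cmod_ge_0 (l - m)); lra).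
  replace l with ((l - m) + m)%C by ring. rewrite F. ring.
Qed.

Lemma cconv_incr_1 u l : cconv (fun n => u (S n)) l -> cconv u l.
Proof. intros U. apply is_lim_seq_incr_1. exact U. Qed.

Lemma cconv_incr_1' u l : cconv u l -> cconv (fun n => u (S n)) l.
Proof. intros U. unfold cconv in *. apply (is_lim_seq_incr_1 (fun n => Cmod (u n - l))) in U. exact U. Qed.

Lemma cconv_components u (x y : R) :
  is_lim_seq (fun n => fst (u n)) x -> is_lim_seq (fun n => snd (u n)) y -> cconv u (x, y).
Proof.
  intros U V.
  apply is_lim_seq_squeeze0 with (fun n => Rabs (fst (u n) - x) + Rabs (snd (u n) - y)).
  - intros n. split; [apply Cmod_ge_0|].
    pose proof (Cmod_sqr (u n - (x, y))) as E. unfold Re, Im in E; simpl in E.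
    set (a := Rabs (fst (u n) - x)). set (b := Rabs (snd (u n) - y)).
    assert (0 <= a) by apply Rabs_pos. assert (0 <= b) by apply Rabs_pos.
    assert (A : a * a = (fst (u n) + - x) * (fst (u n) + - x)).
    { unfold a. rewrite <- Rabs_mult, Rabs_pos_eq; [reflexivity|apply Rle_0_sqr]. }
    assert (B : b * b = (snd (u n) + - y) * (snd (u n) + - y)).
    { unfold b. rewrite <- Rabs_mult, Rabs_pos_eq; [reflexivity|apply Rle_0_sqr]. }
    apply Rsqr_incr_0_var; [|lra]. unfold Rsqr. nra.
  - assert (G : forall w (z : R), is_lim_seq w z -> is_lim_seq (fun n => Rabs (w n - z)) 0).
    { intros w z W. rewrite <- Rabs_R0. apply (is_lim_seq_abs _ 0).
      replace (Finite 0) with (Finite (z - z)) by (f_equal; ring).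
      apply is_lim_seq_minus'; [exact W|apply is_lim_seq_const]. }
    replace (Finite 0) with (Finite (0 + 0)) by (f_equal; ring).
    apply is_lim_seq_plus'; apply G; auto.
Qed.

Lemma sum_n_rsum (f : nat -> R) n : sum_n (fun k => f (S k)) n = rsum f (S n).
Proof.
  induction n as [|n IH]; [rewrite sum_O; simpl; ring|].
  rewrite sum_Sn, IH. reflexivity.
Qed.

Lemma sum_n_csum (f : nat -> C) n :
  sum_n (G := C_AbelianMonoid) (fun k => f (S k)) n = csum f (S n).
Proof.
  induction n as [|n IH]; [rewrite sum_O; simpl; ring|].
  rewrite sum_Sn, IH. reflexivity.
Qed.

Lemma cconv_abs (f : nat -> C) (b : nat -> R) : (forall n, Cmod (f (S n)) <= b n) -> ex_series b ->
  exists l, cconv (csum f) l.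
Proof.
  intros H Hb.
  destruct (ex_series_le (fun n => Re (f (S n))) b) as [x Hx]; auto.
  { intros n. eapply Rle_trans; [apply re_le_Cmod|apply H]. }
  destruct (ex_series_le (fun n => Im (f (S n))) b) as [y Hy]; auto.
  { intros n. eapply Rle_trans; [apply Im_le_Cmod_abs|apply H]. }
  exists (x, y). apply cconv_incr_1. apply cconv_components.
  - apply is_lim_seq_ext with (sum_n (fun n => Re (f (S n)))); [|exact Hx].
    intros n. rewrite (sum_n_rsum (fun n => Re (f n))). symmetry. apply (Re_csum f (S n)).
  - apply is_lim_seq_ext with (sum_n (fun n => Im (f (S n)))); [|exact Hy].
    intros n. rewrite (sum_n_rsum (fun n => Im (f n))). symmetry. apply (Im_csum f (S n)).
Qed.

Lemma is_series_cconv (f : nat -> C) l :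
  is_series (K := C_AbsRing) (V := C_NormedModule) (fun n => f (S n)) l -> cconv (csum f) l.
Proof.
  intros H. apply cconv_incr_1.
  pose proof (proj1 (filterlim_locally_ball_norm (K := C_AbsRing) (U := C_NormedModule) _ _) H) as H'.
  apply is_lim_seq_spec. intros eps. specialize (H' eps). clear H. rename H' into H.
  revert H. apply filter_imp. intros n H. unfold ball_norm in H.
  rewrite Rminus_0_r, Rabs_pos_eq by apply Cmod_ge_0.
  rewrite <- (sum_n_csum f n). exact H.
Qed.

(** Convergence at [r / 2] makes the radius positive, so the sum is continuous at 0, where its
    right-hand limit is 0. *)
Lemma real_powerseries_zero_0 (a : nat -> R) (r : R) : 0 < r ->
  (forall x, 0 < x < r -> is_pseries a x 0) -> a 0%nat = 0.
Proof.
  intros Hr H.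
  assert (CR : Rbar_lt (Rabs 0) (CV_radius a)).
  { apply Rbar_lt_le_trans with (Rabs (r / 2)).
    - rewrite Rabs_R0, Rabs_pos_eq by lra. simpl; lra.
    - destruct (Rbar_le_lt_dec (Rabs (r / 2)) (CV_radius a)) as [|C0]; auto.
      exfalso. apply (CV_disk_outside a (r / 2) C0).
      apply (is_lim_seq_ext (fun n => (r / 2) ^ n * a n)); [intros; ring|].
      apply ex_series_lim_0. exists 0.
      apply (is_series_ext (fun n => scal (pow_n (r / 2) n) (a n))).
      + intros k. rewrite pow_n_pow. reflexivity.
      + apply H; lra. }
  pose proof (PSeries_continuity a 0 CR) as PC.
  apply continuity_pt_filterlim in PC.
  rewrite PSeries_0 in PC.
  symmetry. apply (filterlim_locally_unique (F := at_right 0) (PSeries a)).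
  - apply filterlim_ext_loc with (fun _ => 0).
    + exists (mkposreal r Hr). intros y Hy Hy0. symmetry. apply is_pseries_unique, H.
      change (Rabs (y - 0) < r) in Hy. apply Rabs_def2 in Hy. lra.
    + apply filterlim_const.
  - eapply filterlim_filter_le_1; [|exact PC]. apply filter_le_within.
Qed.

(** Dividing by [x] shifts the coefficients, so each of them becomes a constant term in turn.
    Vanishing is assumed on one side only, since the series for zeta will be known only to the right
    of the centre. *)
Lemma real_powerseries_zero (a : nat -> R) (r : R) : 0 < r ->
  (forall x, 0 < x < r -> is_pseries a x 0) -> forall n, a n = 0.
Proof.
  intros Hr H n. revert a H. induction n as [|n IH]; intros a H.
  - apply real_powerseries_zero_0 with r; auto.
  - change (a (S n)) with (PS_decr_1 a n). apply IH. intros x Hx.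
    pose proof (is_pseries_decr_1 a x (/ x) 0) as D.
    rewrite (real_powerseries_zero_0 a r Hr H) in D.
    replace 0 with (scal (/ x) (plus 0 (opp 0))) at 1.
    + apply D; auto. change (/ x * x = 1). field; lra.
    + unfold scal, plus, opp; simpl. unfold mult; simpl. ring.
Qed.

(** For real [x] the real and imaginary parts are real power series. [csum] starts at 1, hence the
    exponents [pred j]. *)
Lemma complex_powerseries_zero (d : nat -> C) (r : R) : 0 < r ->
  (forall x, 0 < x < r -> cconv (csum (fun j => RtoC (x ^ pred j) * d (pred j))%C) 0%C) ->
  forall j, d j = 0%C.
Proof.
  intros Hr H j.
  assert (G : forall P : C -> R, (forall z, Rabs (P z) <= Cmod z) -> (forall x z, P (RtoC x * z)%C = x * P z) ->
    (forall u v, P (u + v)%C = P u + P v) -> P (d j) = 0).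
  { intros P P1 P2 P3.
    apply (real_powerseries_zero (fun j => P (d j)) r Hr). intros x Hx.
    specialize (H x Hx). apply cconv_incr_1' in H.
    assert (L : is_lim_seq (sum_n (fun k => scal (pow_n x k) (P (d k)))) 0); [|exact L].
    apply is_lim_seq_abs_0.
    apply is_lim_seq_squeeze0 with
      (fun n => Cmod (csum (fun j => RtoC (x ^ pred j) * d (pred j))%C (S n) - 0)); [|exact H].
    intros n. split; [apply Rabs_pos|].
    replace (csum (fun j => RtoC (x ^ pred j) * d (pred j))%C (S n) - 0)%C with
      (csum (fun j => RtoC (x ^ pred j) * d (pred j))%C (S n)) by ring.
    eapply Rle_trans; [|apply P1]. apply Req_le. f_equal.
    induction n as [|n IHn].
    - rewrite sum_O.
      replace (csum (fun j => RtoC (x ^ pred j) * d (pred j))%C 1) with (RtoC (x ^ 0) * d 0%nat)%C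
        by (simpl; ring).
      rewrite P2. reflexivity.
    - rewrite sum_Sn, IHn, (csum_S _ (S n)), P3, P2, pow_n_pow. reflexivity. }
  apply injective_projections.
  - apply (G Re); [apply re_le_Cmod| |]; intros; unfold Re; simpl; ring.
  - apply (G Im); [apply Im_le_Cmod_abs| |]; intros; unfold Im; simpl; ring.
Qed.

Lemma Rpower_gt0 x y : 0 < Rpower x y.
Proof. apply exp_pos. Qed.

(* The mean value theorem gives n^(-1-g) <= ((n-1)^(-g) - n^(-g)) / g. *)
Lemma Rpower_step g x : 0 < g -> 0 < x ->
  Rpower (x + 1) (- 1 - g) <= / g * (Rpower x (- g) - Rpower (x + 1) (- g)).
Proof.
  intros Hg Hx.
  destruct (MVT_gen (fun y => Rpower y (- g)) x (x + 1) (fun y => - g * Rpower y (- g - 1))) as [c [Hc E]].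
  - rewrite Rmin_left, Rmax_right by lra. intros y Hy.
    apply is_derive_Reals, derivable_pt_lim_power; lra.
  - rewrite Rmin_left, Rmax_right by lra. intros y Hy.
    apply derivable_continuous_pt. exists (- g * Rpower y (- g - 1)).
    apply derivable_pt_lim_power; lra.
  - rewrite Rmin_left, Rmax_right in Hc by lra.
    replace (Rpower x (- g) - Rpower (x + 1) (- g)) with (g * Rpower c (- g - 1)) by lra.
    rewrite <- Rmult_assoc, Rinv_l, Rmult_1_l by lra.
    replace (- g - 1) with (- 1 - g) by ring.
    unfold Rpower.
    destruct (Req_dec c (x + 1)) as [->|Hn]; [lra|].
    apply Rlt_le, exp_increasing.
    assert (ln c < ln (x + 1)) by (apply ln_increasing; lra). nra.
Qed.

Lemma rsum_Rpower_tail g n m : 0 < g -> (1 <= n)%nat ->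
  rsum (fun i => Rpower (INR (n + i)) (- 1 - g)) m <= / g * Rpower (INR n) (- g).
Proof.
  intros Hg Hn.
  enough (rsum (fun i => Rpower (INR (n + i)) (- 1 - g)) m <=
    / g * (Rpower (INR n) (- g) - Rpower (INR (n + m)) (- g))).
  { pose proof (Rpower_gt0 (INR (n + m)) (- g)). pose proof (Rinv_0_lt_compat g Hg). nra. }
  induction m as [|m IH].
  - rewrite Nat.add_0_r. simpl. lra.
  - rewrite rsum_S.
    pose proof (Rpower_step g (INR (n + m)) Hg (lt_0_INR (n + m) ltac:(lia))).
    rewrite (Nat.add_succ_r n m), S_INR. lra.
Qed.

Lemma rsum_Rpower_bound g n : 0 < g ->
  0 <= rsum (fun i => Rpower (INR i) (- 1 - g)) n <= 1 + / g.
Proof.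
  intros Hg. split; [apply rsum_ge0; intros; apply Rlt_le, Rpower_gt0|].
    pose proof (Rinv_0_lt_compat g Hg).
    destruct n as [|n]; [simpl; lra|].
    replace (S n) with (1 + n)%nat by lia. rewrite rsum_add.
    pose proof (rsum_Rpower_tail g 1 n Hg (le_n 1)).
    assert (E : forall y, Rpower (INR 1) y = 1).
    { intros y. unfold Rpower. simpl INR. rewrite ln_1, Rmult_0_r, exp_0. reflexivity. }
    rewrite E in H0. change (rsum (fun i => Rpower (INR i) (- 1 - g)) 1) with (0 + Rpower (INR 1) (- 1 - g)).
    rewrite E. lra.
Qed.

Lemma ex_series_Rpower g : 0 < g -> ex_series (fun n => Rpower (INR (S n)) (- 1 - g)).
Proof.
  intros Hg.
  destruct (ex_finite_lim_seq_incr (sum_n (fun n => Rpower (INR (S n)) (- 1 - g))) (1 + / g)) as [l Hl].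
  - intros n. rewrite sum_Sn.
    pose proof (Rpower_gt0 (INR (S (S n))) (- 1 - g)).
    match goal with |- ?u <= plus _ ?v => change (u <= u + v) end. lra.
  - intros n. rewrite (sum_n_rsum (fun n => Rpower (INR n) (- 1 - g))). apply (rsum_Rpower_bound g (S n) Hg).
  - exists l. exact Hl.
Qed.

Lemma Rpow_C_polar x w : Rpow_C x w = (RtoC (exp (Re w * ln x)) * cis (Im w * ln x))%C.
Proof. reflexivity. Qed.

Lemma Rpow_C_add x v w : Rpow_C x (v + w) = (Rpow_C x v * Rpow_C x w)%C.
Proof.
  rewrite !Rpow_C_polar.
  replace (Re (v + w) * ln x) with (Re v * ln x + Re w * ln x) by (unfold Re; simpl; ring).
  replace (Im (v + w) * ln x) with (Im v * ln x + Im w * ln x) by (unfold Im; simpl; ring).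
  rewrite exp_plus, cis_plus, RtoC_mult. ring.
Qed.

Lemma Rpow_C_real x r : Rpow_C x (RtoC r) = RtoC (Rpower x r).
Proof.
  rewrite Rpow_C_polar. unfold Re, Im; simpl. rewrite Rmult_0_l, cis_0. unfold Rpower. ring.
Qed.

Lemma Cmod_Rpow_C x w : Cmod (Rpow_C x w) = Rpower x (Re w).
Proof.
  rewrite Rpow_C_polar, Cmod_mult, Cmod_cis, Cmod_R, Rabs_pos_eq; [apply Rmult_1_r|].
  apply Rlt_le, exp_pos.
Qed.

Lemma Rpow_C_pred x w : 0 < x -> Rpow_C x (w - 1) = (Rpow_C x w * RtoC (/ x))%C.
Proof.
  intros H. replace (w - 1)%C with (w + RtoC (-1))%C.
  - rewrite Rpow_C_add, Rpow_C_real. do 2 f_equal.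
    change (-1) with (- (1)). rewrite Rpower_Ropp, Rpower_1; auto.
  - apply injective_projections; simpl; ring.
Qed.

(** * Second-order errors of x^w q(ln x) and their expansion in real shifts of s *)

Definition cder (q q' : R -> C) := forall L : R,
  is_derive (fun u => fst (q u)) L (fst (q' L)) /\ is_derive (fun u => snd (q u)) L (snd (q' L)).

Lemma cder_exp_cis (w : C) :
  cder (fun L => RtoC (exp (Re w * L)) * cis (Im w * L))%C
       (fun L => w * (RtoC (exp (Re w * L)) * cis (Im w * L)))%C.
Proof.
  intros L. unfold cis, Re, Im; simpl. split; auto_derive; auto; ring.
Qed.

Lemma is_derive_plusR f g x a b : is_derive f x a -> is_derive g x b ->
  is_derive (fun u => f u + g u) x (a + b).
Proof. intros; apply (is_derive_plus f g); auto. Qed.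

Lemma is_derive_minusR f g x a b : is_derive f x a -> is_derive g x b ->
  is_derive (fun u => f u - g u) x (a - b).
Proof. intros; apply (is_derive_minus f g); auto. Qed.

Lemma is_derive_multR f g x a b : is_derive f x a -> is_derive g x b ->
  is_derive (fun u => f u * g u) x (a * g x + f x * b).
Proof. intros; apply (is_derive_mult f g); auto. intros; apply Rmult_comm. Qed.

Lemma cder_mult p p' q q' : cder p p' -> cder q q' ->
  cder (fun L => p L * q L)%C (fun L => p' L * q L + p L * q' L)%C.
Proof.
  intros P Q L. destruct (P L) as [P1 P2], (Q L) as [Q1 Q2]. simpl. split.
  - pose proof (is_derive_minusR _ _ _ _ _ (is_derive_multR _ _ _ _ _ P1 Q1) (is_derive_multR _ _ _ _ _ P2 Q2)) as D.
    eapply is_derive_ext_loc in D; [|apply filter_forall; intros; reflexivity].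
    replace (fst (p' L) * fst (q L) - snd (p' L) * snd (q L) + (fst (p L) * fst (q' L) - snd (p L) * snd (q' L)))
      with (fst (p' L) * fst (q L) + fst (p L) * fst (q' L) - (snd (p' L) * snd (q L) + snd (p L) * snd (q' L))) by ring.
    exact D.
  - pose proof (is_derive_plusR _ _ _ _ _ (is_derive_multR _ _ _ _ _ P1 Q2) (is_derive_multR _ _ _ _ _ P2 Q1)) as D.
    replace (fst (p' L) * snd (q L) + snd (p' L) * fst (q L) + (fst (p L) * snd (q' L) + snd (p L) * fst (q' L)))
      with (fst (p' L) * snd (q L) + fst (p L) * snd (q' L) + (snd (p' L) * fst (q L) + snd (p L) * fst (q' L))) by ring.
    exact D.
Qed.

Lemma cder_plus p p' q q' : cder p p' -> cder q q' ->
  cder (fun L => p L + q L)%C (fun L => p' L + q' L)%C.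
Proof.
  intros P Q L. destruct (P L) as [P1 P2], (Q L) as [Q1 Q2].
  split; apply is_derive_plusR; auto.
Qed.

Lemma cder_scal c q q' : cder q q' -> cder (fun L => c * q L)%C (fun L => c * q' L)%C.
Proof.
  intros Q L. destruct (Q L) as [Q1 Q2].
  split; [apply is_derive_minusR|apply is_derive_plusR]; apply is_derive_scal; auto.
Qed.

(* The functions x^w q(ln x), a class closed under d/dx. *)
Definition logpow (w : C) (q : R -> C) (x : R) : C := (q (ln x) * Rpow_C x w)%C.

Lemma logpow_derive w q q' x : cder q q' -> 0 < x ->
  is_derive (fun u => fst (logpow w q u)) x (fst (logpow (w - 1) (fun L => q' L + w * q L)%C x)) /\
  is_derive (fun u => snd (logpow w q u)) x (snd (logpow (w - 1) (fun L => q' L + w * q L)%C x)).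
Proof.
  intros Q Hx.
  pose proof (cder_mult _ _ _ _ Q (cder_exp_cis w) (ln x)) as [D1 D2].
  assert (Dl : is_derive ln x (/ x)) by (auto_derive; auto; ring).
  assert (E : logpow (w - 1) (fun L => q' L + w * q L)%C x =
    (RtoC (/ x) * (q' (ln x) * (RtoC (exp (Re w * ln x)) * cis (Im w * ln x)) +
     q (ln x) * (w * (RtoC (exp (Re w * ln x)) * cis (Im w * ln x)))))%C).
  { unfold logpow. rewrite Rpow_C_pred, Rpow_C_polar by auto. ring. }
  rewrite E.
  pose proof (is_derive_comp _ _ _ _ _ D1 Dl) as E1.
  pose proof (is_derive_comp _ _ _ _ _ D2 Dl) as E2.
  set (Z := (q' (ln x) * (RtoC (exp (Re w * ln x)) * cis (Im w * ln x)) +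
     q (ln x) * (w * (RtoC (exp (Re w * ln x)) * cis (Im w * ln x))))%C) in *.
  replace (fst (RtoC (/ x) * Z)%C) with (/ x * fst Z) by (simpl; ring).
  replace (snd (RtoC (/ x) * Z)%C) with (/ x * snd Z) by (simpl; ring).
  split; [exact E1|exact E2].
Qed.

(** The error f(x + 1) - f(x) - f'(x) for f(x) = x^w q(ln x), where [q'] is to be the derivative of
    [q]. With [w = 1 - s] and [q = 1] it is the term of the series for zeta. *)
Definition logpow_rem (w : C) (q q' : R -> C) (x : R) : C :=
  (logpow w q (x + 1) - logpow w q x - logpow (w - 1) (fun L => q' L + w * q L) x)%C.

(** [B] bounds the second derivative: differentiating twice multiplies the combination of [q], [q'],
    [q''] by [y^(w-2)]. The mean value theorem is applied first to f' and then to f minus its linear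
    part. *)
Lemma logpow_rem_bound w q q' q'' x B : cder q q' -> cder q' q'' -> 0 < x ->
  (forall y, x <= y <= x + 1 ->
    Cmod (q'' (ln y) + (2 * w - 1) * q' (ln y) + (w - 1) * w * q (ln y)) * Rpower y (Re w - 2) <= B) ->
  Cmod (logpow_rem w q q' x) <= B.
Proof.
  intros Q Q' Hx HB.
  set (q1 := fun L => (q' L + w * q L)%C).
  set (q1' := fun L => (q'' L + w * q' L)%C).
  assert (Q1 : cder q1 q1') by (apply cder_plus; auto; apply cder_scal; auto).
  assert (B0 : 0 <= B).
  { eapply Rle_trans; [|apply (HB x); lra]. apply Rmult_le_pos; [apply Cmod_ge_0|apply Rlt_le, exp_pos]. }
  assert (B1 : forall y, x <= y <= x + 1 -> Cmod (logpow (w - 1) q1 y - logpow (w - 1) q1 x) <= B).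
  { intros y Hy. apply Rle_trans with (B * (y - x)); [|nra].
    apply (Cmod_mvt _ (logpow (w - 1 - 1) (fun L => q1' L + (w - 1) * q1 L)%C)); [lra|].
    intros t Ht. destruct (logpow_derive (w - 1) q1 q1' t Q1 ltac:(lra)) as [D1 D2].
    split; [exact D1|split; [exact D2|]]. unfold logpow. rewrite Cmod_mult, Cmod_Rpow_C.
    eapply Rle_trans; [|apply (HB t); lra]. apply Req_le. f_equal.
    - f_equal. unfold q1', q1. ring.
    - f_equal. unfold Re; simpl; ring. }
  unfold logpow_rem. fold q1.
  replace (logpow w q (x + 1) - logpow w q x - logpow (w - 1) q1 x)%C with
    ((logpow w q (x + 1) - RtoC (x + 1) * logpow (w - 1) q1 x) -
     (logpow w q x - RtoC x * logpow (w - 1) q1 x))%C by (rewrite RtoC_plus; ring).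
  replace B with (B * (x + 1 - x)) by ring.
  apply (Cmod_mvt (fun y => logpow w q y - RtoC y * logpow (w - 1) q1 x)%C
    (fun y => logpow (w - 1) q1 y - logpow (w - 1) q1 x)%C); [lra|].
  intros t Ht. destruct (logpow_derive w q q' t Q ltac:(lra)) as [D1 D2].
  set (c := logpow (w - 1) q1 x) in *.
  assert (E1 : is_derive (fun y => fst (RtoC y * c)%C) t (fst c)) by (simpl; auto_derive; auto; ring).
  assert (E2 : is_derive (fun y => snd (RtoC y * c)%C) t (snd c)) by (simpl; auto_derive; auto; ring).
  split; [|split].
  - apply (is_derive_minusR _ _ _ _ _ D1 E1).
  - apply (is_derive_minusR _ _ _ _ _ D2 E2).
  - apply B1; lra.
Qed.

Lemma logpow_rem_linear w p p' q q' m m' c x :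
  (forall L, p L = q L - c * m L)%C -> (forall L, p' L = q' L - c * m' L)%C ->
  logpow_rem w p p' x = (logpow_rem w q q' x - c * logpow_rem w m m' x)%C.
Proof. intros H H'. unfold logpow_rem, logpow. rewrite !H, !H'. ring. Qed.

(** The first [J] terms in the expansion of [exp (- h L)] in [h]. With [L = ln n] this expands the
    factor [n^(-h)] that a shift of [s] by [h] produces. *)
Fixpoint exp_taylor (h : R) (J : nat) (L : R) : R :=
  match J with O => 0 | S j => exp_taylor h j L + (- h * L) ^ j / INR (fact j) end.

Definition exp_rem h J L := exp (- h * L) - exp_taylor h J L.

Lemma exp_taylor_derive h J L :
  is_derive (exp_taylor h (S J)) L (- h * exp_taylor h J L).
Proof.
  induction J as [|J IH].
  - simpl. auto_derive; auto. ring.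
  - apply (is_derive_ext (fun L => exp_taylor h (S J) L + (- h * L) ^ (S J) / INR (fact (S J)))).
    { intros; reflexivity. }
    replace (- h * exp_taylor h (S J) L) with
      (- h * exp_taylor h J L + - h * ((- h * L) ^ J / INR (fact J))) by (simpl; ring).
    apply is_derive_plusR; [exact IH|].
    auto_derive; auto.
    change (fact J + J * fact J)%nat with (S J * fact J)%nat. rewrite mult_INR.
    change (match J with O => 1 | S _ => INR J + 1 end) with (INR (S J)).
    field. split; [apply INR_fact_neq_0|apply not_0_INR; lia].
Qed.

(** For [J = 0] the remainder is the exponential itself, and [pred 0 = 0] makes the same formula
    cover it. *)
Lemma exp_rem_derive h J L : is_derive (exp_rem h J) L (- h * exp_rem h (pred J) L).
Proof.
  unfold exp_rem.
  assert (D : is_derive (fun L => exp (- h * L)) L (- h * exp (- h * L))) by (auto_derive; auto; ring).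
  rewrite Rmult_minus_distr_l. apply is_derive_minusR; [exact D|].
  destruct J as [|J]; [|apply exp_taylor_derive].
  simpl. rewrite Rmult_0_r. apply (is_derive_const (V := R_NormedModule)).
Qed.

Lemma exp_rem_0 h J : exp_rem h (S J) 0 = 0.
Proof.
  unfold exp_rem. rewrite Rmult_0_r, exp_0.
  enough (exp_taylor h (S J) 0 = 1) by lra.
  induction J as [|J IH]; [simpl; field|].
  change (exp_taylor h (S J) 0 + (- h * 0) ^ S J / INR (fact (S J)) = 1).
  rewrite IH, Rmult_0_r, pow_ne_zero by lia. unfold Rdiv. ring.
Qed.

(** The factor [(/ 2) ^ J] makes the expansion in [h] converge uniformly in [n], at the price of a
    small power of [n]. In the induction the majorant grows fast enough: its derivative is 3/2 of
    [|h|] times the previous majorant. *)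
Lemma exp_rem_bound h J L : 0 <= L -> Rabs (exp_rem h J L) <= (/ 2) ^ J * exp (3 * Rabs h * L).
Proof.
  revert L. induction J as [|J IH]; intros L HL.
  - unfold exp_rem. simpl. rewrite Rminus_0_r, Rmult_1_l, Rabs_pos_eq by (apply Rlt_le, exp_pos).
    assert (- h * L <= 3 * Rabs h * L).
    { apply Rmult_le_compat_r; auto. pose proof (Rle_abs (- h)). rewrite Rabs_Ropp in H.
      pose proof (Rabs_pos h). lra. }
    destruct (Req_dec (- h * L) (3 * Rabs h * L)) as [->|]; [lra|].
    apply Rlt_le, exp_increasing; lra.
  - assert (K : forall s, Rabs s = 1 -> s * exp_rem h (S J) L <= (/ 2) ^ S J * exp (3 * Rabs h * L)).
    { intros s Hs.
      set (u := fun y => (/ 2) ^ S J * exp (3 * Rabs h * y) - s * exp_rem h (S J) y).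
      set (u' := fun y => (/ 2) ^ S J * (3 * Rabs h * exp (3 * Rabs h * y)) - s * (- h * exp_rem h J y)).
      assert (Hu : forall y, is_derive u y (u' y)).
      { intros y. apply is_derive_minusR.
        - apply is_derive_scal. auto_derive; auto; ring.
        - apply is_derive_scal. apply (exp_rem_derive h (S J)). }
      destruct (MVT_gen u 0 L u') as [c [Hc E]].
      - intros; apply Hu.
      - intros y _. apply continuity_pt_filterlim, (ex_derive_continuous (V := R_NormedModule)).
        exists (u' y). apply Hu.
      - rewrite Rmin_left, Rmax_right in Hc by lra.
        unfold u, u' in E.
        rewrite exp_rem_0, Rmult_0_r, Rmult_0_r, exp_0, Rminus_0_r, Rmult_1_r in E.
        specialize (IH c ltac:(lra)).
        assert (P : 0 < (/ 2) ^ S J) by (apply pow_lt; lra).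
        assert (D : s * (- h * exp_rem h J c) <= Rabs h * ((/ 2) ^ J * exp (3 * Rabs h * c))).
        { eapply Rle_trans; [apply Rle_abs|]. rewrite !Rabs_mult, Hs, Rabs_Ropp, Rmult_1_l.
          apply Rmult_le_compat_l; auto. apply Rabs_pos. }
        assert (D2 : Rabs h * ((/ 2) ^ J * exp (3 * Rabs h * c)) = 2 * ((/ 2) ^ S J * (Rabs h * exp (3 * Rabs h * c)))).
        { simpl. field. }
        assert (D3 : 0 <= (/ 2) ^ S J * (Rabs h * exp (3 * Rabs h * c))).
        { apply Rmult_le_pos; [lra|]. apply Rmult_le_pos; [apply Rabs_pos|apply Rlt_le, exp_pos]. }
        nra. }
    apply Rabs_le. split.
    + specialize (K (-1)). rewrite Rabs_left in K by lra. specialize (K ltac:(lra)). lra.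
    + specialize (K 1). rewrite Rabs_R1 in K. specialize (K eq_refl). lra.
Qed.

(* (s-1) zeta(s) = 1 + sum_(n >= 1) zeta_term s n for Re s > 0: the terms are O(|s|^2 n^(-1-Re s)). *)
Definition zeta_term (s : C) (n : nat) : C :=
  (Rpow_C (INR n + 1) (1 - s) - Rpow_C (INR n) (1 - s) - (1 - s) * Rpow_C (INR n) (- s))%C.

Lemma Rpow_C_1 w : Rpow_C 1 w = 1%C.
Proof.
  rewrite Rpow_C_polar, ln_1, !Rmult_0_r, exp_0, cis_0. ring.
Qed.

(** The powers [x^(1-s)] telescope; the 1 on the left is the missing [1^(1-s)]. *)
Lemma csum_zeta_term s M : (1 + csum (zeta_term s) M)%C =
  (Rpow_C (INR M + 1) (1 - s) + (s - 1) * csum (fun n => Rpow_C (INR n) (- s)) M)%C.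
Proof.
  induction M as [|M IH].
  - simpl. rewrite Rplus_0_l, Rpow_C_1. ring.
  - rewrite !csum_S.
    replace (1 + (csum (zeta_term s) M + zeta_term s (S M)))%C with
      (1 + csum (zeta_term s) M + zeta_term s (S M))%C by ring.
    rewrite IH. unfold zeta_term. rewrite !S_INR. ring.
Qed.

Definition rem_c h J : R -> C := fun L => RtoC (exp_rem h J L).
Definition rem_c' h J : R -> C := fun L => RtoC (- h * exp_rem h (pred J) L).

Lemma rem_c_derive h J : cder (rem_c h J) (rem_c' h J).
Proof.
  intros L. unfold rem_c, rem_c'; simpl. split; [apply exp_rem_derive|].
  apply (is_derive_const (V := R_NormedModule)).
Qed.

Lemma rem_c_bound h J L : Rabs h <= / 8 -> 0 <= L ->
  Cmod (rem_c h J L) <= (/ 2) ^ J * exp (3 / 8 * L).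
Proof.
  intros Hh HL. unfold rem_c. rewrite Cmod_R. eapply Rle_trans; [apply exp_rem_bound; auto|].
  apply Rmult_le_compat_l; [apply pow_le; lra|].
  assert (3 * Rabs h * L <= 3 / 8 * L) by (apply Rmult_le_compat_r; lra).
  destruct (Req_dec (3 * Rabs h * L) (3 / 8 * L)) as [->|]; [lra|].
  apply Rlt_le, exp_increasing; lra.
Qed.

Definition rem_const (w : C) := 4 * (1 + Cmod (2 * w - 1) + Cmod ((w - 1) * w)).

Lemma half_pow_pred J : (/ 2) ^ pred J <= 2 * (/ 2) ^ J.
Proof. destruct J as [|J]; simpl; [lra|]. lra. Qed.

(** For [|h| <= 1/8] the exponential costs [y^(3/8)], and [Re w - 2 <= -3/2] leaves the summable
    exponent -9/8. The 4 in [rem_const] pays for lowering [J] by two in the second derivative. *)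
Lemma rem_term_bound w h J n : Re w <= 1 / 2 -> Rabs h <= / 8 -> (1 <= n)%nat ->
  Cmod (logpow_rem w (rem_c h J) (rem_c' h J) (INR n)) <=
    rem_const w * (/ 2) ^ J * Rpower (INR n) (- 1 - / 8).
Proof.
  intros Hw Hh Hn. pose proof (INR_ge1 n Hn) as Hn1.
  apply logpow_rem_bound with (fun L => RtoC (- h) * rem_c' h (pred J) L)%C.
  - apply rem_c_derive.
  - intros L. pose proof (cder_scal (RtoC (- h)) _ _ (rem_c_derive h (pred J)) L) as [D1 D2].
    split.
    + eapply is_derive_ext; [|exact D1]. intros; unfold rem_c, rem_c'; simpl; ring.
    + eapply is_derive_ext; [|exact D2]. intros; unfold rem_c, rem_c'; simpl; ring.
  - lra.
  - intros y Hy.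
    assert (L0 : 0 <= ln y) by (apply ln_nonneg; lra).
    assert (P : 0 < (/ 2) ^ J) by (apply pow_lt; lra).
    set (e := exp (3 / 8 * ln y)).
    assert (He : 0 < e) by apply exp_pos.
    assert (Q0 : Cmod (rem_c h J (ln y)) <= 4 * ((/ 2) ^ J * e)).
    { pose proof (rem_c_bound h J (ln y) Hh L0). fold e in H. nra. }
    assert (R1 : Cmod (rem_c h (pred J) (ln y)) <= 2 * ((/ 2) ^ J * e)).
    { eapply Rle_trans; [apply rem_c_bound; auto|]. fold e. pose proof (half_pow_pred J). nra. }
    assert (R2 : Cmod (rem_c h (pred (pred J)) (ln y)) <= 4 * ((/ 2) ^ J * e)).
    { eapply Rle_trans; [apply rem_c_bound; auto|]. fold e.
      pose proof (half_pow_pred J). pose proof (half_pow_pred (pred J)). nra. }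
    assert (N0 : forall k, Cmod (rem_c' h k (ln y)) <= Cmod (rem_c h (pred k) (ln y))).
    { intros k. unfold rem_c', rem_c. rewrite !Cmod_R, Rabs_mult, Rabs_Ropp.
      pose proof (Rabs_pos (exp_rem h (pred k) (ln y))). nra. }
    assert (N1 : Cmod (RtoC (- h) * rem_c' h (pred J) (ln y)) <= Cmod (rem_c' h (pred J) (ln y))).
    { rewrite Cmod_mult, Cmod_R, Rabs_Ropp. pose proof (Cmod_ge_0 (rem_c' h (pred J) (ln y))). nra. }
    pose proof (N0 J) as NJ. pose proof (N0 (pred J)) as NJ2.
    assert (S : Cmod (RtoC (- h) * rem_c' h (pred J) (ln y) + (2 * w - 1) * rem_c' h J (ln y) +
      (w - 1) * w * rem_c h J (ln y)) <= rem_const w * ((/ 2) ^ J * e)).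
    { eapply Rle_trans; [apply Cmod_triangle|].
      eapply Rle_trans; [apply Rplus_le_compat_r, Cmod_triangle|].
      rewrite (Cmod_mult (2 * w - 1)), (Cmod_mult ((w - 1) * w)).
      pose proof (Cmod_ge_0 (2 * w - 1)). pose proof (Cmod_ge_0 ((w - 1) * w)).
      assert (Cmod (2 * w - 1) * Cmod (rem_c' h J (ln y)) <= Cmod (2 * w - 1) * (4 * ((/ 2) ^ J * e)))
        by (apply Rmult_le_compat_l; nra).
      assert (Cmod ((w - 1) * w) * Cmod (rem_c h J (ln y)) <= Cmod ((w - 1) * w) * (4 * ((/ 2) ^ J * e)))
        by (apply Rmult_le_compat_l; nra).
      unfold rem_const. lra. }
    assert (K0 : 0 <= rem_const w).
    { unfold rem_const. pose proof (Cmod_ge_0 (2 * w - 1)). pose proof (Cmod_ge_0 ((w - 1) * w)). lra. }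
    eapply Rle_trans; [apply Rmult_le_compat_r; [apply Rlt_le, exp_pos|exact S]|].
    rewrite !Rmult_assoc. apply Rmult_le_compat_l; auto. apply Rmult_le_compat_l; [lra|].
    apply Rle_trans with (Rpower y (- 1 - / 8)).
    + unfold e. fold (Rpower y (3 / 8)). rewrite <- Rpower_plus. apply Rle_Rpower; lra.
    + unfold Rpower.
      assert (ln (INR n) <= ln y) by (apply ln_le; lra).
      destruct (Req_dec (ln (INR n)) (ln y)) as [->|]; [lra|].
      apply Rlt_le, exp_increasing; lra.
Qed.

(** The coefficient of [h^j] in [exp (- h L)], which separates consecutive remainders. *)
Definition mono_c (j : nat) : R -> C := fun L => RtoC ((- L) ^ j / INR (fact j)).
Definition mono_c' (j : nat) : R -> C :=
  fun L => match j with O => 0%C | S i => (- mono_c i L)%C end.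

Lemma rem_c_succ h J L : rem_c h (S J) L = (rem_c h J L - RtoC (h ^ J) * mono_c J L)%C.
Proof.
  unfold rem_c, mono_c, exp_rem. rewrite <- RtoC_mult, <- RtoC_minus. f_equal.
  simpl exp_taylor. replace (- h * L) with (h * - L) by ring. rewrite Rpow_mult_distr.
  unfold Rdiv. ring.
Qed.

Lemma rem_c'_succ h J L : rem_c' h (S J) L = (rem_c' h J L - RtoC (h ^ J) * mono_c' J L)%C.
Proof.
  destruct J as [|J].
  - unfold rem_c', mono_c'. simpl pred. ring.
  - unfold rem_c', mono_c'. simpl pred. rewrite !RtoC_mult.
    change (RtoC (exp_rem h (S J) L)) with (rem_c h (S J) L). rewrite rem_c_succ.
    change (h ^ S J) with (h * h ^ J). rewrite RtoC_mult, RtoC_opp. unfold rem_c. ring.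
Qed.

Lemma rem_term_succ w h J x : logpow_rem w (rem_c h (S J)) (rem_c' h (S J)) x =
  (logpow_rem w (rem_c h J) (rem_c' h J) x - RtoC (h ^ J) * logpow_rem w (mono_c J) (mono_c' J) x)%C.
Proof. apply logpow_rem_linear; intros; [apply rem_c_succ|apply rem_c'_succ]. Qed.

Lemma rem_term_zeta s0 h n : (1 <= n)%nat ->
  logpow_rem (1 - s0) (rem_c h 0) (rem_c' h 0) (INR n) = zeta_term (s0 + RtoC h) n.
Proof.
  intros Hn.
  assert (E : forall x v, 0 < x -> (RtoC (exp (- h * ln x)) * Rpow_C x v)%C = Rpow_C x (v - RtoC h)).
  { intros x v Hx. replace (v - RtoC h)%C with (RtoC (- h) + v)%C by (rewrite RtoC_opp; ring).
    rewrite Rpow_C_add, Rpow_C_real. reflexivity. }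
  pose proof (lt_0_INR n Hn) as P.
  unfold logpow_rem, logpow, rem_c, rem_c', zeta_term, exp_rem. simpl exp_taylor. simpl pred.
  rewrite !Rminus_0_r, RtoC_mult.
  replace ((RtoC (- h) * RtoC (exp (- h * ln (INR n))) + (1 - s0) * RtoC (exp (- h * ln (INR n)))) *
    Rpow_C (INR n) (1 - s0 - 1))%C with ((1 - s0 - RtoC h) *
    (RtoC (exp (- h * ln (INR n))) * Rpow_C (INR n) (1 - s0 - 1)))%C by (rewrite RtoC_opp; ring).
  rewrite !E by lra.
  replace (1 - s0 - RtoC h)%C with (1 - (s0 + RtoC h))%C by ring.
  replace (1 - s0 - 1 - RtoC h)%C with (- (s0 + RtoC h))%C by ring. reflexivity.
Qed.

(** A total limit: the expansion coefficients can be given as one explicit sequence, fixed before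
    [h]. *)
Definition clim (u : nat -> C) : C :=
  (real (Lim_seq (fun n => fst (u n))), real (Lim_seq (fun n => snd (u n)))).

Lemma cconv_clim u l : cconv u l -> cconv u (clim u).
Proof.
  intros H. replace (clim u) with l; auto.
  assert (G : forall P : C -> R, (forall z, Rabs (P z) <= Cmod z) -> (forall u v, P (u - v)%C = P u - P v) ->
    P l = real (Lim_seq (fun n => P (u n)))).
  { intros P P1 P2. rewrite (is_lim_seq_unique (fun n => P (u n)) (P l)); [reflexivity|].
    apply is_lim_seq_ext with (fun n => (P (u n) - P l) + P l); [intros; ring|].
    replace (Finite (P l)) with (Finite (0 + P l)) by (f_equal; ring).
    apply is_lim_seq_plus'; [|apply is_lim_seq_const].
    apply is_lim_seq_abs_0. apply is_lim_seq_squeeze0 with (fun n => Cmod (u n - l)); auto.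
    intros n. split; [apply Rabs_pos|]. rewrite <- P2. auto. }
  apply injective_projections.
  - apply (G fst); [apply re_le_Cmod|reflexivity].
  - apply (G snd); [apply Im_le_Cmod_abs|reflexivity].
Qed.

(** The sum over [n] and the expansion in [h] are interchanged: the sum over [n] of the remainders
    of order [J] is [O((/ 2) ^ J)], uniformly in the number of terms. *)
Lemma zeta_term_expansion (s0 : C) : 1 / 2 <= Re s0 ->
  exists e : nat -> C, forall h : R, Rabs h <= / 8 -> exists l : C,
    cconv (csum (zeta_term (s0 + RtoC h))) l /\
    cconv (csum (fun j => RtoC (h ^ pred j) * e (pred j))%C) l.
Proof.
  intros Hs. set (w := (1 - s0)%C).
  assert (Hw : Re w <= 1 / 2) by (unfold w, Re in *; simpl; lra).
  set (A := fun h J n => logpow_rem w (rem_c h J) (rem_c' h J) (INR n)).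
  set (c := fun j n => logpow_rem w (mono_c j) (mono_c' j) (INR n)).
  assert (K0 : 0 <= rem_const w).
  { unfold rem_const. pose proof (Cmod_ge_0 (2 * w - 1)). pose proof (Cmod_ge_0 ((w - 1) * w)). lra. }
  assert (EA : forall h J, Rabs h <= / 8 -> exists l, cconv (csum (A h J)) l).
  { intros h J Hh. apply cconv_abs with
      (fun n => rem_const w * (/ 2) ^ J * Rpower (INR (S n)) (- 1 - / 8)).
    - intros n. apply rem_term_bound; auto. lia.
    - apply (ex_series_scal (V := R_NormedModule)). apply ex_series_Rpower. lra. }
  (* Each coefficient sum converges, being a rescaled difference of two consecutive remainder sums
     at [h = 1/8]. *)
  assert (Ec : forall j, cconv (csum (c j)) (clim (csum (c j)))).
  { intros j.
    destruct (EA (/ 8) j) as [l1 H1]; [rewrite Rabs_pos_eq; lra|].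
    destruct (EA (/ 8) (S j)) as [l2 H2]; [rewrite Rabs_pos_eq; lra|].
    apply cconv_clim with (RtoC (8 ^ j) * (l1 - l2))%C.
    apply cconv_ext with (fun n => RtoC (8 ^ j) * (csum (A (/ 8)%R j) n - csum (A (/ 8)%R (S j)) n))%C.
    - intros n. rewrite <- csum_minus, <- csum_scal. apply csum_ext; intros i Hi.
      unfold A. rewrite rem_term_succ. fold (c j i).
      replace (RtoC (8 ^ j) * (logpow_rem w (rem_c (/ 8)%R j) (rem_c' (/ 8)%R j) (INR i) -
        (logpow_rem w (rem_c (/ 8)%R j) (rem_c' (/ 8)%R j) (INR i) - RtoC ((/ 8) ^ j) * c j i)))%C
        with (RtoC (8 ^ j) * RtoC ((/ 8) ^ j) * c j i)%C by ring.
      rewrite <- RtoC_mult, <- Rpow_mult_distr. replace (8 * / 8) with 1 by field.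
      rewrite pow1. ring.
    - apply cconv_scal, cconv_minus; auto. }
  exists (fun j => clim (csum (c j))). intros h Hh.
  destruct (EA h 0%nat Hh) as [l Hl]. exists l. split.
  { apply cconv_ext with (csum (A h 0%nat)); auto.
    intros n. apply csum_ext; intros i Hi. apply rem_term_zeta; lia. }
  set (S := csum (fun j => RtoC (h ^ pred j) * clim (csum (c (pred j))))%C).
  assert (AJ : forall J, cconv (csum (A h J)) (l - S J)%C).
  { induction J as [|J IH].
    - unfold S; simpl. replace (l - 0)%C with l by ring. exact Hl.
    - unfold S. rewrite csum_S. fold (S J). simpl pred.
      replace (l - (S J + RtoC (h ^ J) * clim (csum (c J))))%C with
        ((l - S J) - RtoC (h ^ J) * clim (csum (c J)))%C by ring.
      apply cconv_ext with (fun n => csum (A h J) n - RtoC (h ^ J) * csum (c J) n)%C.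
      + intros n. rewrite <- csum_scal, <- csum_minus. apply csum_ext; intros i Hi.
        unfold A. rewrite rem_term_succ. reflexivity.
      + apply cconv_minus; auto. apply cconv_scal; auto. }
  (* The number 9 is [1 + 8], the bound for the sum of [n^(-9/8)]. *)
  apply is_lim_seq_squeeze0 with (fun J => (rem_const w * 9) * (/ 2) ^ J).
  - intros J. split; [apply Cmod_ge_0|]. rewrite Cmod_minus_sym.
    apply cconv_bound with (csum (A h J)); auto. intros n.
    apply Rle_trans with (rsum (fun n => rem_const w * (/ 2) ^ J * Rpower (INR n) (- 1 - / 8)) n).
    + apply Cmod_csum_le; intros i Hi. apply rem_term_bound; auto; lia.
    + rewrite rsum_scal. pose proof (rsum_Rpower_bound (/ 8) n ltac:(lra)).
      assert (0 <= rem_const w * (/ 2) ^ J) by (apply Rmult_le_pos; auto; apply pow_le; lra).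
      rewrite Rinv_inv in H. nra.
  - replace (Finite 0) with (Finite (rem_const w * 9 * 0)) by (f_equal; ring).
    apply (is_lim_seq_scal_l _ (rem_const w * 9) 0). apply is_lim_seq_geom. rewrite Rabs_pos_eq; lra.
Qed.

(** The series has the value that the continued function prescribes at [s]; this property is
    transported from [Re s > 1] to the critical line. *)
Definition zeta_repr (zeta : C -> C) (s : C) := cconv (fun M => 1 + csum (zeta_term s) M)%C ((s - 1) * zeta s)%C.

Lemma zeta_repr_right zeta s : is_Riemann_zeta zeta -> 1 < Re s -> zeta_repr zeta s.
Proof.
  intros Hzeta Hs. destruct Hzeta as [H1 _]. specialize (H1 s Hs).
  apply (is_series_cconv (fun n => Rpow_C (INR n) (- s))) in H1.
  unfold zeta_repr. eapply cconv_ext; [intros M; symmetry; apply csum_zeta_term|].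
  replace ((s - 1) * zeta s)%C with (0 + (s - 1) * zeta s)%C by ring.
  apply cconv_plus; [|apply cconv_scal; exact H1].
  set (g := Re s - 1).
  apply is_lim_seq_ext with (fun M => Rpower (INR M + 1) (- g)).
  - intros M. replace (Rpow_C (INR M + 1) (1 - s) - 0)%C with (Rpow_C (INR M + 1) (1 - s)) by ring.
    rewrite Cmod_Rpow_C. f_equal. unfold g, Re; simpl; ring.
  - assert (Hg : 0 < g) by (unfold g; lra).
    unfold Rpower. apply (is_lim_comp_seq exp _ m_infty 0 is_lim_exp_m).
    + exists 0%nat; intros; discriminate.
    + apply is_lim_seq_ext with (fun M => (- g) * ln (INR (S M))).
      * intros; rewrite S_INR; reflexivity.
      * replace m_infty with (Rbar_mult (- g) p_infty).
        -- apply is_lim_seq_scal_l.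
           apply (is_lim_comp_seq ln _ p_infty p_infty is_lim_ln_p).
           ++ exists 0%nat; intros; discriminate.
           ++ apply (is_lim_seq_incr_1 INR), is_lim_seq_INR.
        -- unfold Rbar_mult, Rbar_mult'. destruct (Rle_dec 0 (- g)); [exfalso; lra|reflexivity].
Qed.

(** In a real shift both (s - 1) zeta(s) and the series are power series. Agreement just to the
    right of [s0] forces equal coefficients, hence agreement to the left. The radius [r] is chosen
    before [r'], the range of the known agreement, so each use advances by a definite amount. *)
Lemma zeta_repr_local zeta s0 : is_Riemann_zeta zeta -> 1 / 2 <= Re s0 -> s0 <> 1%C ->
  exists r, 0 < r /\ forall r', 0 < r' ->
    (forall x, 0 < x < r' -> zeta_repr zeta (s0 + RtoC x)%C) ->
    forall x, Rabs x < r -> zeta_repr zeta (s0 + RtoC x)%C.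
Proof.
  intros Hzeta Hs Hs1. destruct Hzeta as [_ H2].
  destruct (H2 s0 Hs1) as [c [rz Hc]].
  destruct (zeta_term_expansion s0 Hs) as [e He].
  exists (Rmin rz (/ 8)). split; [apply Rmin_pos; [apply cond_pos|lra]|].
  intros r' Hr' Hright.
  (* [d1] has the coefficients of (s0 - 1 + x) zeta(s0 + x); [d] subtracts those of the series and
     the constant 1. *)
  set (d1 := fun j => ((s0 - 1) * c j + match j with O => 0 | S i => c i end)%C).
  set (d := fun j => (d1 j - e j - match j with O => 1 | S _ => 0 end)%C).
  assert (Hd : forall x, Rabs x < Rmin rz (/ 8) -> exists l, cconv (csum (zeta_term (s0 + RtoC x))) l /\
    cconv (csum (fun j => RtoC (x ^ pred j) * d (pred j))%C)
      ((s0 + RtoC x - 1) * zeta (s0 + RtoC x) - l - 1)%C).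
  { intros x Hx.
    assert (Hx1 : Rabs x < rz) by (eapply Rlt_le_trans; [exact Hx|apply Rmin_l]).
    assert (Hx2 : Rabs x < / 8) by (eapply Rlt_le_trans; [exact Hx|apply Rmin_r]).
    destruct (He x ltac:(lra)) as [l [Hl1 Hl2]]. exists l. split; auto.
    assert (Hz : cconv (csum (fun j => RtoC (x ^ pred j) * c (pred j))%C) (zeta (s0 + RtoC x)%C)).
    { apply is_series_cconv.
      apply (is_series_ext (fun n => scal (K := C_AbsRing) (V := C_NormedModule) (pow_n (K := C_AbsRing) (RtoC x) n) (c n))).
      - intros n. simpl pred. change (pow_n (K := C_AbsRing) (RtoC x) n * c n = RtoC (x ^ n) * c n)%C.
        f_equal. induction n as [|n IHn]; [reflexivity|].
        change (RtoC x * pow_n (K := C_AbsRing) (RtoC x) n = RtoC (x * x ^ n))%C.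
        rewrite IHn, RtoC_mult. reflexivity.
      - apply Hc. rewrite Cmod_R. exact Hx1. }
    set (f := fun j => (RtoC (x ^ pred j) * c (pred j))%C) in *.
    apply cconv_incr_1.
    apply cconv_ext with (fun n => (s0 - 1) * csum f (S n) + RtoC x * csum f n
       - csum (fun j => RtoC (x ^ pred j) * e (pred j)) (S n) - 1)%C.
    - intros n. induction n as [|n IHn].
      + unfold d, d1, f; simpl. ring.
      + rewrite (csum_S (fun j => RtoC (x ^ pred j) * d (pred j))%C (S n)), <- IHn.
        rewrite (csum_S f (S n)), (csum_S (fun j => RtoC (x ^ pred j) * e (pred j))%C (S n)).
        rewrite (csum_S f n) at 2.
        unfold d, d1, f. simpl pred. change (x ^ S n) with (x * x ^ n). rewrite RtoC_mult. ring.
    - replace ((s0 + RtoC x - 1) * zeta (s0 + RtoC x) - l - 1)%C with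
        ((s0 - 1) * zeta (s0 + RtoC x) + RtoC x * zeta (s0 + RtoC x) - l - 1)%C by ring.
      apply cconv_minus; [|apply cconv_const].
      apply cconv_minus; [|apply cconv_incr_1'; exact Hl2].
      apply cconv_plus; apply cconv_scal; auto. apply cconv_incr_1'; auto. }
  assert (Zero : forall j, d j = 0%C).
  { apply complex_powerseries_zero with (Rmin r' (Rmin rz (/ 8))).
    - repeat apply Rmin_pos; try lra. apply cond_pos.
    - intros x [Hx0 Hx].
      assert (Hx1 : x < r') by (eapply Rlt_le_trans; [exact Hx|apply Rmin_l]).
      assert (Hx2 : x < Rmin rz (/ 8)) by (eapply Rlt_le_trans; [exact Hx|apply Rmin_r]).
      destruct (Hd x) as [l [L1 L2]]; [rewrite Rabs_pos_eq; lra|].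
      specialize (Hright x ltac:(lra)). unfold zeta_repr in Hright.
      assert (E := cconv_unique _ _ _ Hright (cconv_plus _ _ _ _ (cconv_const 1) L1)).
      rewrite E in L2. replace (1 + l - l - 1)%C with (RtoC 0) in L2 by ring. exact L2. }
  intros x Hx. destruct (Hd x Hx) as [l [L1 L2]].
  assert (E0 : cconv (csum (fun j => RtoC (x ^ pred j) * d (pred j))%C) 0%C).
  { apply cconv_ext with (fun _ => 0%C); [|apply cconv_const].
    intros n. rewrite <- (csum_zero n). apply csum_ext; intros. rewrite Zero. ring. }
  pose proof (cconv_unique _ _ _ L2 E0) as E.
  unfold zeta_repr. replace ((s0 + RtoC x - 1) * zeta (s0 + RtoC x))%C with (1 + l)%C.
  - apply cconv_plus; auto. apply cconv_const.
  - replace ((s0 + RtoC x - 1) * zeta (s0 + RtoC x))%C with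
      (((s0 + RtoC x - 1) * zeta (s0 + RtoC x) - l - 1) + (1 + l))%C by ring.
    rewrite E. ring.
Qed.

(** Real induction along the horizontal segment from [2 + it] to [1/2 + it], which avoids the pole.
    The supremum [m] of the distances covered can be exceeded by the local lemma unless it is
    3/2. *)
Lemma zeta_repr_half zeta t : is_Riemann_zeta zeta -> t <> 0 -> zeta_repr zeta (1 / 2, t).
Proof.
  intros Hzeta Ht.
  set (P := fun y => zeta_repr zeta (2 - y, t)).
  assert (shift : forall y x, (((2 - y)%R, t) + RtoC x)%C = (2 - (y - x), t)).
  { intros. apply injective_projections; simpl; ring. }
  set (S := fun x => 0 <= x <= 3 / 2 /\ forall y, 0 <= y < x -> P y).
  destruct (completeness S) as [m [Hm1 Hm2]].
  - exists (3 / 2). intros x [Hx _]; lra.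
  - exists 0. split; [lra|]. intros; lra.
  - assert (M0 : / 2 <= m).
    { apply Hm1. split; [lra|]. intros y Hy. apply zeta_repr_right; auto. unfold Re; simpl; lra. }
    assert (M1 : m <= 3 / 2) by (apply Hm2; intros x [Hx _]; lra).
    assert (HP : forall y, 0 <= y < m -> P y).
    { intros y Hy. 
      destruct (Rle_dec m y) as [|_]; [lra|].
      assert (~ forall x, S x -> x <= y).
      { intros Hb. specialize (Hm2 y Hb). lra. }
      apply NNPP. intros HN. apply H. intros x [Hx Hx'].
      destruct (Rle_dec x y); auto. exfalso. apply HN. apply Hx'. lra. }
    destruct (zeta_repr_local zeta (2 - m, t) Hzeta) as [r [Hr Hloc]].
    { unfold Re; simpl; lra. }
    { intros E. apply (f_equal snd) in E. simpl in E. lra. }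
    assert (HQ : forall x, Rabs x < r -> P (m - x)).
    { intros x Hx. unfold P. rewrite <- shift. apply (Hloc m); auto; [lra|].
      intros u Hu. rewrite shift. apply HP. lra. }
    destruct (Rle_dec (3 / 2) m) as [Hge|Hlt].
    + specialize (HQ 0). rewrite Rabs_R0 in HQ. specialize (HQ Hr).
      unfold P in HQ. replace (1 / 2) with (2 - (m - 0)) by lra. exact HQ.
    + exfalso. set (m' := Rmin (m + r / 2) (3 / 2)).
      assert (m < m' <= 3 / 2) by (unfold m', Rmin; destruct Rle_dec; lra).
      assert (m' <= m + r / 2) by apply Rmin_l.
      specialize (Hm1 m'). enough (m' <= m) by lra. apply Hm1. split; [lra|].
      intros y Hy. destruct (Rlt_dec y m) as [|Hn]; [apply HP; lra|].
      replace y with (m - (m - y)) by ring. apply HQ. rewrite Rabs_left1; lra.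
Qed.

(** * Approximation of zeta(1/2 + it) by a Dirichlet polynomial *)

Lemma Rpow_C_mult x y w : 0 < x -> 0 < y -> Rpow_C (x * y) w = (Rpow_C x w * Rpow_C y w)%C.
Proof.
  intros Hx Hy. rewrite !Rpow_C_polar, ln_mult, !Rmult_plus_distr_l, exp_plus, cis_plus, RtoC_mult by auto.
  ring.
Qed.

Lemma Rpow_C_derive w x : 0 < x ->
  is_derive (fun u => fst (Rpow_C u w)) x (fst (w * Rpow_C x (w - 1))%C) /\
  is_derive (fun u => snd (Rpow_C u w)) x (snd (w * Rpow_C x (w - 1))%C).
Proof.
  intros Hx.
  assert (Q : cder (fun _ => 1%C) (fun _ => 0%C)).
  { intros L; split; apply (is_derive_const (V := R_NormedModule)). }
  destruct (logpow_derive w _ _ x Q Hx) as [D1 D2].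
  unfold logpow in D1, D2.
  replace ((0 + w * 1) * Rpow_C x (w - 1))%C with (w * Rpow_C x (w - 1))%C in D1, D2 by ring.
  split; [eapply is_derive_ext; [|exact D1]|eapply is_derive_ext; [|exact D2]];
  intros u; simpl; ring.
Qed.

Lemma Rpower_le_1 x y : 1 <= x -> y <= 0 -> Rpower x y <= 1.
Proof.
  intros Hx Hy. rewrite <- (Rpower_O x) by lra. apply Rle_Rpower; lra.
Qed.

Lemma Rpow_C_mvt w x y : Re w <= 1 -> 1 <= x -> x <= y ->
  Cmod (Rpow_C y w - Rpow_C x w) <= Cmod w * (y - x).
Proof.
  intros Hw Hx Hxy. apply (Cmod_mvt (fun u => Rpow_C u w) (fun u => w * Rpow_C u (w - 1))%C); auto.
  intros t Ht. destruct (Rpow_C_derive w t ltac:(lra)) as [D1 D2].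
  split; [exact D1|split; [exact D2|]].
  rewrite Cmod_mult, Cmod_Rpow_C. rewrite <- (Rmult_1_r (Cmod w)) at 2.
  apply Rmult_le_compat_l; [apply Cmod_ge_0|]. apply Rpower_le_1; [lra|]. unfold Re in *; simpl; lra.
Qed.

(** With [v = 1 / n] this is [zeta_term] divided by [n^w], where [w = 1 - s]. *)
Definition binom_rem (w : C) (v : R) : C := (Rpow_C (1 + v) w - 1 - w * RtoC v)%C.

(** The difference form serves partial summation, where the values at [1 / n] and [1 / (n + 1)] are
    compared. *)
Lemma binom_rem_mvt w u v : Re w <= 1 -> 0 <= u -> u <= v ->
  Cmod (binom_rem w v - binom_rem w u) <= Cmod w * Cmod (w - 1) * v * (v - u).
Proof.
  intros Hw Hu Huv.
  apply (Cmod_mvt (binom_rem w) (fun y => w * (Rpow_C (1 + y) (w - 1) - Rpow_C 1 (w - 1)))%C); auto.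
  intros y Hy.
  assert (Hy' : 0 < 1 + y) by lra.
  destruct (Rpow_C_derive w (1 + y) Hy') as [D1 D2].
  assert (Da : is_derive (fun y => 1 + y) y 1) by (auto_derive; auto; ring).
  pose proof (is_derive_comp _ _ _ _ _ D1 Da) as E1.
  pose proof (is_derive_comp _ _ _ _ _ D2 Da) as E2.
  rewrite Rpow_C_1.
  set (X := Rpow_C (1 + y) (w - 1)) in *.
  split; [|split].
  - replace (fst (w * (X - 1))%C) with (scal 1 (fst (w * X)%C) - fst w)
      by (unfold scal; simpl; unfold mult; simpl; ring).
    apply (is_derive_ext (fun z => fst (Rpow_C (1 + z) w) - (1 + fst w * z))).
    { intros z. unfold binom_rem; simpl; ring. }
    apply is_derive_minusR; [exact E1|]. auto_derive; auto; ring.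
  - replace (snd (w * (X - 1))%C) with (scal 1 (snd (w * X)%C) - snd w)
      by (unfold scal; simpl; unfold mult; simpl; ring).
    apply (is_derive_ext (fun z => snd (Rpow_C (1 + z) w) - (snd w * z))).
    { intros z. unfold binom_rem; simpl; ring. }
    apply is_derive_minusR; [exact E2|]. auto_derive; auto; ring.
  - rewrite Cmod_mult, Rmult_assoc. apply Rmult_le_compat_l; [apply Cmod_ge_0|].
    replace (X - 1)%C with (X - Rpow_C 1 (w - 1))%C by (rewrite Rpow_C_1; reflexivity). unfold X.
    eapply Rle_trans; [apply Rpow_C_mvt; try lra|].
    + unfold Re in *; simpl; lra.
    + apply Rmult_le_compat_l; [apply Cmod_ge_0|lra].
Qed.

Lemma binom_rem_bound w v : Re w <= 1 -> 0 <= v ->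
  Cmod (binom_rem w v) <= Cmod w * Cmod (w - 1) * (v * v).
Proof.
  intros Hw Hv. pose proof (binom_rem_mvt w 0 v Hw (Rle_refl 0) Hv) as H.
  assert (E : binom_rem w 0 = 0%C).
  { unfold binom_rem. rewrite Rplus_0_r, Rpow_C_1. ring. }
  rewrite E in H. replace (binom_rem w v - 0)%C with (binom_rem w v) in H by ring. lra.
Qed.

Lemma Rpow_C_half x t : 0 < x -> Rpow_C x (1 / 2, - t) = (RtoC (sqrt x) * cis (- (t * ln x)))%C.
Proof.
  intros Hx. rewrite Rpow_C_polar. f_equal.
  - f_equal. rewrite <- Rpower_sqrt by auto. unfold Rpower, Re; simpl. f_equal. field.
  - f_equal. unfold Im; simpl. ring.
Qed.

Lemma zeta_term_half t n : (1 <= n)%nat -> zeta_term (1 / 2, t) n =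
  (RtoC (sqrt (INR n)) * binom_rem ((1 / 2)%R, (- t)%R) (/ INR n) * cis (- (t * ln (INR n))))%C.
Proof.
  intros Hn. pose proof (lt_0_INR n Hn) as P.
  set (w := (1 / 2, - t) : C).
  assert (E1 : (1 - ((1 / 2)%R, t))%C = w) by (apply injective_projections; simpl; field).
  assert (E2 : (- ((1 / 2)%R, t))%C = (w - 1)%C) by (apply injective_projections; simpl; field).
  unfold zeta_term. rewrite E1, E2, Rpow_C_pred by auto.
  replace (INR n + 1) with (INR n * (1 + / INR n)) by fld.
  rewrite Rpow_C_mult.
  - unfold binom_rem. unfold w at 1 3 5. rewrite !Rpow_C_half by auto. fold w.
    rewrite <- !(Rmult_comm (ln _) t). ring.
  - auto.
  - pose proof (Rinv_0_lt_compat _ P). lra.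
Qed.

Lemma Rpow_C_mhalf x t : 0 < x -> Rpow_C x (- ((1 / 2)%R, t)) = (RtoC (/ sqrt x) * cis (- (t * ln x)))%C.
Proof.
  intros Hx. rewrite Rpow_C_polar. f_equal.
  - f_equal. rewrite <- Rpower_sqrt, <- Rpower_Ropp by auto. unfold Rpower, Re; simpl. f_equal. field.
  - f_equal. unfold Im; simpl. ring.
Qed.

Lemma zsum_long_abs (t : R) (p n : nat) : t <> 0 -> Rabs t <= INR p -> (1 <= p)%nat ->
  Cmod (csum (fun i => cis (- (t * ln (INR (p + i))))) n) <= 14 * INR (p + n) / Rabs t.
Proof.
  intros Ht Hp Hp1. destruct (Rle_lt_dec 0 t) as [H|H].
  - rewrite Rabs_pos_eq in * by lra. rewrite csum_cis_neg. apply zsum_long; auto. lra.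
  - rewrite Rabs_left in * by lra.
    rewrite (csum_ext _ (fun i => cis ((- t) * ln (INR (p + i))))).
    + apply zsum_long; auto. lra.
    + intros; f_equal; ring.
Qed.

Lemma sqrt_over_sq x : 0 < x -> sqrt x / (x * x) = Rpower x (- 1 - / 2).
Proof.
  intros Hx. replace (- 1 - / 2) with (/ 2 + - (1 + 1)) by field.
  rewrite Rpower_plus, Rpower_Ropp, Rpower_plus, Rpower_1, Rpower_sqrt by auto. reflexivity.
Qed.

(** Absolute values would give [t^2 / sqrt p], too large by a factor [|t|] when [p = |t|]. Each term
    is [cis (- t ln n)] with a smooth coefficient of size [t^2 n^(-3/2)], and partial summation
    against [zsum_long_abs] saves that factor. *)
Lemma zeta_tail_bound (t : R) (p n : nat) : 1 <= Rabs t -> Rabs t <= INR p ->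
  Cmod (csum (fun i => zeta_term (1 / 2, t) (p + i)) n) <= 300 * sqrt (INR p).
Proof.
  intros Ht Hp.
  assert (Hp1 : (1 <= p)%nat) by (destruct p; [simpl in Hp; lra|lia]).
  assert (Ht0 : t <> 0) by (intros ->; rewrite Rabs_R0 in Ht; lra).
  set (w := (1 / 2, - t) : C).
  set (T := Rabs t) in *.
  assert (Hw : Cmod w * Cmod (w - 1) <= 3 * (T * T)).
  { assert (A : Cmod w * Cmod w = 1 / 4 + t * t) by (rewrite Cmod_sqr; unfold w, Re, Im; simpl; field).
    assert (B : Cmod (w - 1) * Cmod (w - 1) = 1 / 4 + t * t) by (rewrite Cmod_sqr; unfold w, Re, Im; simpl; field).
    assert (E : T * T = t * t) by (unfold T; rewrite <- Rabs_mult; apply Rabs_pos_eq, Rle_0_sqr).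
    assert (0 <= (Cmod w - Cmod (w - 1)) * (Cmod w - Cmod (w - 1))) by apply Rle_0_sqr. nra. }
  set (K := Cmod w * Cmod (w - 1)) in *.
  assert (K0 : 0 <= K) by (apply Rmult_le_pos; apply Cmod_ge_0).
  assert (Rw : Re w <= 1) by (unfold w, Re; simpl; lra).
  destruct n as [|n].
  { simpl. rewrite Cmod_0. pose proof (sqrt_pos (INR p)). lra. }
  set (c := fun i => (RtoC (sqrt (INR (p + i))) * binom_rem w (/ INR (p + i)))%C).
  rewrite (csum_ext _ (fun i => c i * cis (- (t * ln (INR (p + i)))))%C).
  2: { intros i Hi. apply zeta_term_half; lia. }
  assert (Cb : forall i, Cmod (c i) <= K * Rpower (INR (p + i)) (- 1 - / 2)).
  { intros i. assert (P : 0 < INR (p + i)) by (apply lt_0_INR; lia).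
    unfold c. rewrite Cmod_RtoC_mult by apply sqrt_pos.
    rewrite <- sqrt_over_sq by auto.
    eapply Rle_trans; [apply Rmult_le_compat_l; [apply sqrt_pos|apply binom_rem_bound; auto]|].
    - apply Rlt_le, Rinv_0_lt_compat; auto.
    - fold K. apply Req_le. fld. }
  (* Multiplied by the index, the variation of the coefficients is as small as the coefficients
     themselves; this offsets the partial sums, which grow like the index over [T]. *)
  assert (Cd : forall i, INR (p + i) * Cmod (c i - c (S i)) <= 2 * K * Rpower (INR (p + i)) (- 1 - / 2)).
  { intros i. assert (P : 0 < INR (p + i)) by (apply lt_0_INR; lia).
    rewrite <- sqrt_over_sq by auto. unfold c. rewrite Nat.add_succ_r, S_INR.
    set (x := INR (p + i)) in *.
    assert (Px : 0 < / x) by (apply Rinv_0_lt_compat; auto).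
    assert (Px1 : 0 < / (x + 1)) by (apply Rinv_0_lt_compat; lra).
    assert (Pd : / (x + 1) <= / x) by (apply Rinv_le_contravar; lra).
    assert (S0 : 0 < sqrt x) by (apply sqrt_lt_R0; auto).
    assert (S1 : sqrt x <= sqrt (x + 1)) by (apply sqrt_le_1; lra).
    assert (E0 : sqrt x * sqrt x = x) by (apply sqrt_sqrt; lra).
    assert (E1 : sqrt (x + 1) * sqrt (x + 1) = x + 1) by (apply sqrt_sqrt; lra).
    replace (RtoC (sqrt x) * binom_rem w (/ x) - RtoC (sqrt (x + 1)) * binom_rem w (/ (x + 1)))%C with
      (RtoC (sqrt x) * (binom_rem w (/ x) - binom_rem w (/ (x + 1))) -
       RtoC (sqrt (x + 1) - sqrt x) * binom_rem w (/ (x + 1)))%C by (rewrite RtoC_minus; ring).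
    eapply Rle_trans; [apply Rmult_le_compat_l; [lra|apply Cmod_minus_le]|].
    rewrite !Cmod_RtoC_mult by lra.
    assert (B1 : Cmod (binom_rem w (/ x) - binom_rem w (/ (x + 1))) <= K * (/ x * (/ x * / x))).
    { eapply Rle_trans; [apply binom_rem_mvt; lra|]. fold K. rewrite Rmult_assoc.
      apply Rmult_le_compat_l; auto. apply Rmult_le_compat_l; [lra|].
      replace (/ x - / (x + 1)) with (/ x * / (x + 1)) by fld. apply Rmult_le_compat_l; lra. }
    assert (B2 : Cmod (binom_rem w (/ (x + 1))) <= K * (/ x * / x)).
    { eapply Rle_trans; [apply binom_rem_bound; lra|]. fold K. apply Rmult_le_compat_l; auto.
      apply Rmult_le_compat; lra. }
    assert (B3 : sqrt (x + 1) - sqrt x <= / sqrt x).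
    { apply (Rmult_le_reg_r (sqrt x)); auto. rewrite Rinv_l by lra. nra. }
    assert (B4 : sqrt x * Cmod (binom_rem w (/ x) - binom_rem w (/ (x + 1))) <= sqrt x * (K * (/ x * (/ x * / x))))
      by (apply Rmult_le_compat_l; lra).
    assert (B5 : (sqrt (x + 1) - sqrt x) * Cmod (binom_rem w (/ (x + 1))) <= / sqrt x * (K * (/ x * / x))).
    { apply Rmult_le_compat; try lra. apply Cmod_ge_0. }
    apply Rle_trans with (x * (sqrt x * (K * (/ x * (/ x * / x))) + / sqrt x * (K * (/ x * / x)))).
    - apply Rmult_le_compat_l; lra.
    - assert (E3 : / sqrt x = sqrt x * / x) by (replace (/ x) with (/ (sqrt x * sqrt x)) by (rewrite E0; reflexivity); fld).
      rewrite E3. apply Req_le. fld. }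
  eapply Rle_trans.
  - apply (abel_bound (fun i => cis (- (t * ln (INR (p + i))))) c (fun i => 14 * INR (p + i) / T)).
    intros i Hi. apply zsum_long_abs; auto.
  - assert (PT : 0 < / T) by (apply Rinv_0_lt_compat; lra).
    assert (Pp : 0 < INR p) by (apply lt_0_INR; auto).
    set (R0 := rsum (fun i => Rpower (INR (p + i)) (- 1 - / 2)) n).
    assert (HR : R0 <= 2 * / sqrt (INR p)).
    { unfold R0. eapply Rle_trans; [apply rsum_Rpower_tail; [lra|auto]|].
      rewrite Rpower_Ropp, Rpower_sqrt, Rinv_inv by auto. lra. }
    assert (A1 : 14 * INR (p + S n) / T * Cmod (c (S n)) <= 14 * K / T * / sqrt (INR p)).
    { assert (P : 0 < INR (p + S n)) by (apply lt_0_INR; lia).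
      specialize (Cb (S n)). rewrite <- sqrt_over_sq in Cb by auto.
      set (x := INR (p + S n)) in *.
      assert (S0 : 0 < sqrt x) by (apply sqrt_lt_R0; auto).
      assert (E0 : sqrt x * sqrt x = x) by (apply sqrt_sqrt; lra).
      apply Rle_trans with (14 * x / T * (K * (sqrt x / (x * x)))).
      - apply Rmult_le_compat_l; auto. unfold Rdiv. apply Rmult_le_pos; lra.
      - assert (E3 : sqrt x / x = / sqrt x) by (rewrite <- E0 at 2; fld).
        replace (14 * x / T * (K * (sqrt x / (x * x)))) with (14 * K / T * (sqrt x / x)) by fld.
        rewrite E3. apply Rmult_le_compat_l; [unfold Rdiv; apply Rmult_le_pos; lra|].
        apply Rinv_le_contravar; [apply sqrt_lt_R0; auto|].
        apply sqrt_le_1; try lra. apply le_INR; lia. }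
    assert (A2 : rsum (fun i => 14 * INR (p + i) / T * Cmod (c i - c (S i))) n <= 28 * K / T * R0).
    { unfold R0. rewrite <- rsum_scal. apply rsum_le; intros i Hi. specialize (Cd i).
      replace (14 * INR (p + i) / T * Cmod (c i - c (S i))) with
        (14 * / T * (INR (p + i) * Cmod (c i - c (S i)))) by (unfold Rdiv; ring).
      replace (28 * K / T * Rpower (INR (p + i)) (- 1 - / 2)) with
        (14 * / T * (2 * K * Rpower (INR (p + i)) (- 1 - / 2))) by (unfold Rdiv; ring).
      apply Rmult_le_compat_l; lra. }
    assert (S0 : 0 < sqrt (INR p)) by (apply sqrt_lt_R0; auto).
    assert (A3 : 28 * K / T * R0 <= 28 * K / T * (2 * / sqrt (INR p))).
    { apply Rmult_le_compat_l; auto. unfold Rdiv. apply Rmult_le_pos; lra. }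
    assert (A4 : K / T <= 3 * T).
    { apply (Rmult_le_reg_r T); [lra|]. unfold Rdiv. rewrite Rmult_assoc, Rinv_l; lra. }
    assert (A5 : K / T * / sqrt (INR p) <= 3 * sqrt (INR p)).
    { apply Rle_trans with (3 * INR p * / sqrt (INR p)).
      - apply Rmult_le_compat_r; [apply Rlt_le, Rinv_0_lt_compat; auto|]. lra.
      - apply Req_le. rewrite <- (sqrt_sqrt (INR p)) at 1 by lra. fld. }
    unfold Rdiv in *. nra.
Qed.

(** The tail of the series and the boundary term [(M + 1)^(1 - s)] contribute 300 and 2 times
    [sqrt M]; division by [s - 1] brings the factor [1 / |t|]. *)
Lemma zeta_approx zeta t M : is_Riemann_zeta zeta -> 1 <= Rabs t -> Rabs t <= INR M ->
  Cmod (zeta ((1 / 2)%R, t) - dpoly M t) <= 302 * sqrt (INR M) / Rabs t.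
Proof.
  intros Hz Ht HM.
  assert (Ht0 : t <> 0) by (intros ->; rewrite Rabs_R0 in Ht; lra).
  set (s := (1 / 2, t) : C).
  pose proof (zeta_repr_half zeta t Hz Ht0) as R0. fold s in R0. unfold zeta_repr in R0.
  assert (E : (1 + csum (zeta_term s) M)%C = (Rpow_C (INR M + 1) (1 - s) + (s - 1) * dpoly M t)%C).
  { rewrite csum_zeta_term. do 2 f_equal. apply csum_ext; intros i Hi.
    apply Rpow_C_mhalf, lt_0_INR; lia. }
  assert (B : Cmod ((s - 1) * zeta s - (1 + csum (zeta_term s) M)) <= 300 * sqrt (INR M)).
  { apply cconv_bound with (fun n => (1 + csum (zeta_term s) (M + n)) - (1 + csum (zeta_term s) M))%C.
    - apply cconv_minus; [|apply cconv_const].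
      unfold cconv in *. apply (is_lim_seq_incr_n _ M) in R0.
      eapply is_lim_seq_ext; [|exact R0]. intros n. rewrite Nat.add_comm. reflexivity.
    - intros n. rewrite csum_add.
      replace (1 + (csum (zeta_term s) M + csum (fun i => zeta_term s (M + i)) n) - (1 + csum (zeta_term s) M))%C
        with (csum (fun i => zeta_term s (M + i)) n) by ring.
      apply zeta_tail_bound; auto. }
  rewrite E in B.
  assert (B2 : Cmod (Rpow_C (INR M + 1) (1 - s)) <= 2 * sqrt (INR M)).
  { rewrite Cmod_Rpow_C. replace (Re (1 - s)) with (/ 2) by (unfold s, Re; simpl; field).
    rewrite Rpower_sqrt by lra.
    apply Rsqr_incr_0_var; [|pose proof (sqrt_pos (INR M)); lra].
    unfold Rsqr. rewrite sqrt_sqrt by lra.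
    replace (2 * sqrt (INR M) * (2 * sqrt (INR M))) with (4 * (sqrt (INR M) * sqrt (INR M))) by ring.
    rewrite sqrt_sqrt by lra. lra. }
  assert (B3 : Cmod ((s - 1) * (zeta s - dpoly M t)) <= 302 * sqrt (INR M)).
  { replace ((s - 1) * (zeta s - dpoly M t))%C with
      (((s - 1) * zeta s - (Rpow_C (INR M + 1) (1 - s) + (s - 1) * dpoly M t)) + Rpow_C (INR M + 1) (1 - s))%C by ring.
    eapply Rle_trans; [apply Cmod_triangle|]. lra. }
  rewrite Cmod_mult in B3.
  assert (B4 : Rabs t <= Cmod (s - 1)).
  { eapply Rle_trans; [|apply Im_le_Cmod_abs]. unfold s, Im; simpl. apply Req_le. f_equal. ring. }
  apply (Rmult_le_reg_l (Rabs t)); [lra|].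
  replace (Rabs t * (302 * sqrt (INR M) / Rabs t)) with (302 * sqrt (INR M)) by fld.
  eapply Rle_trans; [|exact B3]. apply Rmult_le_compat_r; [apply Cmod_ge_0|exact B4].
Qed.

(** * Mean squares *)

Lemma cont_cos_lin u : cont (fun t => cos (u * t)).
Proof.
  apply (cont_comp (fun t => u * t)); auto using cont_mult, cont_const, cont_id, cont_cos.
Qed.

Lemma cont_fejer V : cont (fun t => 1 - t / V).
Proof. apply cont_minus; [apply cont_const|]. apply cont_mult; auto using cont_const, cont_id. Qed.

(* The Fejer weight makes the transform O(1/(V u^2)). *)
Lemma RInt_fejer V u : 0 < V -> u <> 0 ->
  RInt (fun t => (1 - t / V) * cos (u * t)) 0 V <= 2 / (V * (u * u)).
Proof.
  intros HV Hu.
  rewrite (RInt_antideriv (fun t => (1 - t / V) * sin (u * t) / u - cos (u * t) / (V * (u * u)))).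
  - rewrite Rmult_0_r, sin_0, cos_0.
    replace ((1 - V / V) * sin (u * V) / u - cos (u * V) / (V * (u * u)) -
      ((1 - 0 / V) * 0 / u - 1 / (V * (u * u)))) with ((1 - cos (u * V)) / (V * (u * u)))
      by (field; split; (assumption || lra)).
    apply Rmult_le_compat_r.
    + apply Rlt_le, Rinv_0_lt_compat. apply Rmult_lt_0_compat; auto. apply Rsqr_pos_lt; auto.
    + pose proof (COS_bound (u * V)). lra.
  - intros t. auto_derive; [auto|]. field; split; (assumption || lra).
  - apply cont_mult; auto using cont_fejer, cont_cos_lin.
Qed.

Lemma RInt_fejer_0 V : 0 < V -> RInt (fun t => (1 - t / V) * cos (0 * t)) 0 V = V / 2.
Proof.
  intros HV.
  rewrite (RInt_ext _ (fun t => 1 - t / V)).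
  - rewrite (RInt_antideriv (fun t => t - t * t / (2 * V))).
    + eqR. field; lra.
    + intros t. auto_derive; [auto|]. field; lra.
    + apply cont_fejer.
  - intros t _. rewrite Rmult_0_l, cos_0. eqR. ring.
Qed.

Lemma Cmod_sqr_trig_sum (w l : nat -> R) M :
  Cmod (csum (fun m => RtoC (w m) * cis (- l m))%C M) * Cmod (csum (fun m => RtoC (w m) * cis (- l m))%C M) =
  rsum (fun m => rsum (fun k => w m * w k * cos (l m - l k)) M) M.
Proof.
  rewrite Cmod_sqr, Re_csum, Im_csum, !rsum_mult, <- rsum_plus.
  apply rsum_ext; intros m _. rewrite <- rsum_plus. apply rsum_ext; intros k _.
  unfold Re, Im; simpl. rewrite !cos_neg, !sin_neg, cos_minus. ring.
Qed.

Lemma RInt_ge0R f a b : cont f -> a <= b -> (forall t, a <= t <= b -> 0 <= f t) -> 0 <= RInt f a b.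
Proof.
  intros F Hab H. apply RInt_ge_0; auto using cont_ex_RInt. intros; apply H; lra.
Qed.

(** A bound of large sieve type: the frequencies [a ln m] and [a ln k] differ by at least
    [|m - k| / M]. Thanks to the Fejer weight the off-diagonal terms decay like
    [M^2 / (T (m - k)^2)], whose sum over [k] is bounded. *)
Lemma mean_square (w : nat -> R) (a T : R) (M : nat) : 1 <= a -> 0 < T -> (1 <= M)%nat ->
  RInt (fun t => Cmod (csum (fun m => RtoC (w m) * cis (- (a * t * ln (INR m))))%C M) ^ 2) 0 T <=
  64 * (T + INR M * INR M / T) * rsum (fun m => w m * w m) M.
Proof.
  intros Ha HT HM.
  (* On [[0, T]] the weight [1 - t / (2 T)] is at least 1/2. *)
  set (V := 2 * T). assert (HV : 0 < V) by (unfold V; lra).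
  pose proof (INR_ge1 M HM) as PM.
  set (u := fun m k => a * ln (INR m) - a * ln (INR k)).
  set (G := fun t => rsum (fun m => rsum (fun k => w m * w k * cos (u m k * t)) M) M).
  assert (EG : forall t, Cmod (csum (fun m => RtoC (w m) * cis (- (a * t * ln (INR m))))%C M) ^ 2 = G t).
  { intros t. simpl. rewrite Rmult_1_r.
    rewrite (Cmod_sqr_trig_sum w (fun m => a * t * ln (INR m)) M).
    apply rsum_ext; intros; apply rsum_ext; intros. f_equal. f_equal. unfold u. ring. }
  assert (CG : cont G).
  { intros t. apply (continuous_ext (fun t => Cmod (csum (fun m => RtoC (w m) * cis (- (a * t * ln (INR m))))%C M) ^ 2)).
    - intros; apply EG.
    - revert t. simpl.
      assert (C0 : cont (fun t => Cmod (csum (fun m => RtoC (w m) * cis (- (a * t * ln (INR m))))%C M))).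
      { apply cont_Cmod, ccont_csum. intros i. apply ccont_mult; [apply ccont_const|].
        apply ccont_cis. intros t. apply (continuous_opp (fun t => a * t * ln (INR i))).
        apply cont_mult; [apply cont_mult|]; auto using cont_const, cont_id. }
      apply cont_mult; auto. apply cont_mult; auto using cont_const. }
  assert (G0 : forall t, 0 <= G t) by (intros t; rewrite <- EG; apply pow2_ge_0).
  rewrite (RInt_ext _ G) by (intros; apply EG).
  assert (CF : cont (fun t => (1 - t / V) * G t)) by (apply cont_mult; auto using cont_fejer).
  assert (A1 : RInt G 0 T <= 2 * RInt (fun t => (1 - t / V) * G t) 0 V).
  { rewrite <- (RInt_ChaslesR _ 0 T V) by auto.
    assert (B1 : 0 <= RInt (fun t => (1 - t / V) * G t) T V).
    { apply RInt_ge0R; [auto|unfold V; lra|]. intros t Ht. apply Rmult_le_pos; auto.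
      apply Rmult_le_reg_r with V; auto. replace ((1 - t / V) * V) with (V - t) by fld. lra. }
    assert (B2 : RInt G 0 T <= RInt (fun t => 2 * ((1 - t / V) * G t)) 0 T).
    { apply RInt_leR; auto; [apply cont_mult; auto using cont_const|lra|].
      intros t Ht. assert (1 / 2 <= 1 - t / V).
      { apply Rmult_le_reg_r with V; auto. replace ((1 - t / V) * V) with (V - t) by fld. unfold V; lra. }
      specialize (G0 t). nra. }
    rewrite RInt_scalR in B2 by auto. lra. }
  assert (A2 : RInt (fun t => (1 - t / V) * G t) 0 V =
    rsum (fun m => rsum (fun k => w m * w k * RInt (fun t => (1 - t / V) * cos (u m k * t)) 0 V) M) M).
  { assert (C1 : forall m k, cont (fun t => (1 - t / V) * cos (u m k * t))).
    { intros; apply cont_mult; auto using cont_fejer, cont_cos_lin. }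
    assert (C2 : forall m k, cont (fun t => w m * w k * ((1 - t / V) * cos (u m k * t)))).
    { intros; apply cont_mult; auto using cont_const. }
    assert (C3 : forall m n, cont (fun t => rsum (fun k => w m * w k * ((1 - t / V) * cos (u m k * t))) n)).
    { intros m n; induction n as [|n IH]; simpl; [apply cont_const|apply cont_plus; auto]. }
    rewrite (RInt_ext _ (fun t => rsum (fun m => rsum (fun k => w m * w k * ((1 - t / V) * cos (u m k * t))) M) M)).
    - rewrite RInt_rsum by auto. apply rsum_ext; intros m _.
      rewrite RInt_rsum by auto. apply rsum_ext; intros k _. apply RInt_scalR; auto.
    - intros t _. unfold G. rewrite <- rsum_scal. apply rsum_ext; intros.
      rewrite <- rsum_scal. apply rsum_ext; intros. eqR. ring. }
  set (Q := 2 * V + 8 * (INR M * INR M / V)).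
  assert (PMV : 0 < INR M * INR M / V) by (apply Rdiv_lt_0_compat; nra).
  set (D := fun m k => / ((1 + Rabs (INR k - INR m)) * (1 + Rabs (INR k - INR m)))).
  assert (D0 : forall m k, 0 < D m k).
  { intros. apply Rinv_0_lt_compat. pose proof (Rabs_pos (INR k - INR m)). nra. }
  assert (A3 : forall m k, (1 <= m <= M)%nat -> (1 <= k <= M)%nat ->
     0 <= Q * D m k - Rabs (RInt (fun t => (1 - t / V) * cos (u m k * t)) 0 V)).
  { intros m k Hm Hk.
    assert (P0 : - (Q * D m k) <= RInt (fun t => (1 - t / V) * cos (u m k * t)) 0 V <= Q * D m k); [|apply Rabs_le in P0; lra].
    destruct (Nat.eq_dec m k) as [->|Hmk].
    - unfold u. rewrite Rminus_diag, RInt_fejer_0 by auto.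
      unfold D. rewrite Rminus_diag, Rabs_R0. replace (/ ((1 + 0) * (1 + 0))) with 1 by (field; lra).
      unfold Q. lra.
    - assert (Hd : 1 <= Rabs (INR k - INR m)).
      { destruct (Nat.lt_trichotomy m k) as [L|[L|L]]; [|lia|].
        - rewrite Rabs_pos_eq, <- minus_INR by (try lia; assert (INR m <= INR k) by (apply le_INR; lia); lra).
          apply INR_ge1; lia.
        - rewrite Rabs_minus_sym, Rabs_pos_eq, <- minus_INR
            by (try lia; assert (INR k <= INR m) by (apply le_INR; lia); lra).
          apply INR_ge1; lia. }
      set (d := Rabs (INR k - INR m)) in *.
      assert (Hu : d / INR M <= Rabs (u m k)).
      { unfold u. rewrite <- Rmult_minus_distr_l, Rabs_mult, (Rabs_pos_eq a) by lra.
        pose proof (lt_0_INR m ltac:(lia)) as Pm. pose proof (lt_0_INR k ltac:(lia)) as Pk.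
        pose proof (ln_sub_ge (INR m) (INR k) Pm Pk) as L.
        rewrite Rabs_minus_sym in L. fold d in L.
        assert (Rmax (INR m) (INR k) <= INR M) by (apply Rmax_lub; apply le_INR; lia).
        assert (0 < Rmax (INR m) (INR k)) by (eapply Rlt_le_trans; [exact Pm|apply Rmax_l]).
        apply Rle_trans with (d / Rmax (INR m) (INR k)).
        - apply Rmult_le_compat_l; [lra|]. apply Rinv_le_contravar; auto.
        - pose proof (Rabs_pos (ln (INR m) - ln (INR k))). nra. }
      assert (Hu1 : 0 < d / INR M) by (apply Rdiv_lt_0_compat; lra).
      assert (Hu0 : u m k <> 0) by (intros E; rewrite E, Rabs_R0 in Hu; lra).
      assert (Hsq : d / INR M * (d / INR M) <= u m k * u m k).
      { replace (u m k * u m k) with (Rabs (u m k) * Rabs (u m k)).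
        - apply Rmult_le_compat; lra.
        - rewrite <- Rabs_mult. apply Rabs_pos_eq, Rle_0_sqr. }
      assert (QD : 2 / (V * (d / INR M * (d / INR M))) <= Q * D m k).
      { apply Rle_trans with (8 * (INR M * INR M / V) * D m k).
        - replace (2 / (V * (d / INR M * (d / INR M)))) with (8 * (INR M * INR M / V) * / (2 * d * (2 * d))) by fld.
          apply Rmult_le_compat_l; [lra|]. unfold D. fold d. apply Rinv_le_contravar; nra.
        - apply Rmult_le_compat_r; [apply Rlt_le, D0|]. unfold Q. lra. }
      assert (Hup := RInt_fejer V (u m k) HV Hu0).
      assert (2 / (V * (u m k * u m k)) <= 2 / (V * (d / INR M * (d / INR M)))).
      { apply Rmult_le_compat_l; [lra|]. apply Rinv_le_contravar; [|apply Rmult_le_compat_l; lra].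
        apply Rmult_lt_0_compat; [auto|]. apply Rmult_lt_0_compat; auto. }
      split; [|lra].
      (* The transform of the Fejer weight is nonnegative, so only the upper bound has content. *)
      enough (0 <= RInt (fun t => (1 - t / V) * cos (u m k * t)) 0 V) by
        (assert (0 < Q * D m k) by (apply Rmult_lt_0_compat; [unfold Q; lra|apply D0]); lra).
      rewrite (RInt_antideriv (fun t => (1 - t / V) * sin (u m k * t) / u m k - cos (u m k * t) / (V * (u m k * u m k)))).
      + rewrite Rmult_0_r, sin_0, cos_0.
        replace ((1 - V / V) * sin (u m k * V) / u m k - cos (u m k * V) / (V * (u m k * u m k)) -
          ((1 - 0 / V) * 0 / u m k - 1 / (V * (u m k * u m k)))) with ((1 - cos (u m k * V)) / (V * (u m k * u m k)))
          by (field; split; (assumption || lra)).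
        apply Rmult_le_pos; [pose proof (COS_bound (u m k * V)); lra|].
        apply Rlt_le, Rinv_0_lt_compat. apply Rmult_lt_0_compat; auto. apply Rsqr_pos_lt; auto.
      + intros t. auto_derive; [auto|]. field; split; (assumption || lra).
      + apply cont_mult; auto using cont_fejer, cont_cos_lin. }
  assert (A4 : RInt (fun t => (1 - t / V) * G t) 0 V <=
     rsum (fun m => rsum (fun k => Q / 2 * (w m * w m * D m k + w k * w k * D m k)) M) M).
  { rewrite A2. apply rsum_le; intros m Hm. apply rsum_le; intros k Hk.
    specialize (A3 m k Hm Hk). set (I := RInt _ 0 V) in *.
    eapply Rle_trans; [apply Rle_abs|]. rewrite Rabs_mult.
    apply Rle_trans with ((w m * w m + w k * w k) / 2 * (Q * D m k)).
    - apply Rmult_le_compat; try apply Rabs_pos; [|lra].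
      apply Rabs_le. split.
      + pose proof (Rle_0_sqr (w m + w k)) as S. unfold Rsqr in S. nra.
      + pose proof (Rle_0_sqr (w m - w k)) as S. unfold Rsqr in S. nra.
    - apply Req_le. field. }
  assert (A5 : rsum (fun m => rsum (fun k => Q / 2 * (w m * w m * D m k + w k * w k * D m k)) M) M <=
     Q * 8 * rsum (fun m => w m * w m) M).
  { assert (S1 : rsum (fun m => rsum (fun k => w m * w m * D m k) M) M <= 8 * rsum (fun m => w m * w m) M).
    { rewrite <- rsum_scal. apply rsum_le; intros m Hm. rewrite rsum_scal.
      pose proof (rsum_inv_dist_sq (INR m) M). fold (D m) in H.
      assert (0 <= w m * w m) by apply Rle_0_sqr.
      rewrite Rmult_comm. apply Rmult_le_compat_r; auto. }
    assert (S2 : rsum (fun m => rsum (fun k => w k * w k * D m k) M) M =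
      rsum (fun m => rsum (fun k => w m * w m * D m k) M) M).
    { rewrite rsum_swap. apply rsum_ext; intros; apply rsum_ext; intros.
      unfold D. rewrite (Rabs_minus_sym (INR i)). reflexivity. }
    rewrite (rsum_ext _ (fun m => Q / 2 * (rsum (fun k => w m * w m * D m k) M + rsum (fun k => w k * w k * D m k) M))).
    - rewrite rsum_scal, rsum_plus, S2. assert (0 < Q) by (unfold Q; lra). nra.
    - intros m _. rewrite rsum_scal, rsum_plus. reflexivity. }
  assert (EQ : 2 * (Q * 8) = 64 * (T + INR M * INR M / T)).
  { unfold Q, V. field. lra. }
  rewrite <- EQ. lra.
Qed.

(** The squares of the coefficients sum to a difference of harmonic numbers: of size [log M] for
    [N = 0], but bounded if [N] is a fixed proportion of [M]. *)
Lemma dpoly_mean_square (a T : R) (N M : nat) : 1 <= a -> 0 < T -> (1 <= M)%nat -> (N <= M)%nat ->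
  RInt (fun t => Cmod (dpoly M (a * t) - dpoly N (a * t)) ^ 2) 0 T <=
  64 * (T + INR M * INR M / T) * (harmonic M - harmonic N).
Proof.
  intros Ha HT HM HN.
  set (w := fun m => if Nat.leb m N then 0 else / sqrt (INR m)).
  assert (E : harmonic M - harmonic N = rsum (fun m => w m * w m) M).
  { assert (F : forall n, (N <= n)%nat -> rsum (fun m => w m * w m) n = harmonic n - harmonic N).
    { induction 1 as [|n Hn IH].
      - rewrite Rminus_diag. replace 0 with (rsum (fun _ => 0) N) by (rewrite rsum_const; ring).
        apply rsum_ext; intros. unfold w. case Nat.leb_spec; intros; [eqR; ring|lia].
      - unfold harmonic in *. rewrite !rsum_S, IH. unfold w at 1 2. case Nat.leb_spec; intros; [lia|].
        rewrite <- Rinv_mult, sqrt_sqrt by apply pos_INR. ring. }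
    symmetry. apply F. auto. }
  rewrite E. eapply Rle_trans; [|apply (mean_square w a T M); auto].
  apply Req_le, RInt_ext. intros t _. do 2 f_equal.
  assert (F : forall n, (N <= n)%nat -> (dpoly n (a * t) - dpoly N (a * t))%C =
     csum (fun m => RtoC (w m) * cis (- (a * t * ln (INR m))))%C n).
  { induction 1 as [|n Hn IH].
    - replace (dpoly N (a * t) - dpoly N (a * t))%C with (RtoC 0) by ring.
      rewrite <- (csum_zero N). apply csum_ext; intros. unfold w. case Nat.leb_spec; intros; [ring|lia].
    - rewrite csum_S, <- IH. unfold dpoly. rewrite csum_S. unfold w at 1. case Nat.leb_spec; intros; [lia|]. ring. }
  apply F; auto.
Qed.

(** * Smoothing the ends of an integral by iterated averaging *)

(** A discrete average stays within finite sums, and its effect on [cis (u t)] is an exponential sum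
    to which Kusmin-Landau applies. *)
Definition avg (h : R) (Q : nat) (f : R -> C) (t : R) : C :=
  (RtoC (/ INR Q) * csum (fun q => f (t + INR q * h)%R) Q)%C.

Fixpoint avgn (h : R) (Q r : nat) (f : R -> C) : R -> C :=
  match r with O => f | S p => avg h Q (avgn h Q p f) end.

Lemma avg_bound h Q f g (t : R) B : (1 <= Q)%nat ->
  (forall q, (1 <= q <= Q)%nat -> Cmod (f (t + INR q * h)%R - g q) <= B) ->
  Cmod (avg h Q f t - RtoC (/ INR Q) * csum g Q) <= B.
Proof.
  intros HQ H. unfold avg. pose proof (lt_0_INR Q HQ) as P.
  replace (RtoC (/ INR Q) * csum (fun q => f (t + INR q * h)%R) Q - RtoC (/ INR Q) * csum g Q)%C
    with (RtoC (/ INR Q) * csum (fun q => f (t + INR q * h)%R - g q)%C Q)%C by (rewrite csum_minus; ring).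
  rewrite Cmod_RtoC_mult by (apply Rlt_le, Rinv_0_lt_compat; auto).
  apply (Rmult_le_reg_l (INR Q)); auto. rewrite <- Rmult_assoc, Rinv_r, Rmult_1_l by lra.
  rewrite <- rsum_const. apply Cmod_csum_le; auto.
Qed.

Lemma avg_const Q c : (1 <= Q)%nat -> (RtoC (/ INR Q) * csum (fun _ => c) Q)%C = c.
Proof.
  intros HQ. pose proof (lt_0_INR Q HQ) as P.
  replace (csum (fun _ => c) Q) with (RtoC (INR Q) * c)%C.
  - rewrite Cmult_assoc, <- RtoC_mult, Rinv_l by lra. ring.
  - clear. induction Q as [|Q IH]; [simpl; ring|].
    rewrite csum_S, <- IH, S_INR, RtoC_plus. ring.
Qed.

Lemma avgn_close h Q r f (t0 t1 B : R) : (1 <= Q)%nat -> 0 <= h -> 0 <= B ->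
  (forall x y, t0 <= x -> x <= y -> y <= t1 -> Cmod (f y - f x) <= B * (y - x)) ->
  forall t, t0 <= t -> t + INR r * (INR Q * h) <= t1 ->
  Cmod (avgn h Q r f t - f t) <= INR r * (INR Q * h) * B.
Proof.
  intros HQ Hh HB HL. pose proof (lt_0_INR Q HQ) as PQ.
  induction r as [|r IH]; intros t Ht0 Ht1.
  - simpl. replace (f t - f t)%C with (RtoC 0) by ring. rewrite Cmod_0. lra.
  - rewrite S_INR in *. simpl avgn. rewrite <- (avg_const Q (f t) HQ).
    assert (Hr : 0 <= INR r) by apply pos_INR.
    assert (Hr2 : 0 <= INR r * (INR Q * h)) by (apply Rmult_le_pos; [auto|nra]).
    apply avg_bound; auto. intros q Hq.
    assert (q0 : 0 <= INR q) by apply pos_INR.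
    assert (Hq2 : INR q <= INR Q) by (apply le_INR; lia).
    assert (Hqh : INR q * h <= INR Q * h) by (apply Rmult_le_compat_r; auto).
    assert (Hqh0 : 0 <= INR q * h) by (apply Rmult_le_pos; auto).
    replace (avgn h Q r f (t + INR q * h)%R - f t)%C with
      ((avgn h Q r f (t + INR q * h)%R - f (t + INR q * h)%R) + (f (t + INR q * h)%R - f t))%C by ring.
    eapply Rle_trans; [apply Cmod_triangle|].
    assert (A1 := IH (t + INR q * h) ltac:(lra) ltac:(lra)).
    assert (A2 := HL t (t + INR q * h) ltac:(lra) ltac:(lra) ltac:(lra)).
    assert (B * (t + INR q * h - t) <= B * (INR Q * h)) by (apply Rmult_le_compat_l; lra). lra.
Qed.

Lemma avgn_diff_bound h Q r f (t t' B : R) : (1 <= Q)%nat ->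
  (forall s, Cmod (f (t + s)%R - f (t' + s)%R) <= B) ->
  forall s, Cmod (avgn h Q r f (t + s)%R - avgn h Q r f (t' + s)%R) <= B.
Proof.
  intros HQ H. induction r as [|r IH]; intros s; [apply H|].
  simpl avgn. unfold avg at 2. apply avg_bound; auto. intros q Hq.
  rewrite !Rplus_assoc. apply IH.
Qed.

Lemma avgn_ext h Q r f g : (forall t, f t = g t) -> forall t, avgn h Q r f t = avgn h Q r g t.
Proof.
  intros H. induction r as [|r IH]; intros t; [apply H|].
  simpl. unfold avg. f_equal. apply csum_ext; intros. apply IH.
Qed.

Lemma avgn_csum h Q r (f : nat -> R -> C) n t :
  avgn h Q r (fun t => csum (fun i => f i t) n) t = csum (fun i => avgn h Q r (f i) t) n.
Proof.
  revert t. induction r as [|r IH]; intros t; [reflexivity|].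
  simpl. unfold avg. rewrite (csum_scal (RtoC (/ INR Q)) (fun i => csum (fun q => avgn h Q r (f i) (t + INR q * h)%R) Q)).
  f_equal. rewrite csum_swap. apply csum_ext; intros. apply IH.
Qed.

Lemma avgn_scal h Q r c f t : avgn h Q r (fun t => c * f t)%C t = (c * avgn h Q r f t)%C.
Proof.
  revert t. induction r as [|r IH]; intros t; [reflexivity|].
  simpl. unfold avg. rewrite (csum_ext _ (fun q => c * avgn h Q r f (t + INR q * h)%R)%C) by (intros; apply IH).
  rewrite csum_scal. ring.
Qed.

(** The eigenvalue of [avg] on [cis (u t)]; [r] averages multiply by its [r]-th power. *)
Definition avg_factor (h : R) (Q : nat) (u : R) : C :=
  (RtoC (/ INR Q) * csum (fun q => cis (u * (INR q * h))) Q)%C.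

Lemma avgn_cis h Q r u c d t : (1 <= Q)%nat ->
  avgn h Q r (fun t => c * cis (u * t) + d)%C t =
  (c * Cpow (avg_factor h Q u) r * cis (u * t) + d)%C.
Proof.
  intros HQ. revert t. induction r as [|r IH]; intros t; [simpl; ring|].
  simpl. unfold avg.
  rewrite (csum_ext _ (fun q => c * Cpow (avg_factor h Q u) r * cis (u * t) * cis (u * (INR q * h)) + d)%C).
  - rewrite csum_plus, csum_scal. rewrite Cmult_plus_distr_l, avg_const by auto.
    unfold avg_factor at 2. ring.
  - intros q Hq. rewrite IH, Rmult_plus_distr_l, cis_plus. ring.
Qed.

(** The phases form an arithmetic progression with step at most 1. The gain is [|u|] times the
    length [Q h] of the average. *)
Lemma avg_factor_bound h Q u : (1 <= Q)%nat -> 0 < h -> u <> 0 -> Rabs u * h <= 1 ->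
  Cmod (avg_factor h Q u) <= 7 / (INR Q * h * Rabs u).
Proof.
  intros HQ Hh Hu Huh. pose proof (lt_0_INR Q HQ) as P. pose proof (Rabs_pos_lt u Hu) as Pu.
  unfold avg_factor. rewrite Cmod_RtoC_mult by (apply Rlt_le, Rinv_0_lt_compat; auto).
  replace (7 / (INR Q * h * Rabs u)) with (/ INR Q * (7 / (Rabs u * h))) by fld.
  apply Rmult_le_compat_l; [apply Rlt_le, Rinv_0_lt_compat; auto|].
  assert (K : Cmod (csum (fun q => cis (Rabs u * (INR q * h))) Q) <= 7 / (Rabs u * h)).
  { apply (kusmin_landau (fun q => Rabs u * (INR q * h))).
    - nra.
    - intros i Hi. rewrite S_INR. nra.
    - intros i Hi. rewrite !S_INR. nra. }
  destruct (Rle_lt_dec 0 u) as [H|H].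
  - rewrite Rabs_pos_eq in * by lra. exact K.
  - rewrite <- csum_cis_neg. rewrite Rabs_left in * by lra.
    rewrite (csum_ext _ (fun q => cis (- u * (INR q * h)))); auto. intros; f_equal; ring.
Qed.

Definition cis_int (u t : R) : C := CInt (fun t => cis (u * t)) 0 t.

Lemma cis_int_diff u t t' : (cis_int u t - cis_int u t')%C = CInt (fun t => cis (u * t)) t' t.
Proof.
  unfold cis_int. rewrite <- (CInt_Chasles (fun t => cis (u * t)) 0 t' t) by apply ccont_cis_lin. ring.
Qed.

(** For frequencies near 0 averaging gains nothing, but it also loses nothing: both bounds for the
    plain integral are invariant under translation. *)
Lemma avgn_cis_int_near h Q r u t t' : (1 <= Q)%nat -> t' <= t ->
  Cmod (avgn h Q r (cis_int u) t - avgn h Q r (cis_int u) t') <= t - t' /\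
  (u <> 0 -> Cmod (avgn h Q r (cis_int u) t - avgn h Q r (cis_int u) t') <= 2 / Rabs u).
Proof.
  intros HQ Ht.
  rewrite <- (Rplus_0_r t) at 1 3. rewrite <- (Rplus_0_r t') at 1 3.
  split; [|intros Hu]; apply avgn_diff_bound; auto; intros s; rewrite cis_int_diff.
  - eapply Rle_trans; [apply Cmod_CInt_cis_T; lra|]. lra.
  - apply Cmod_CInt_cis_u; auto.
Qed.

(** The antiderivative is a multiple of [cis (u t)] plus a constant; averages preserve the constant,
    which cancels in the difference. *)
Lemma avgn_cis_int_far h Q r u t t' : (1 <= Q)%nat -> u <> 0 ->
  Cmod (avgn h Q r (cis_int u) t - avgn h Q r (cis_int u) t') <=
    2 / Rabs u * Cmod (avg_factor h Q u) ^ r.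
Proof.
  intros HQ Hu. pose proof (Rabs_pos_lt u Hu) as Pu.
  assert (Hn : (Ci * RtoC u)%C <> 0%C).
  { intros E. apply (f_equal Cmod) in E. rewrite Cmod_Ci_R, Cmod_0 in E. lra. }
  assert (E : forall s, avgn h Q r (cis_int u) s =
    (/ (Ci * RtoC u) * Cpow (avg_factor h Q u) r * cis (u * s) + (- / (Ci * RtoC u)))%C).
  { intros s. rewrite <- avgn_cis by auto. apply avgn_ext. intros y. unfold cis_int.
    rewrite CInt_cis by auto. rewrite Rmult_0_r, cis_0. unfold Cdiv. ring. }
  rewrite !E.
  replace (/ (Ci * RtoC u) * Cpow (avg_factor h Q u) r * cis (u * t) + - / (Ci * RtoC u) -
    (/ (Ci * RtoC u) * Cpow (avg_factor h Q u) r * cis (u * t') + - / (Ci * RtoC u)))%C with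
    (/ (Ci * RtoC u) * Cpow (avg_factor h Q u) r * (cis (u * t) - cis (u * t')))%C by ring.
  rewrite !Cmod_mult, Cmod_inv, Cmod_Ci_R, Cmod_pow by auto.
  assert (A : Cmod (cis (u * t) - cis (u * t')) <= 2).
  { eapply Rle_trans; [apply Cmod_minus_le|]. rewrite !Cmod_cis. lra. }
  replace (2 / Rabs u * Cmod (avg_factor h Q u) ^ r) with (/ Rabs u * Cmod (avg_factor h Q u) ^ r * 2)
    by (unfold Rdiv; ring).
  apply Rmult_le_compat_l; auto. apply Rmult_le_pos; [apply Rlt_le, Rinv_0_lt_compat; auto|].
  apply pow_le, Cmod_ge_0.
Qed.

Definition trisum (W u : nat -> nat -> nat -> R) (M : nat) (t : R) : C :=
  csum (fun n => csum (fun k => csum (fun m => RtoC (W n k m) * cis (u n k m * t))%C M) M) M.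

Definition rtrisum (f : nat -> nat -> nat -> R) (M : nat) : R :=
  rsum (fun n => rsum (fun k => rsum (fun m => f n k m) M) M) M.

Lemma ccont_trisum W u M : ccont (trisum W u M).
Proof.
  apply ccont_csum; intros n. apply ccont_csum; intros k. apply ccont_csum; intros m.
  apply ccont_mult; [apply ccont_const|apply ccont_cis_lin].
Qed.

Lemma CInt_trisum W u M t : CInt (trisum W u M) 0 t =
  csum (fun n => csum (fun k => csum (fun m => RtoC (W n k m) * cis_int (u n k m) t)%C M) M) M.
Proof.
  unfold trisum.
  assert (C3 : forall n k m, ccont (fun t => RtoC (W n k m) * cis (u n k m * t))%C).
  { intros; apply ccont_mult; [apply ccont_const|apply ccont_cis_lin]. }
  rewrite CInt_csum by (intros; apply ccont_csum; intros; apply ccont_csum; intros; auto).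
  apply csum_ext; intros n _. rewrite CInt_csum by (intros; apply ccont_csum; intros; auto).
  apply csum_ext; intros k _. rewrite CInt_csum by auto.
  apply csum_ext; intros m _. apply CInt_scal, ccont_cis_lin.
Qed.

(* Replacing the sharp cutoff by an r-fold average costs only the size of the integrand near the ends. *)
Lemma trisum_smoothing W u M h Q r (T0 T B : R) (tau : nat -> nat -> nat -> R) :
  (1 <= Q)%nat -> 0 <= h -> T0 <= T -> 0 <= B ->
  (forall t, T0 <= t <= T0 + INR r * (INR Q * h) -> Cmod (trisum W u M t) <= B) ->
  (forall t, T <= t <= T + INR r * (INR Q * h) -> Cmod (trisum W u M t) <= B) ->
  (forall n k m, (1 <= n <= M)%nat -> (1 <= k <= M)%nat -> (1 <= m <= M)%nat ->
    Rabs (W n k m) * Cmod (avgn h Q r (cis_int (u n k m)) T - avgn h Q r (cis_int (u n k m)) T0) <= tau n k m) ->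
  Cmod (CInt (trisum W u M) T0 T) <= 2 * (INR r * (INR Q * h) * B) + rtrisum tau M.
Proof.
  intros HQ Hh HT HB HB0 HB1 Htau.
  set (F := fun t => CInt (trisum W u M) 0 t).
  assert (CT := ccont_trisum W u M).
  assert (FL : forall t0, (forall t, t0 <= t <= t0 + INR r * (INR Q * h) -> Cmod (trisum W u M t) <= B) ->
    Cmod (avgn h Q r F t0 - F t0) <= INR r * (INR Q * h) * B).
  { intros t0 H. apply (avgn_close h Q r F t0 (t0 + INR r * (INR Q * h))); auto; try lra.
    intros x y Hx Hxy Hy. unfold F.
    rewrite <- (CInt_Chasles _ 0 x y) by auto.
    replace (CInt (trisum W u M) 0 x + CInt (trisum W u M) x y - CInt (trisum W u M) 0 x)%C
      with (CInt (trisum W u M) x y) by ring.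
    apply Cmod_CInt_const; auto. intros; apply H; lra. }
  assert (A0 := FL T0 HB0). assert (A1 := FL T HB1).
  replace (CInt (trisum W u M) T0 T) with
    ((F T - avgn h Q r F T) - (F T0 - avgn h Q r F T0) + (avgn h Q r F T - avgn h Q r F T0))%C.
  2: { unfold F at 1 3. rewrite <- (CInt_Chasles _ 0 T0 T) by auto. ring. }
  eapply Rle_trans; [apply Cmod_triangle|]. apply Rplus_le_compat.
  { eapply Rle_trans; [apply Cmod_minus_le|]. rewrite Cmod_minus_sym, (Cmod_minus_sym (F T0)). lra. }
  assert (E : forall t, avgn h Q r F t =
    csum (fun n => csum (fun k => csum (fun m => RtoC (W n k m) * avgn h Q r (cis_int (u n k m)) t)%C M) M) M).
  { intros t. unfold F. rewrite (avgn_ext _ _ _ _ _ (CInt_trisum W u M)), avgn_csum.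
    apply csum_ext; intros n _. rewrite avgn_csum. apply csum_ext; intros k _. rewrite avgn_csum.
    apply csum_ext; intros m _. apply avgn_scal. }
  rewrite !E, <- csum_minus. apply Cmod_csum_le; intros n Hn.
  rewrite <- csum_minus. apply Cmod_csum_le; intros k Hk.
  rewrite <- csum_minus. apply Cmod_csum_le; intros m Hm.
  eapply Rle_trans; [|apply Htau; auto]. apply Req_le.
  rewrite <- Cmod_R, <- Cmod_mult. f_equal. ring.
Qed.

(** * The frequencies n^(b/a) with n large *)

(** [y] stands for [k n^(b/a)] and [D] for an integral bounded by [T] and by 2 over the frequency.
    At distance [d < 1] the bound [T] is used, with [(1 + d)^2 < 4]; otherwise the frequency is at
    least [d / (2 y)]. Both majorants can be summed over [m] uniformly in [y]. *)
Lemma near_term (y m D T : R) : 0 < y -> 0 < m -> 0 <= T -> Rabs (ln y - ln m) <= 1 / 2 ->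
  D <= T -> (ln y <> ln m -> D <= 2 / Rabs (ln y - ln m)) ->
  y <= 2 * m /\ / sqrt m <= 2 / sqrt y /\
  D <= 4 * T * / ((1 + Rabs (m - y)) * (1 + Rabs (m - y))) + 8 * y * / (1 + Rabs (m - y)).
Proof.
  (* As [ln 2 > 1/2], the hypothesis on the logarithms puts [y] and [m] within a factor 2 of each
     other. *)
  intros Hy Hm HT Hl HD HD2. pose proof ln_lt_2 as L2.
  apply Rabs_le_between in Hl.
  assert (Y1 : y <= 2 * m).
  { apply Rnot_lt_le; intros C. assert (ln (2 * m) < ln y) by (apply ln_increasing; lra).
    rewrite ln_mult in H by lra. lra. }
  assert (Y2 : m <= 2 * y).
  { apply Rnot_lt_le; intros C. assert (ln (2 * y) < ln m) by (apply ln_increasing; lra).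
    rewrite ln_mult in H by lra. lra. }
  assert (Sy : 0 < sqrt y) by (apply sqrt_lt_R0; auto).
  assert (Sm : 0 < sqrt m) by (apply sqrt_lt_R0; auto).
  split; [auto|split].
  - replace (2 / sqrt y) with (/ (sqrt y / 2)) by fld. apply Rinv_le_contravar; [lra|].
    apply Rsqr_incr_0_var; [|lra]. unfold Rsqr.
    replace (sqrt y / 2 * (sqrt y / 2)) with (sqrt y * sqrt y / 4) by field.
    rewrite !sqrt_sqrt by lra. lra.
  - set (d := Rabs (m - y)). assert (d0 : 0 <= d) by apply Rabs_pos.
    assert (P1 : 0 < / ((1 + d) * (1 + d))) by (apply Rinv_0_lt_compat; nra).
    assert (P2 : 0 < / (1 + d)) by (apply Rinv_0_lt_compat; lra).
    destruct (Rlt_le_dec d 1) as [H|H].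
    + assert (/ 4 <= / ((1 + d) * (1 + d))) by (apply Rinv_le_contravar; nra). nra.
    + assert (Hne : ln y <> ln m).
      { intros E. apply ln_inv in E; auto. unfold d in H. rewrite E, Rminus_diag, Rabs_R0 in H. lra. }
      specialize (HD2 Hne).
      pose proof (ln_sub_ge m y Hm Hy) as G. fold d in G. rewrite (Rabs_minus_sym (ln m)) in G.
      assert (Mx : Rmax m y <= 2 * y) by (apply Rmax_lub; lra).
      assert (Mx0 : 0 < Rmax m y) by (eapply Rlt_le_trans; [exact Hm|apply Rmax_l]).
      assert (G2 : d / (2 * y) <= Rabs (ln y - ln m)).
      { eapply Rle_trans; [|exact G]. apply Rmult_le_compat_l; auto. apply Rinv_le_contravar; auto. }
      assert (Pd : 0 < d / (2 * y)) by (apply Rdiv_lt_0_compat; lra).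
      assert (D <= 8 * y * / (1 + d)).
      { eapply Rle_trans; [exact HD2|]. apply Rle_trans with (2 / (d / (2 * y))).
        - apply Rmult_le_compat_l; [lra|]. apply Rinv_le_contravar; auto.
        - replace (2 / (d / (2 * y))) with (8 * y * / (2 * d)) by fld.
          apply Rmult_le_compat_l; [lra|]. apply Rinv_le_contravar; lra. }
      nra.
Qed.

(** The total for one [n], with [alpha = n^(b/a)]. In the second summand the factor [sqrt alpha] is
    offset by the number of admissible [k], at most [2 M / alpha], so both parts decay like
    [1 / sqrt alpha]. *)
Lemma near_sum (alpha T : R) (M : nat) : 0 < alpha -> 0 <= T ->
  rsum (fun k => rsum (fun m =>
     8 * T * (/ INR k * / sqrt alpha) *
       / ((1 + Rabs (INR m - INR k * alpha)) * (1 + Rabs (INR m - INR k * alpha))) +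
     16 * sqrt alpha * (if Rle_dec (INR k) (2 * INR M / alpha) then 1 else 0) *
       / (1 + Rabs (INR m - INR k * alpha))) M) M
  <= / sqrt alpha * (harmonic M * (64 * T + 64 * INR M)).
Proof.
  intros Ha HT. assert (Sa : 0 < sqrt alpha) by (apply sqrt_lt_R0; auto).
  assert (Sa' : 0 < / sqrt alpha) by (apply Rinv_0_lt_compat; auto).
  pose proof (harmonic_ge0 M) as H0. pose proof (pos_INR M) as M0.
  apply Rle_trans with (rsum (fun k => 64 * T * / sqrt alpha * / INR k +
     32 * sqrt alpha * harmonic M * (if Rle_dec (INR k) (2 * INR M / alpha) then 1 else 0)) M).
  - apply rsum_le; intros k Hk. rewrite rsum_plus, !rsum_scal.
    pose proof (Rinv_0_lt_compat _ (lt_0_INR k ltac:(lia))) as Pk.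
    pose proof (rsum_inv_dist_sq (INR k * alpha) M) as S2.
    pose proof (rsum_inv_dist (INR k * alpha) M) as S1.
    apply Rplus_le_compat.
    + replace (64 * T * / sqrt alpha * / INR k) with (8 * T * (/ INR k * / sqrt alpha) * 8) by ring.
      apply Rmult_le_compat_l; auto. apply Rmult_le_pos; [lra|]. apply Rmult_le_pos; lra.
    + set (i := if Rle_dec (INR k) (2 * INR M / alpha) then 1 else 0).
      assert (0 <= i) by (unfold i; destruct Rle_dec; lra).
      replace (32 * sqrt alpha * harmonic M * i) with (16 * sqrt alpha * i * (2 * harmonic M)) by ring.
      apply Rmult_le_compat_l; auto. apply Rmult_le_pos; lra.
  - rewrite rsum_plus, !rsum_scal. fold (harmonic M).
    assert (X0 : 0 <= 2 * INR M / alpha) by (apply Rmult_le_pos; [lra|apply Rlt_le, Rinv_0_lt_compat; auto]).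
    pose proof (rsum_indicator (2 * INR M / alpha) M X0) as I.
    apply Rle_trans with (64 * T * / sqrt alpha * harmonic M + 32 * sqrt alpha * harmonic M * (2 * INR M / alpha)).
    + apply Rplus_le_compat_l, Rmult_le_compat_l; auto.
      apply Rmult_le_pos; [lra|auto].
    + apply Req_le.
      replace (2 * INR M / alpha) with (2 * INR M / (sqrt alpha * sqrt alpha)) by (rewrite sqrt_sqrt by lra; reflexivity).
      fld.
Qed.

Definition tail_weight (n0 n : nat) : R := if Nat.leb n n0 then 0 else / sqrt (INR n).

Lemma tail_weight_bound n0 n : (1 <= n)%nat -> 0 <= tail_weight n0 n <= 1.
Proof.
  intros Hn. unfold tail_weight. case Nat.leb_spec; intros; [lra|].
  assert (1 <= sqrt (INR n)).
  { rewrite <- sqrt_1. apply sqrt_le_1; try lra; [apply pos_INR|apply INR_ge1; auto]. }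
  split; [apply Rlt_le, Rinv_0_lt_compat; lra|]. rewrite <- Rinv_1. apply Rinv_le_contravar; lra.
Qed.

(** Here [b > a] enters: with [b/a = 1 + 2 g] the terms are [n^(-1-g)], and their tail beyond [n0]
    is small. *)
Lemma tail_weight_sum (g : R) n0 M : 0 < g -> (1 <= n0)%nat ->
  rsum (fun n => tail_weight n0 n * / sqrt (Rpower (INR n) (1 + 2 * g))) M <= / g * Rpower (INR n0) (- g).
Proof.
  intros Hg Hn0.
  assert (Z : forall n, (n <= n0)%nat ->
    rsum (fun n => tail_weight n0 n * / sqrt (Rpower (INR n) (1 + 2 * g))) n = 0).
  { intros n Hn. rewrite (rsum_ext _ (fun _ => 0)), rsum_const; [ring|].
    intros i Hi. unfold tail_weight. case Nat.leb_spec; intros; [ring|lia]. }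
  assert (P : 0 < / g * Rpower (INR n0) (- g)) by (apply Rmult_lt_0_compat; [apply Rinv_0_lt_compat; auto|apply Rpower_gt0]).
  destruct (Nat.le_gt_cases M n0) as [H|H]; [rewrite Z by auto; lra|].
  replace M with (n0 + (M - n0))%nat by lia. rewrite rsum_add, Z, Rplus_0_l by lia.
  eapply Rle_trans; [|apply (rsum_Rpower_tail g n0 (M - n0)); auto].
  apply rsum_le; intros i Hi. apply Req_le.
  unfold tail_weight. case Nat.leb_spec; intros; [lia|].
  pose proof (lt_0_INR (n0 + i) ltac:(lia)) as Pi. set (x := INR (n0 + i)) in *.
  rewrite <- (Rpower_sqrt x), <- (Rpower_sqrt (Rpower x _)) by (auto; apply Rpower_gt0).
  rewrite Rpower_mult, <- !Rpower_Ropp, <- Rpower_plus. f_equal. field.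
Qed.

Definition tri_weight (n0 n k m : nat) : R := tail_weight n0 n * (/ sqrt (INR k) * / sqrt (INR m)).
Definition tri_freq (A B : R) (n k m : nat) : R := A * ln (INR k) + B * ln (INR n) - A * ln (INR m).

Lemma dpoly_tail_weight n0 M s : (n0 <= M)%nat ->
  (dpoly M s - dpoly n0 s)%C = csum (fun n => RtoC (tail_weight n0 n) * cis (- (s * ln (INR n))))%C M.
Proof.
  induction 1 as [|n Hn IH].
  - replace (dpoly n0 s - dpoly n0 s)%C with (RtoC 0) by ring.
    rewrite <- (csum_zero n0). apply csum_ext; intros. unfold tail_weight.
    case Nat.leb_spec; intros; [ring|lia].
  - rewrite csum_S, <- IH. unfold dpoly. rewrite csum_S. unfold tail_weight at 1.
    case Nat.leb_spec; intros; [lia|]. ring.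
Qed.

Lemma trisum_product A B n0 M t : (n0 <= M)%nat ->
  trisum (tri_weight n0) (tri_freq A B) M t =
  (dpoly M (A * t) * dpoly M (- (A * t)) * (dpoly M (- (B * t)) - dpoly n0 (- (B * t))))%C.
Proof.
  intros H. rewrite dpoly_tail_weight by auto.
  set (cn := fun n => (RtoC (tail_weight n0 n) * cis (- (- (B * t) * ln (INR n))))%C).
  set (ck := fun k => (RtoC (/ sqrt (INR k)) * cis (- (- (A * t) * ln (INR k))))%C).
  change (dpoly M (- (A * t))) with (csum ck M).
  unfold trisum.
  transitivity (csum (fun n => cn n * (csum ck M * dpoly M (A * t)))%C M).
  2: { rewrite csum_scal_r. ring. }
  apply csum_ext; intros n _.
  transitivity (csum (fun k => cn n * (ck k * dpoly M (A * t)))%C M).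
  2: { rewrite csum_scal, csum_scal_r. reflexivity. }
  apply csum_ext; intros k _.
  unfold dpoly. rewrite <- !csum_scal. apply csum_ext; intros m _.
  unfold tri_weight, tri_freq, cn, ck. rewrite !RtoC_mult.
  replace ((A * ln (INR k) + B * ln (INR n) - A * ln (INR m)) * t) with
    (- (- (B * t) * ln (INR n)) + (- (- (A * t) * ln (INR k)) + - (A * t * ln (INR m)))) by ring.
  rewrite !cis_plus. ring.
Qed.

(** The pointwise bound for all arguments met while averaging: 61 averages of length at most [2 v^2]
    reach [v^40 + 122 v^2], at most [123 v^40]. For [s >= v^24] the term [sqrt M / s] is bounded. *)
Lemma dpoly_range_bound (B : R) : 1 <= B -> exists C, 0 < C /\ forall (v s : R) (M : nat),
  1 <= v -> v ^ 24 <= s <= 123 * B * v ^ 40 -> INR M <= 2 * B * v ^ 40 ->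
  Cmod (dpoly M s) <= C * v ^ 12.
Proof.
  intros HB. destruct dpoly_bound as [C [HC H]].
  set (K := 123 * B). assert (HK : 1 <= K) by (unfold K; lra).
  assert (PK : 1 <= K ^ 12) by (apply pow_R1_Rle; auto).
  exists (C * (K ^ 12 + 2 * B)). split; [apply Rmult_lt_0_compat; lra|].
  intros v s M Hv Hs HM.
  assert (P : forall n, 1 <= v ^ n) by (intros; apply pow_R1_Rle; auto).
  pose proof (P 24%nat) as P24. pose proof (P 40%nat) as P40.
  set (v' := Rpower s (/ 40)).
  assert (E : v' ^ 40 = s).
  { unfold v'. rewrite <- Rpower_pow by apply Rpower_gt0. rewrite Rpower_mult.
    replace (/ 40 * INR 40) with 1 by (simpl; field). apply Rpower_1; lra. }
  assert (Hv' : 1 <= v').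
  { unfold v'. rewrite <- (Rpower_O s) by lra. apply Rle_Rpower; lra. }
  assert (Hle : v' <= K * v).
  { replace (K * v) with (Rpower ((K * v) ^ 40) (/ 40)).
    - apply Rle_Rpower_l; [lra|]. split; [lra|].
      apply Rle_trans with (K * v ^ 40); [lra|].
      rewrite Rpow_mult_distr. apply Rmult_le_compat_r; [lra|].
      rewrite <- (pow_1 K) at 1. apply Rle_pow; auto. lia.
    - rewrite <- Rpower_pow, Rpower_mult by nra.
      replace (INR 40 * / 40) with 1 by (simpl; field). apply Rpower_1; nra. }
  specialize (H v' M Hv'). rewrite E in H.
  eapply Rle_trans; [exact H|]. rewrite Rmult_assoc. apply Rmult_le_compat_l; [lra|].
  rewrite Rmult_plus_distr_r. apply Rplus_le_compat.
  - rewrite <- Rpow_mult_distr. apply pow_incr. lra.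
  - assert (S1 : sqrt (INR M) <= 2 * B * v ^ 20).
    { apply Rsqr_incr_0_var; [|pose proof (P 20%nat); nra]. unfold Rsqr.
      rewrite sqrt_sqrt by apply pos_INR.
      replace (2 * B * v ^ 20 * (2 * B * v ^ 20)) with (2 * B * v ^ 40 * (2 * B)) by (simpl; ring).
      nra. }
    apply Rle_trans with (2 * B * v ^ 20 / v ^ 24).
    + unfold Rdiv. apply Rmult_le_compat; auto; [apply sqrt_pos|apply Rlt_le, Rinv_0_lt_compat; lra|].
      apply Rinv_le_contravar; lra.
    + apply (Rmult_le_reg_r (v ^ 24)); [lra|].
      replace (2 * B * v ^ 20 / v ^ 24 * v ^ 24) with (2 * B * v ^ 20) by (field; lra).
      replace (2 * B * v ^ 12 * v ^ 24) with (2 * B * v ^ 20 * v ^ 16) by (simpl; ring).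
      rewrite <- (Rmult_1_r (2 * B * v ^ 20)) at 1. pose proof (P 20%nat).
      apply Rmult_le_compat_l; [nra|apply P].
Qed.

Definition near_majorant (alpha : nat -> R) (w : nat -> R) (T : R) (M n k m : nat) : R :=
  w n * (8 * T * (/ INR k * / sqrt (alpha n)) *
       / ((1 + Rabs (INR m - INR k * alpha n)) * (1 + Rabs (INR m - INR k * alpha n))) +
     16 * sqrt (alpha n) * (if Rle_dec (INR k) (2 * INR M / alpha n) then 1 else 0) *
       / (1 + Rabs (INR m - INR k * alpha n))).

Lemma near_majorant_ge0 alpha w T M n k m : (1 <= k)%nat -> 0 < alpha n -> 0 <= w n -> 0 <= T ->
  0 <= near_majorant alpha w T M n k m.
Proof.
  intros Hk Ha Hw HT. unfold near_majorant.
  pose proof (Rinv_0_lt_compat _ (lt_0_INR k Hk)). assert (Sa : 0 < sqrt (alpha n)) by (apply sqrt_lt_R0; auto).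
  pose proof (Rinv_0_lt_compat _ Sa). pose proof (Rabs_pos (INR m - INR k * alpha n)) as D.
  set (d := Rabs _) in *.
  assert (0 < / (1 + d)) by (apply Rinv_0_lt_compat; lra).
  assert (0 < / ((1 + d) * (1 + d))) by (apply Rinv_0_lt_compat; nra).
  apply Rmult_le_pos; auto. apply Rplus_le_le_0_compat.
  - apply Rmult_le_pos; [|lra]. apply Rmult_le_pos; [lra|]. apply Rmult_le_pos; lra.
  - apply Rmult_le_pos; [|lra]. apply Rmult_le_pos; [lra|]. destruct Rle_dec; lra.
Qed.

(** Since [m] is comparable to [k alpha], its coefficient is replaced by [2 / sqrt (k alpha)]; [m]
    then enters only through its distance from [k alpha]. *)
Lemma tri_term_near (A B T : R) (n0 M n k m : nat) (D : R) : 1 <= A -> 0 <= T ->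
  (1 <= n)%nat -> (1 <= k)%nat -> (1 <= m <= M)%nat ->
  Rabs (tri_freq A B n k m) <= 1 / 2 -> 0 <= D -> D <= T ->
  (tri_freq A B n k m <> 0 -> D <= 2 / Rabs (tri_freq A B n k m)) ->
  tri_weight n0 n k m * D <= near_majorant (fun n => Rpower (INR n) (B / A)) (tail_weight n0) T M n k m.
Proof.
  intros HA HT Hn Hk Hm Hu HD0 HD HD2.
  pose proof (lt_0_INR n Hn) as Pn. pose proof (lt_0_INR k Hk) as Pk. pose proof (lt_0_INR m ltac:(lia)) as Pm.
  set (al := Rpower (INR n) (B / A)). assert (Pa : 0 < al) by apply Rpower_gt0.
  set (y := INR k * al). assert (Py : 0 < y) by (apply Rmult_lt_0_compat; auto).
  assert (Eu : tri_freq A B n k m = A * (ln y - ln (INR m))).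
  { unfold tri_freq, y. rewrite ln_mult by auto. unfold al. rewrite ln_Rpower. field. lra. }
  rewrite Eu in *. rewrite Rabs_mult, (Rabs_pos_eq A) in * by lra.
  set (l := ln y - ln (INR m)) in *. pose proof (Rabs_pos l) as L0.
  destruct (near_term y (INR m) D T) as [N1 [N2 N3]]; auto.
  { fold l. nra. }
  { intros Hne. fold l. assert (Hl : l <> 0) by (unfold l; lra).
    pose proof (Rabs_pos_lt l Hl) as L1.
    eapply Rle_trans; [apply HD2; nra|]. apply Rmult_le_compat_l; [lra|]. apply Rinv_le_contravar; nra. }
  unfold tri_weight, near_majorant. fold al. fold y.
  rewrite Rmult_assoc. apply Rmult_le_compat_l; [apply tail_weight_bound; auto|].
  destruct (Rle_dec (INR k) (2 * INR M / al)) as [Hi|Hi].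
  2: { exfalso. apply Hi. apply (Rmult_le_reg_r al); auto.
       replace (2 * INR M / al * al) with (2 * INR M) by (field; lra). fold y.
       assert (INR m <= INR M) by (apply le_INR; lia). lra. }
  assert (Sk : 0 < sqrt (INR k)) by (apply sqrt_lt_R0; auto).
  assert (Sa : 0 < sqrt al) by (apply sqrt_lt_R0; auto).
  assert (Ey : sqrt y = sqrt (INR k) * sqrt al) by (apply sqrt_mult; lra).
  set (d := Rabs (INR m - y)) in *.
  assert (d0 : 0 <= d) by apply Rabs_pos.
  apply Rle_trans with (/ sqrt (INR k) * (2 / sqrt y) *
    (4 * T * / ((1 + d) * (1 + d)) + 8 * y * / (1 + d))).
  - rewrite Rmult_assoc, Rmult_assoc. apply Rmult_le_compat_l; [apply Rlt_le, Rinv_0_lt_compat; auto|].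
    apply Rmult_le_compat; auto. apply Rlt_le, Rinv_0_lt_compat, sqrt_lt_R0; auto.
  - apply Req_le. rewrite Ey. unfold y at 1.
    replace (INR k * al) with (sqrt (INR k) * sqrt (INR k) * (sqrt al * sqrt al)) by (rewrite !sqrt_sqrt by lra; reflexivity).
    replace (/ INR k) with (/ (sqrt (INR k) * sqrt (INR k))) by (rewrite sqrt_sqrt by lra; reflexivity).
    field. repeat split; apply Rgt_not_eq; nra.
Qed.

Lemma near_majorant_sum (A B T : R) (n0 M : nat) : 1 <= A -> A < B -> 0 <= T -> (1 <= n0)%nat ->
  rtrisum (near_majorant (fun n => Rpower (INR n) (B / A)) (tail_weight n0) T M) M <=
  harmonic M * (64 * T + 64 * INR M) * (2 * A / (B - A) * Rpower (INR n0) (- ((B - A) / (2 * A)))).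
Proof.
  intros HA HAB HT Hn0. set (g := (B - A) / (2 * A)).
  assert (Hg : 0 < g) by (apply Rdiv_lt_0_compat; lra).
  assert (Eg : B / A = 1 + 2 * g) by (unfold g; field; lra).
  pose proof (harmonic_ge0 M). pose proof (pos_INR M).
  assert (HH : 0 <= harmonic M * (64 * T + 64 * INR M)) by (apply Rmult_le_pos; lra).
  apply Rle_trans with (rsum (fun n => harmonic M * (64 * T + 64 * INR M) *
    (tail_weight n0 n * / sqrt (Rpower (INR n) (1 + 2 * g)))) M).
  - apply rsum_le; intros n Hn. unfold near_majorant.
    rewrite (rsum_ext _ (fun k => tail_weight n0 n * rsum (fun m =>
     8 * T * (/ INR k * / sqrt (Rpower (INR n) (B / A))) *
       / ((1 + Rabs (INR m - INR k * Rpower (INR n) (B / A))) * (1 + Rabs (INR m - INR k * Rpower (INR n) (B / A)))) +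
     16 * sqrt (Rpower (INR n) (B / A)) * (if Rle_dec (INR k) (2 * INR M / Rpower (INR n) (B / A)) then 1 else 0) *
       / (1 + Rabs (INR m - INR k * Rpower (INR n) (B / A)))) M)).
    2: { intros k _. rewrite <- rsum_scal. reflexivity. }
    rewrite rsum_scal. pose proof (near_sum (Rpower (INR n) (B / A)) T M (Rpower_gt0 _ _) HT) as S.
    eapply Rle_trans; [apply Rmult_le_compat_l; [apply tail_weight_bound; lia|exact S]|].
    rewrite Eg. apply Req_le. ring.
  - rewrite rsum_scal. apply Rmult_le_compat_l; auto.
    replace (2 * A / (B - A)) with (/ g) by (unfold g; field; lra).
    apply tail_weight_sum; auto.
Qed.

Lemma rtrisum_plus_const f c M : rtrisum (fun n k m => f n k m + c) M = rtrisum f M + INR M ^ 3 * c.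
Proof.
  unfold rtrisum.
  rewrite (rsum_ext _ (fun n => rsum (fun k => rsum (fun m => f n k m) M) M + INR M * (INR M * c))).
  - rewrite rsum_plus, rsum_const. simpl. ring.
  - intros n _. rewrite <- rsum_const, <- rsum_plus. apply rsum_ext; intros k _.
    rewrite rsum_plus, rsum_const. reflexivity.
Qed.

Lemma tri_freq_bound A B n k m M : 1 <= A -> A < B ->
  (1 <= n <= M)%nat -> (1 <= k <= M)%nat -> (1 <= m <= M)%nat ->
  Rabs (tri_freq A B n k m) <= (2 * A + B) * ln (INR M).
Proof.
  intros HA HB Hn Hk Hm.
  assert (L : forall j, (1 <= j <= M)%nat -> 0 <= ln (INR j) <= ln (INR M)).
  { intros j Hj. split; [apply ln_nonneg, INR_ge1; lia|].
    apply ln_le; [apply lt_0_INR; lia|apply le_INR; lia]. }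
  destruct (L n Hn), (L k Hk), (L m Hm). unfold tri_freq. apply Rabs_le. split; nra.
Qed.

(** [K] is fixed before [n0], so the last term becomes small by the choice of [n0] alone. [C] may
    depend on [n0], as [v^38] is of lower order. *)
Lemma tail_bound (A B : R) : 1 <= A -> A < B -> exists K, 0 < K /\
  forall n0 : nat, (1 <= n0)%nat -> exists C v0, 0 < C /\ 1 <= v0 /\
  forall (v : R) (M : nat), v0 <= v -> B * v ^ 40 <= INR M <= B * v ^ 40 + 1 ->
  Cmod (CInt (fun t => dpoly M (A * t) * dpoly M (- (A * t)) *
                 (dpoly M (- (B * t)) - dpoly n0 (- (B * t))))%C (v ^ 24) (v ^ 40)) <=
  C * v ^ 38 + K * v ^ 40 * harmonic M * Rpower (INR n0) (- ((B - A) / (2 * A))).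
Proof.
  intros HA HB. destruct (dpoly_range_bound B ltac:(lra)) as [C1 [HC1 HD]].
  set (K := 64 * (1 + 2 * B) * (2 * A / (B - A))).
  assert (HK0 : 0 < 2 * A / (B - A)) by (apply Rdiv_lt_0_compat; lra).
  exists K. split; [unfold K; nra|]. intros n0 Hn0.
  (* [L0 v] bounds every frequency; once [v >= L0] this is at most [v^2 = 1 / h], as
     [avg_factor_bound] requires. *)
  set (L0 := (2 * A + B) * (ln (2 * B) + 40)).
  assert (HlB : 0 <= ln (2 * B)) by (apply ln_nonneg; lra).
  set (c61 := 14 ^ 61). assert (Pc : 0 < c61) by (apply pow_lt; lra).
  set (S0 := C1 * C1 * (C1 + 2 * sqrt (INR n0))).
  assert (PS0 : 0 < S0).
  { unfold S0. apply Rmult_lt_0_compat; [nra|]. pose proof (sqrt_pos (INR n0)). lra. }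
  set (B8 := (2 * B) ^ 3 * (4 * c61)).
  assert (PB8 : 0 < B8) by (apply Rmult_lt_0_compat; [apply pow_lt|]; lra).
  exists (244 * S0 + B8), (1 + L0 + INR n0).
  assert (HL0 : 0 <= L0) by (unfold L0; nra). pose proof (pos_INR n0) as Pn0.
  split; [lra|split; [lra|]].
  intros v M Hv HM.
  assert (Hv1 : 1 <= v) by lra.
  assert (P : forall n, 1 <= v ^ n) by (intros; apply pow_R1_Rle; auto).
  pose proof (P 40%nat) as P40. pose proof (P 24%nat) as P24. pose proof (P 2%nat) as P2.
  pose proof (P 12%nat) as P12. pose proof (P 36%nat) as P36. pose proof (P 38%nat) as P38.
  assert (V40 : v <= v ^ 40) by (rewrite <- (pow_1 v) at 1; apply Rle_pow; [auto|lia]).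
  assert (HM2 : INR M <= 2 * B * v ^ 40) by nra.
  assert (Hn0M : (n0 <= M)%nat) by (apply INR_le; nra).
  assert (HM1 : (1 <= M)%nat) by lia.
  assert (Hfreq : (2 * A + B) * ln (INR M) <= v ^ 2).
  { assert (E : ln (INR M) <= ln (2 * B) + 40 * v).
    { apply Rle_trans with (ln (2 * B * v ^ 40)).
      - apply ln_le; [apply lt_0_INR; auto|auto].
      - rewrite ln_mult by lra. pose proof (ln_pow40 v Hv1). lra. }
    apply Rle_trans with (L0 * v).
    - unfold L0. rewrite Rmult_assoc. apply Rmult_le_compat_l; nra.
    - simpl. nra. }
  (* About [v^4] steps of size [v^(-2)] give averages of length [v^2]: long enough to gain, and
     short enough that the ends cost only [v^2 v^36]. *)
  destruct (nceil_ex (v ^ 2 * v ^ 2)) as [Q [HQ1 HQ2]]; [nra|].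
  assert (HQ : (1 <= Q)%nat) by (destruct Q; [simpl in HQ1; nra|lia]).
  set (h := / v ^ 2). assert (Hh : 0 < h) by (apply Rinv_0_lt_compat; lra).
  assert (HQh : v ^ 2 <= INR Q * h <= 2 * v ^ 2).
  { unfold h. split; apply (Rmult_le_reg_r (v ^ 2)); try lra;
    rewrite Rmult_assoc, Rinv_l, Rmult_1_r by lra; nra. }
  rewrite (CInt_ext _ (trisum (tri_weight n0) (tri_freq A B) M)).
  2: { intros t. symmetry. apply trisum_product; auto. }
  set (Bd := S0 * v ^ 36).
  assert (HBd : forall t, v ^ 24 <= t <= v ^ 40 + 122 * v ^ 2 ->
    Cmod (trisum (tri_weight n0) (tri_freq A B) M t) <= Bd).
  { intros t Ht. rewrite trisum_product by auto.
    assert (V2 : v ^ 2 <= v ^ 40) by (apply Rle_pow; [auto|lia]).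
    assert (DA : Cmod (dpoly M (A * t)) <= C1 * v ^ 12).
    { apply HD; auto. split; nra. }
    assert (DB : Cmod (dpoly M (B * t)) <= C1 * v ^ 12).
    { apply HD; auto. split; nra. }
    rewrite !Cmod_mult. rewrite <- dpoly_conj, Cmod_conj.
    assert (DS : Cmod (dpoly M (- (B * t)) - dpoly n0 (- (B * t))) <= (C1 + 2 * sqrt (INR n0)) * v ^ 12).
    { eapply Rle_trans; [apply Cmod_minus_le|]. rewrite <- (dpoly_conj M), Cmod_conj.
      pose proof (Cmod_dpoly_trivial n0 (- (B * t))). pose proof (sqrt_pos (INR n0)). nra. }
    unfold Bd, S0. replace (C1 * C1 * (C1 + 2 * sqrt (INR n0)) * v ^ 36) with
      ((C1 * v ^ 12) * (C1 * v ^ 12) * ((C1 + 2 * sqrt (INR n0)) * v ^ 12)) by (simpl; ring).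
    apply Rmult_le_compat; auto.
    - apply Rmult_le_pos; apply Cmod_ge_0.
    - apply Cmod_ge_0.
    - apply Rmult_le_compat; auto; apply Cmod_ge_0. }
  (* For [|u| > 1/2] the integral is at most 4 and each average gains [14 / v^2]. The exponent 61 is
     the first with [v^122] above the number of triples [M^3], which is of order [v^120]. *)
  set (kap := 4 * (14 / v ^ 2) ^ 61).
  assert (Hkap : 0 <= kap).
  { apply Rmult_le_pos; [lra|]. apply pow_le. apply Rlt_le, Rdiv_lt_0_compat; lra. }
  assert (V24 : v ^ 24 <= v ^ 40) by (apply Rle_pow; [auto|lia]).
  assert (E61 : INR 61 = 61) by (simpl; ring).
  eapply Rle_trans.
  - apply (trisum_smoothing _ _ M h Q 61 (v ^ 24) (v ^ 40) Bd
      (fun n k m => near_majorant (fun n => Rpower (INR n) (B / A)) (tail_weight n0) (v ^ 40) M n k m + kap)); auto.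
    + lra.
    + unfold Bd. nra.
    + intros t Ht. rewrite E61 in Ht. apply HBd. lra.
    + intros t Ht. rewrite E61 in Ht. apply HBd. lra.
    + intros n k m Hn Hk Hm.
      assert (W0 : 0 <= tri_weight n0 n k m <= 1).
      { unfold tri_weight. pose proof (tail_weight_bound n0 n ltac:(lia)).
        assert (S : forall j, (1 <= j)%nat -> 0 <= / sqrt (INR j) <= 1).
        { intros j Hj. assert (1 <= sqrt (INR j)).
          { rewrite <- sqrt_1. apply sqrt_le_1; try lra; [apply pos_INR|apply INR_ge1; auto]. }
          split; [apply Rlt_le, Rinv_0_lt_compat; lra|]. rewrite <- Rinv_1. apply Rinv_le_contravar; lra. }
        pose proof (S k ltac:(lia)). pose proof (S m ltac:(lia)).
        assert (0 <= / sqrt (INR k) * / sqrt (INR m) <= 1) by (split; nra). split; nra. }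
      rewrite (Rabs_pos_eq (tri_weight n0 n k m)) by lra.
      set (u := tri_freq A B n k m).
      destruct (avgn_cis_int_near h Q 61 u (v ^ 40) (v ^ 24) HQ V24) as [N1 N2].
      assert (G0 : 0 <= near_majorant (fun n => Rpower (INR n) (B / A)) (tail_weight n0) (v ^ 40) M n k m).
      { apply near_majorant_ge0; [lia|apply Rpower_gt0|apply tail_weight_bound; lia|lra]. }
      destruct (Rle_lt_dec (Rabs u) (1 / 2)) as [Hu|Hu].
      * assert (X : tri_weight n0 n k m * Cmod (avgn h Q 61 (cis_int u) (v ^ 40) - avgn h Q 61 (cis_int u) (v ^ 24)) <=
          near_majorant (fun n => Rpower (INR n) (B / A)) (tail_weight n0) (v ^ 40) M n k m).
        { apply (tri_term_near A B); try lia; try lra; auto. apply Cmod_ge_0. }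
        lra.
      * assert (Hu0 : u <> 0) by (intros E; rewrite E, Rabs_R0 in Hu; lra).
        pose proof (tri_freq_bound A B n k m M HA HB Hn Hk Hm) as Fb. fold u in Fb.
        assert (Huh : Rabs u * h <= 1).
        { unfold h. apply (Rmult_le_reg_r (v ^ 2)); [lra|]. rewrite Rmult_assoc, Rinv_l; lra. }
        pose proof (avg_factor_bound h Q u HQ Hh Hu0 Huh) as F1.
        assert (F2 : Cmod (avg_factor h Q u) <= 14 / v ^ 2).
        { eapply Rle_trans; [exact F1|].
          replace (14 / v ^ 2) with (7 / (v ^ 2 * (1 / 2))) by (field; lra).
          apply Rmult_le_compat_l; [lra|]. apply Rinv_le_contravar; nra. }
        pose proof (avgn_cis_int_far h Q 61 u (v ^ 40) (v ^ 24) HQ Hu0) as F3.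
        assert (F4 : 2 / Rabs u <= 4).
        { replace 4 with (2 / (1 / 2)) by field. apply Rmult_le_compat_l; [lra|]. apply Rinv_le_contravar; lra. }
        assert (F5 : Cmod (avgn h Q 61 (cis_int u) (v ^ 40) - avgn h Q 61 (cis_int u) (v ^ 24)) <= kap).
        { eapply Rle_trans; [exact F3|]. unfold kap. apply Rmult_le_compat; auto.
          - apply Rlt_le, Rdiv_lt_0_compat; lra.
          - apply pow_le, Cmod_ge_0.
          - apply pow_incr. split; [apply Cmod_ge_0|auto]. }
        pose proof (Cmod_ge_0 (avgn h Q 61 (cis_int u) (v ^ 40) - avgn h Q 61 (cis_int u) (v ^ 24))). nra.
  - rewrite rtrisum_plus_const, E61.
    pose proof (near_majorant_sum A B (v ^ 40) n0 M HA HB ltac:(lra) Hn0) as NS.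
    assert (T1 : 2 * (61 * (INR Q * h) * Bd) <= 244 * S0 * v ^ 38).
    { unfold Bd. replace (v ^ 38) with (v ^ 2 * v ^ 36) by (simpl; ring).
      assert (0 <= S0 * v ^ 36) by nra. nra. }
    assert (T2 : INR M ^ 3 * kap <= B8).
    { apply Rle_trans with ((2 * B * v ^ 40) ^ 3 * kap).
      - apply Rmult_le_compat_r; auto. apply pow_incr. split; [apply pos_INR|auto].
      - unfold kap, B8, Rdiv. rewrite !Rpow_mult_distr, pow_inv. fold c61.
        replace ((v ^ 40) ^ 3) with (v ^ 120) by (rewrite <- pow_mult; reflexivity).
        replace ((v ^ 2) ^ 61) with (v ^ 2 * v ^ 120) by (rewrite <- pow_mult, <- pow_add; reflexivity).
        pose proof (P 120%nat) as P120. set (x := v ^ 120) in *.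
        replace (2 ^ 3 * B ^ 3 * x * (4 * (c61 * / (v ^ 2 * x)))) with (2 ^ 3 * B ^ 3 * (4 * c61) * / v ^ 2) by (field; lra).
        assert (Q1 : 0 <= 2 ^ 3 * B ^ 3 * (4 * c61)).
        { apply Rmult_le_pos; [|lra]. apply Rmult_le_pos; apply pow_le; lra. }
        rewrite <- (Rmult_1_r (2 ^ 3 * B ^ 3 * (4 * c61))) at 2. apply Rmult_le_compat_l; auto.
        rewrite <- Rinv_1. apply Rinv_le_contravar; lra. }
    assert (T3 : rtrisum (near_majorant (fun n => Rpower (INR n) (B / A)) (tail_weight n0) (v ^ 40) M) M <=
      K * v ^ 40 * harmonic M * Rpower (INR n0) (- ((B - A) / (2 * A)))).
    { eapply Rle_trans; [exact NS|]. unfold K.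
      pose proof (harmonic_ge0 M) as H0. pose proof (Rpower_gt0 (INR n0) (- ((B - A) / (2 * A)))) as R0.
      set (R1 := Rpower (INR n0) (- ((B - A) / (2 * A)))) in *. set (q := 2 * A / (B - A)) in *.
      assert (Y : 0 <= harmonic M * (q * R1)) by (apply Rmult_le_pos; nra).
      replace (harmonic M * (64 * v ^ 40 + 64 * INR M) * (q * R1)) with
        ((harmonic M * (q * R1)) * (64 * v ^ 40 + 64 * INR M)) by ring.
      replace (64 * (1 + 2 * B) * q * v ^ 40 * harmonic M * R1) with
        ((harmonic M * (q * R1)) * (64 * ((1 + 2 * B) * v ^ 40))) by ring.
      apply Rmult_le_compat_l; auto. lra. }
    assert (B8 <= B8 * v ^ 38) by nra. unfold near_majorant in *. lra.
Qed.

(** * A fixed frequency n^(b/a) *)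

(** The logarithms differ by at least [d / max], where [max = min + d] and [min <= sqrt (m y)]. For
    [y = k alpha] the factor [sqrt (m y)] cancels the coefficients of [k] and [m], whatever their
    relative size. *)
Lemma pair_term_far (A y m D : R) : 1 <= A -> 0 < y -> 0 < m -> 1 <= Rabs (m - y) ->
  (ln y <> ln m -> D <= 2 / Rabs (A * (ln y - ln m))) ->
  D <= 2 + 4 * (sqrt m * sqrt y) * / (1 + Rabs (m - y)).
Proof.
  intros HA Hy Hm Hd HD.
  assert (Hne : ln y <> ln m).
  { intros E. apply ln_inv in E; auto. rewrite E, Rminus_diag, Rabs_R0 in Hd. lra. }
  specialize (HD Hne).
  pose proof (ln_sub_ge m y Hm Hy) as G. rewrite (Rabs_minus_sym (ln m)) in G.
  set (d := Rabs (m - y)) in *.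
  assert (Mx : Rmax m y = Rmin m y + d).
  { unfold d, Rmax, Rmin. destruct Rle_dec; [rewrite Rabs_left1|rewrite Rabs_pos_eq]; lra. }
  assert (Mn : Rmin m y <= sqrt m * sqrt y).
  { rewrite <- (sqrt_sqrt (Rmin m y)) by (apply Rlt_le, Rmin_pos; auto).
    apply Rmult_le_compat; try apply sqrt_pos; apply sqrt_le_1; try lra.
    - apply Rlt_le, Rmin_pos; auto.
    - apply Rmin_l.
    - apply Rlt_le, Rmin_pos; auto.
    - apply Rmin_r. }
  assert (Mx0 : 0 < Rmax m y) by (eapply Rlt_le_trans; [exact Hm|apply Rmax_l]).
  assert (Pd : 0 < d / Rmax m y) by (apply Rdiv_lt_0_compat; lra).
  eapply Rle_trans; [exact HD|].
  rewrite Rabs_mult, (Rabs_pos_eq A) by lra.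
  apply Rle_trans with (2 / (d / Rmax m y)).
  - apply Rmult_le_compat_l; [lra|]. apply Rinv_le_contravar; auto. nra.
  - replace (2 / (d / Rmax m y)) with (2 + 2 * Rmin m y * / d) by (rewrite Mx; field; lra).
    apply Rplus_le_compat_l.
    assert (0 <= Rmin m y) by (apply Rlt_le, Rmin_pos; auto).
    replace (4 * (sqrt m * sqrt y) * / (1 + d)) with (2 * (sqrt m * sqrt y) * (2 * / (1 + d))) by ring.
    apply Rmult_le_compat; try lra.
    + apply Rlt_le, Rinv_0_lt_compat; lra.
    + replace (2 * / (1 + d)) with (/ ((1 + d) / 2)) by (field; lra). apply Rinv_le_contravar; lra.
Qed.

Definition pair_freq (A theta : R) (k m : nat) : R := A * ln (INR k) + theta - A * ln (INR m).
Definition pair_weight (k m : nat) : R := / sqrt (INR k) * / sqrt (INR m).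

Lemma pair_freq_eq A alpha k m : 0 < alpha -> (1 <= k)%nat ->
  pair_freq A (A * ln alpha) k m = A * (ln (INR k * alpha) - ln (INR m)).
Proof. intros Ha Hk. unfold pair_freq. rewrite ln_mult; [ring|apply lt_0_INR; auto|auto]. Qed.

Lemma pair_sum_product A theta N t :
  csum (fun k => csum (fun m => RtoC (pair_weight k m) * cis (pair_freq A theta k m * t))%C N) N =
  (dpoly N (A * t) * dpoly N (- (A * t)) * cis (theta * t))%C.
Proof.
  set (ck := fun k => (RtoC (/ sqrt (INR k)) * cis (- (- (A * t) * ln (INR k))))%C).
  change (dpoly N (- (A * t))) with (csum ck N).
  transitivity (csum (fun k => ck k * (cis (theta * t) * dpoly N (A * t)))%C N).
  2: { rewrite csum_scal_r. ring. }
  apply csum_ext; intros k _. unfold dpoly. rewrite <- !csum_scal. apply csum_ext; intros m _.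
  unfold pair_weight, pair_freq, ck. rewrite RtoC_mult.
  replace ((A * ln (INR k) + theta - A * ln (INR m)) * t) with
    (- (- (A * t) * ln (INR k)) + (theta * t + - (A * t * ln (INR m)))) by ring.
  rewrite !cis_plus. ring.
Qed.

Lemma ccont_dpoly N c : ccont (fun t => dpoly N (c * t)).
Proof.
  apply ccont_csum. intros i. apply ccont_mult; [apply ccont_const|]. apply ccont_cis.
  intros t. apply (continuous_opp (fun t => c * t * ln (INR i))).
  apply cont_mult; [apply cont_mult|]; auto using cont_const, cont_id.
Qed.

Lemma CInt_pair_sum A theta N T0 T :
  CInt (fun t => dpoly N (A * t) * dpoly N (- (A * t)) * cis (theta * t))%C T0 T =
  csum (fun k => csum (fun m => RtoC (pair_weight k m) * CInt (fun t => cis (pair_freq A theta k m * t)) T0 T)%C N) N.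
Proof.
  rewrite (CInt_ext _ (fun t => csum (fun k => csum (fun m => RtoC (pair_weight k m) * cis (pair_freq A theta k m * t))%C N) N)).
  2: { intros t. symmetry. apply pair_sum_product. }
  assert (C : forall k m, ccont (fun t => RtoC (pair_weight k m) * cis (pair_freq A theta k m * t))%C).
  { intros; apply ccont_mult; [apply ccont_const|apply ccont_cis_lin]. }
  rewrite CInt_csum by (intros; apply ccont_csum; auto).
  apply csum_ext; intros k _. rewrite CInt_csum by auto.
  apply csum_ext; intros m _. apply CInt_scal, ccont_cis_lin.
Qed.

Lemma pair_weight_pos k m : (1 <= k)%nat -> (1 <= m)%nat -> 0 < pair_weight k m.
Proof.
  intros Hk Hm. apply Rmult_lt_0_compat; apply Rinv_0_lt_compat, sqrt_lt_R0, lt_0_INR; auto.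
Qed.

Definition far_majorant (alpha : R) (k m : nat) : R :=
  2 * pair_weight k m + 4 * sqrt alpha * / (1 + Rabs (INR m - INR k * alpha)).

(** The total is [O(N log N)]: for [N = rho T] with small [rho] it is a small multiple of
    [T log T]. *)
Lemma far_majorant_sum alpha N : 0 < alpha ->
  rsum (fun k => rsum (fun m => far_majorant alpha k m) N) N <=
  8 * INR N + 8 * sqrt alpha * (INR N * harmonic N).
Proof.
  intros Ha. pose proof (sqrt_pos alpha) as Sa.
  rewrite (rsum_ext _ (fun k => 2 * (/ sqrt (INR k) * rsum (fun m => / sqrt (INR m)) N) +
    4 * sqrt alpha * rsum (fun m => / (1 + Rabs (INR m - INR k * alpha))) N)).
  2: { intros k _. unfold far_majorant, pair_weight. rewrite rsum_plus, !rsum_scal. reflexivity. }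
  rewrite rsum_plus, rsum_scal, rsum_scal_r.
  pose proof (rsum_inv_sqrt N) as R1. set (s := rsum (fun m => / sqrt (INR m)) N) in *.
  assert (s0 : 0 <= s) by (apply rsum_ge0; intros; apply Rlt_le, Rinv_0_lt_compat, sqrt_lt_R0, lt_0_INR; lia).
  assert (Sq : sqrt (INR N) * sqrt (INR N) = INR N) by (apply sqrt_sqrt, pos_INR).
  apply Rplus_le_compat; [nra|].
  rewrite rsum_scal.
  replace (8 * sqrt alpha * (INR N * harmonic N)) with (4 * sqrt alpha * (INR N * (2 * harmonic N))) by ring.
  apply Rmult_le_compat_l; [lra|]. rewrite <- rsum_const. apply rsum_le; intros.
  apply rsum_inv_dist.
Qed.

Lemma pair_term_far_weighted A alpha T0 T k m : 1 <= A -> 0 < alpha -> (1 <= k)%nat -> (1 <= m)%nat ->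
  1 <= Rabs (INR m - INR k * alpha) ->
  pair_weight k m * Cmod (CInt (fun t => cis (pair_freq A (A * ln alpha) k m * t)) T0 T) <= far_majorant alpha k m.
Proof.
  intros HA Ha Hk Hm Hd.
  pose proof (lt_0_INR k Hk) as Pk. pose proof (lt_0_INR m Hm) as Pm.
  assert (Py : 0 < INR k * alpha) by (apply Rmult_lt_0_compat; auto).
  rewrite pair_freq_eq by auto.
  set (D := Cmod _).
  assert (HD : D <= 2 + 4 * (sqrt (INR m) * sqrt (INR k * alpha)) * / (1 + Rabs (INR m - INR k * alpha))).
  { apply (pair_term_far A); auto. intros Hne. apply Cmod_CInt_cis_u. nra. }
  eapply Rle_trans; [apply Rmult_le_compat_l; [apply Rlt_le, pair_weight_pos; auto|exact HD]|].
  unfold far_majorant, pair_weight. rewrite sqrt_mult by lra.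
  assert (Sk : 0 < sqrt (INR k)) by (apply sqrt_lt_R0; auto).
  assert (Sm : 0 < sqrt (INR m)) by (apply sqrt_lt_R0; auto).
  apply Req_le. field. repeat split; lra.
Qed.

(** For an integer [alpha] all pairs with [m <> k alpha] are at distance at least 1 and fall under
    the far bound. The pairs with [m = k alpha] have frequency 0 and are limited by [m <= N] to
    [k <= N / alpha]. *)
Lemma pair_int_diag (alpha : nat) N A T0 T : 1 <= A -> (1 <= alpha)%nat -> T0 <= T ->
  Cmod (CInt (fun t => dpoly N (A * t) * dpoly N (- (A * t)) * cis (A * ln (INR alpha) * t))%C T0 T -
    RtoC ((T - T0) * (/ sqrt (INR alpha) * harmonic (N / alpha)))) <=
  8 * INR N + 8 * sqrt (INR alpha) * (INR N * harmonic N).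
Proof.
  intros HA Hal HT. pose proof (lt_0_INR alpha Hal) as Pa.
  rewrite CInt_pair_sum.
  set (diag := fun k m : nat => if Nat.eqb m (k * alpha) then pair_weight k m * (T - T0) else 0).
  assert (E1 : forall k n, (1 <= k)%nat -> rsum (fun m => diag k m) n =
    if Nat.leb (k * alpha) n then (T - T0) * (/ sqrt (INR alpha) * / INR k) else 0).
  { intros k n Hk. pose proof (lt_0_INR k Hk) as Pk.
    induction n as [|n IH].
    - simpl rsum. case Nat.leb_spec; intros; [nia|reflexivity].
    - rewrite rsum_S, IH. unfold diag. case Nat.eqb_spec; intros E.
      + replace (k * alpha <=? n)%nat with false by (symmetry; apply Nat.leb_gt; lia).
        replace (k * alpha <=? S n)%nat with true by (symmetry; apply Nat.leb_le; lia).
        unfold pair_weight. rewrite E, mult_INR, sqrt_mult by lra.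
        rewrite <- (sqrt_sqrt (INR k)) at 3 by lra.
        assert (0 < sqrt (INR k)) by (apply sqrt_lt_R0; auto).
        assert (0 < sqrt (INR alpha)) by (apply sqrt_lt_R0; auto). field. split; lra.
      + case Nat.leb_spec; intros; case Nat.leb_spec; intros; try lia; ring. }
  assert (E2 : rsum (fun k => rsum (fun m => diag k m) N) N = (T - T0) * (/ sqrt (INR alpha) * harmonic (N / alpha))).
  { assert (F : forall n, (n <= N)%nat -> rsum (fun k => rsum (fun m => diag k m) N) n =
      (T - T0) * (/ sqrt (INR alpha) * harmonic (Nat.min n (N / alpha)))).
    { induction n as [|n IH]; intros Hn; [unfold harmonic; simpl; ring|].
      rewrite rsum_S, IH, E1 by lia.
      case Nat.leb_spec; intros L.
      - assert (S n <= N / alpha)%nat by (apply Nat.div_le_lower_bound; lia).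
        rewrite !Nat.min_l by lia. unfold harmonic. rewrite rsum_S. ring.
      - assert (N / alpha < S n)%nat by (apply Nat.Div0.div_lt_upper_bound; lia).
        rewrite !Nat.min_r by lia. ring. }
    rewrite F by lia. rewrite Nat.min_r; auto. apply Nat.Div0.div_le_upper_bound; nia. }
  rewrite <- E2, <- csum_RtoC, <- csum_minus.
  eapply Rle_trans; [|apply far_majorant_sum; auto].
  apply Cmod_csum_le; intros k Hk. rewrite <- csum_RtoC, <- csum_minus.
  apply Cmod_csum_le; intros m Hm.
  assert (F0 : 0 <= far_majorant (INR alpha) k m).
  { unfold far_majorant. pose proof (pair_weight_pos k m ltac:(lia) ltac:(lia)).
    pose proof (sqrt_pos (INR alpha)). pose proof (Rabs_pos (INR m - INR k * INR alpha)).
    assert (0 < / (1 + Rabs (INR m - INR k * INR alpha))) by (apply Rinv_0_lt_compat; lra). nra. }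
  unfold diag. case Nat.eqb_spec; intros E.
  - rewrite pair_freq_eq by (auto; lia). rewrite E, mult_INR.
    rewrite Rminus_diag, Rmult_0_r, CInt_cis_0, RtoC_mult.
    match goal with |- Cmod ?x <= _ => replace x with (RtoC 0) by ring end.
    rewrite Cmod_0. rewrite <- E. exact F0.
  - match goal with |- Cmod ?x <= _ => replace x with
      (RtoC (pair_weight k m) * CInt (fun t => cis (pair_freq A (A * ln (INR alpha)) k m * t)) T0 T)%C by ring end.
    rewrite Cmod_RtoC_mult by (apply Rlt_le, pair_weight_pos; lia).
    apply pair_term_far_weighted; auto; try lia.
    rewrite <- mult_INR.
    destruct (Nat.lt_trichotomy m (k * alpha)) as [L|[L|L]]; [|lia|].
    + rewrite Rabs_minus_sym, Rabs_pos_eq, <- minus_INR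
        by (try lia; assert (INR m <= INR (k * alpha)) by (apply le_INR; lia); lra).
      apply INR_ge1; lia.
    + rewrite Rabs_pos_eq, <- minus_INR
        by (try lia; assert (INR (k * alpha) <= INR m) by (apply le_INR; lia); lra).
      apply INR_ge1; lia.
Qed.

(* A weight supported on a q-spaced set, also away from 0, picks up a 1/q fraction of the harmonic sum. *)
Lemma rsum_spaced (f : nat -> R) (c : R) (q : nat) : (1 <= q)%nat ->
  (forall k, 0 <= f k <= c) ->
  (forall k, (1 <= k)%nat -> f k <> 0 -> (q <= k)%nat) ->
  (forall k k', (1 <= k < k')%nat -> f k <> 0 -> f k' <> 0 -> (k + q <= k')%nat) ->
  forall N, rsum (fun k => f k * / INR k) N <= c / INR q * harmonic N.
Proof.
  intros Hq Hf H0 Hs. pose proof (lt_0_INR q Hq) as Pq.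
  assert (c0 : 0 <= c) by (destruct (Hf 0%nat); lra).
  induction N as [N IH] using (well_founded_ind Nat.lt_wf_0).
  destruct N as [|N]; [unfold harmonic; simpl; lra|].
  pose proof (INR_S_pos N) as PN.
  destruct (Req_dec (f (S N)) 0) as [E|E].
  - rewrite rsum_S, E. specialize (IH N ltac:(lia)).
    unfold harmonic in *. rewrite rsum_S.
    assert (0 <= c / INR q * / INR (S N)).
    { apply Rmult_le_pos; [|apply Rlt_le, Rinv_0_lt_compat; auto]. apply Rmult_le_pos; [auto|apply Rlt_le, Rinv_0_lt_compat; auto]. }
    lra.
  - pose proof (H0 (S N) ltac:(lia) E) as HqN.
    set (j := (S N - q)%nat).
    specialize (IH j ltac:(lia)).
    assert (A1 : rsum (fun k => f k * / INR k) N = rsum (fun k => f k * / INR k) j).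
    { replace N with (j + (N - j))%nat by lia. rewrite rsum_add.
      rewrite (rsum_ext (fun i => f (j + i)%nat * / INR (j + i)) (fun _ => 0)), rsum_const; [ring|].
      intros i Hi. destruct (Req_dec (f (j + i)%nat) 0) as [Z|Z]; [rewrite Z; ring|].
      pose proof (Hs (j + i)%nat (S N) ltac:(lia) Z E). lia. }
    rewrite rsum_S, A1.
    assert (A2 : harmonic j + INR q * / INR (S N) <= harmonic (S N)).
    { unfold harmonic. replace (S N) with (j + q)%nat at 2 by lia. rewrite rsum_add.
      apply Rplus_le_compat_l. rewrite <- rsum_const. apply rsum_le; intros i Hi.
      apply Rinv_le_contravar; [apply lt_0_INR; lia|apply le_INR; lia]. }
    assert (A3 : f (S N) * / INR (S N) <= c * / INR (S N)).
    { apply Rmult_le_compat_r; [apply Rlt_le, Rinv_0_lt_compat; auto|apply Hf]. }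
    apply Rle_trans with (c / INR q * (harmonic j + INR q * / INR (S N))).
    + replace (c / INR q * (harmonic j + INR q * / INR (S N))) with
        (c / INR q * harmonic j + c * / INR (S N)) by (field; lra). lra.
    + apply Rmult_le_compat_l; auto. apply Rmult_le_pos; [auto|apply Rlt_le, Rinv_0_lt_compat; auto].
Qed.

Lemma nonint_dist (x : R) : (forall z : Z, x <> IZR z) -> exists d, 0 < d /\ forall z, d <= Rabs (IZR z - x).
Proof.
  intros H. destruct (archimed x) as [A1 A2].
  assert (A3 : IZR (up x) - x <> 1).
  { intros E. apply (H (up x - 1)%Z). rewrite minus_IZR. lra. }
  exists (Rmin (IZR (up x) - x) (1 - (IZR (up x) - x))). split; [apply Rmin_pos; lra|].
  intros z. destruct (Z.lt_ge_cases z (up x)) as [L|L].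
  - eapply Rle_trans; [apply Rmin_r|].
    assert (IZR z <= IZR (up x) - 1) by (rewrite <- minus_IZR; apply IZR_le; lia).
    rewrite Rabs_left1; lra.
  - eapply Rle_trans; [apply Rmin_l|].
    apply IZR_le in L. rewrite Rabs_pos_eq; lra.
Qed.

(** A minimum over finitely many [k]. It is what forces the near coincidences of [k alpha] with
    integers to lie at least [q] apart. *)
Lemma multiples_dist (alpha : R) (q : nat) : (forall (k : nat) (z : Z), (1 <= k)%nat -> INR k * alpha <> IZR z) ->
  exists d, 0 < d /\ forall k z, (1 <= k < q)%nat -> d <= Rabs (IZR z - INR k * alpha).
Proof.
  intros H. induction q as [|q IH].
  - exists 1. split; [lra|]. intros; lia.
  - destruct IH as [d1 [P1 D1]]. destruct (Nat.eq_dec q 0) as [->|Hq].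
    { exists 1. split; [lra|]. intros; lia. }
    destruct (nonint_dist (INR q * alpha)) as [d2 [P2 D2]].
    { intros z. apply H; lia. }
    exists (Rmin d1 d2). split; [apply Rmin_pos; auto|].
    intros k z Hk. destruct (Nat.eq_dec k q) as [->|].
    + eapply Rle_trans; [apply Rmin_r|apply D2].
    + eapply Rle_trans; [apply Rmin_l|apply D1; lia].
Qed.

(** Three ranges for the distance [d] from [m] to [k alpha]. For [d >= 1] the far bound holds; for
    [delta <= d < 1] the frequency is at least [delta / (2 N)]; for [d < delta] only the trivial
    bound is left, but two such [k] differ by at least [q], since otherwise [(k' - k) alpha] would
    come within [2 delta] of an integer. *)
Lemma pair_int_irrational (A alpha delta T0 T : R) (q N : nat) : 1 <= A -> 1 <= alpha -> T0 <= T -> 0 < delta <= 1 ->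
  (1 <= q)%nat -> (1 <= N)%nat ->
  (forall k m : nat, (1 <= k)%nat -> INR k * alpha <> INR m) ->
  (forall k z, (1 <= k < q)%nat -> 2 * delta <= Rabs (IZR z - INR k * alpha)) ->
  Cmod (CInt (fun t => dpoly N (A * t) * dpoly N (- (A * t)) * cis (A * ln alpha * t))%C T0 T) <=
  8 * INR N + 8 * sqrt alpha * (INR N * harmonic N) + 256 * (INR N / delta) * harmonic N +
  64 * (T - T0) / INR q * harmonic N.
Proof.
  intros HA Ha HT Hdel Hq HN Hirr Hsp. rewrite CInt_pair_sum.
  pose proof (INR_ge1 N HN) as PN.
  set (D := fun k m : nat => / ((1 + Rabs (INR m - INR k * alpha)) * (1 + Rabs (INR m - INR k * alpha)))).
  assert (D0 : forall k m, 0 < D k m).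
  { intros. apply Rinv_0_lt_compat. pose proof (Rabs_pos (INR m - INR k * alpha)). nra. }
  set (ind := fun k m : nat => if Rlt_dec (Rabs (INR m - INR k * alpha)) delta then 1 else 0).
  (* For [d < 1] one has [4 D >= 1], so [4 ind D] dominates the indicator of a near coincidence,
     while its sum over [m] is at most 32 for every [k]. *)
  set (f := fun k => rsum (fun m => 4 * (ind k m * D k m)) N).
  assert (I0 : forall k m, 0 <= ind k m <= 1) by (intros; unfold ind; destruct Rlt_dec; lra).
  assert (Hf : forall k, 0 <= f k <= 32).
  { intros k. split.
    - apply rsum_ge0; intros m _. specialize (I0 k m). specialize (D0 k m). nra.
    - apply Rle_trans with (rsum (fun m => 4 * D k m) N).
      + apply rsum_le; intros m _. specialize (I0 k m). specialize (D0 k m). nra.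
      + rewrite rsum_scal. pose proof (rsum_inv_dist_sq (INR k * alpha) N) as S. fold (D k) in S. lra. }
  assert (Hsupp : forall k, f k <> 0 -> exists m, Rabs (INR m - INR k * alpha) < delta).
  { intros k Hk. apply NNPP. intros C. apply Hk. unfold f.
    rewrite (rsum_ext _ (fun _ => 0)), rsum_const; [ring|].
    intros m _. unfold ind. destruct Rlt_dec as [L|L]; [|ring]. exfalso. apply C. exists m; auto. }
  assert (Hsum := rsum_spaced f 32 q Hq Hf).
  assert (Hsp0 : forall k, (1 <= k)%nat -> f k <> 0 -> (q <= k)%nat).
  { intros k Hk Hfk. destruct (Hsupp k Hfk) as [m Hm].
    destruct (Nat.le_gt_cases q k) as [|L]; auto. exfalso.
    specialize (Hsp k (Z.of_nat m) ltac:(lia)). rewrite <- INR_IZR_INZ in Hsp. lra. }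
  assert (Hsp1 : forall k k', (1 <= k < k')%nat -> f k <> 0 -> f k' <> 0 -> (k + q <= k')%nat).
  { intros k k' Hk F1 F2. destruct (Hsupp k F1) as [m Hm]. destruct (Hsupp k' F2) as [m' Hm'].
    destruct (Nat.le_gt_cases (k + q) k') as [|L]; auto. exfalso.
    specialize (Hsp (k' - k)%nat (Z.of_nat m' - Z.of_nat m)%Z ltac:(lia)).
    rewrite minus_IZR, <- !INR_IZR_INZ, minus_INR in Hsp by lia.
    replace (INR m' - INR m - (INR k' - INR k) * alpha) with
      ((INR m' - INR k' * alpha) - (INR m - INR k * alpha)) in Hsp by ring.
    pose proof (Rabs_triang (INR m' - INR k' * alpha) (- (INR m - INR k * alpha))) as Tr.
    rewrite Rabs_Ropp in Tr. unfold Rminus at 1 in Hsp. lra. }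
  specialize (Hsum Hsp0 Hsp1 N).
  assert (Key : forall k m, (1 <= k <= N)%nat -> (1 <= m <= N)%nat ->
    pair_weight k m * Cmod (CInt (fun t => cis (pair_freq A (A * ln alpha) k m * t)) T0 T) <=
    far_majorant alpha k m + (32 * (INR N / delta) * / INR k * D k m +
      2 * (T - T0) * (4 * (ind k m * D k m) * / INR k))).
  { intros k m Hk Hm.
    pose proof (lt_0_INR k ltac:(lia)) as Pk. pose proof (INR_ge1 m ltac:(lia)) as Pm.
    assert (P1 : 0 <= 32 * (INR N / delta) * / INR k * D k m).
    { apply Rmult_le_pos; [|apply Rlt_le, D0]. apply Rmult_le_pos; [|apply Rlt_le, Rinv_0_lt_compat; auto].
      assert (0 < INR N / delta) by (apply Rdiv_lt_0_compat; lra). lra. }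
    assert (P2 : 0 <= 2 * (T - T0) * (4 * (ind k m * D k m) * / INR k)).
    { apply Rmult_le_pos; [lra|]. apply Rmult_le_pos; [|apply Rlt_le, Rinv_0_lt_compat; auto].
      specialize (I0 k m). specialize (D0 k m). nra. }
    assert (P3 : 0 <= far_majorant alpha k m).
    { unfold far_majorant. pose proof (pair_weight_pos k m ltac:(lia) ltac:(lia)).
      pose proof (sqrt_pos alpha). pose proof (Rabs_pos (INR m - INR k * alpha)).
      assert (0 < / (1 + Rabs (INR m - INR k * alpha))) by (apply Rinv_0_lt_compat; lra). nra. }
    destruct (Rle_lt_dec 1 (Rabs (INR m - INR k * alpha))) as [Hfar|Hnear].
    { pose proof (pair_term_far_weighted A alpha T0 T k m HA ltac:(lra) ltac:(lia) ltac:(lia) Hfar). lra. }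
    set (y := INR k * alpha) in *. set (d := Rabs (INR m - y)) in *.
    assert (Py : 0 < y) by (apply Rmult_lt_0_compat; lra).
    assert (Hym : INR k <= 2 * INR m).
    { unfold d in Hnear. apply Rabs_def2 in Hnear. assert (INR k <= y) by (unfold y; nra). lra. }
    assert (W : pair_weight k m <= 2 * / INR k).
    { unfold pair_weight.
      assert (Sk : 0 < sqrt (INR k)) by (apply sqrt_lt_R0; auto).
      assert (Sm : 0 < sqrt (INR m)) by (apply sqrt_lt_R0; lra).
      assert (Ek : sqrt (INR k) * sqrt (INR k) = INR k) by (apply sqrt_sqrt; lra).
      assert (Em : sqrt (INR m) * sqrt (INR m) = INR m) by (apply sqrt_sqrt; lra).
      replace (2 * / INR k) with (/ sqrt (INR k) * (/ sqrt (INR k) * 2))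
        by (rewrite <- Rmult_assoc, <- Rinv_mult, Ek; ring).
      apply Rmult_le_compat_l; [apply Rlt_le, Rinv_0_lt_compat; auto|].
      replace (/ sqrt (INR k) * 2) with (/ (sqrt (INR k) / 2)) by (field; lra).
      apply Rinv_le_contravar; [lra|]. apply Rsqr_incr_0_var; [|lra]. unfold Rsqr.
      replace (sqrt (INR k) / 2 * (sqrt (INR k) / 2)) with (sqrt (INR k) * sqrt (INR k) / 4) by field.
      rewrite Ek, Em. lra. }
    assert (Wp : 0 < pair_weight k m) by (apply pair_weight_pos; lia).
    assert (d0 : 0 <= d) by apply Rabs_pos.
    assert (D4 : 1 <= 4 * D k m).
    { unfold D. fold y d. assert (/ 4 <= / ((1 + d) * (1 + d))) by (apply Rinv_le_contravar; nra). lra. }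
    rewrite pair_freq_eq by (lra || lia). fold y.
    set (I := Cmod (CInt _ T0 T)).
    assert (I00 : 0 <= I) by apply Cmod_ge_0.
    destruct (Rlt_dec d delta) as [Hd|Hd].
    - assert (HI : I <= T - T0) by (apply Cmod_CInt_cis_T; auto).
      assert (Ei : ind k m = 1).
      { unfold ind. fold y d. destruct Rlt_dec; lra. }
      rewrite Ei in *. rewrite Rmult_1_l in *.
      assert (pair_weight k m * I <= 2 * / INR k * (T - T0)) by (apply Rmult_le_compat; lra).
      assert (2 * / INR k * (T - T0) * 1 <= 2 * / INR k * (T - T0) * (4 * D k m)).
      { apply Rmult_le_compat_l; auto. apply Rmult_le_pos; [|lra].
        lra. }
      lra.
    - assert (Hyne : y <> INR m) by (apply Hirr; lia).
      assert (Hne : ln y <> ln (INR m)) by (intros E; apply ln_inv in E; auto; lra).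
      pose proof (ln_sub_ge (INR m) y ltac:(lra) Py) as G. fold d in G. rewrite (Rabs_minus_sym (ln (INR m))) in G.
      assert (HmN : INR m <= INR N) by (apply le_INR; lia).
      assert (Mx : Rmax (INR m) y <= 2 * INR N).
      { apply Rmax_lub; [lra|]. unfold d in Hnear. apply Rabs_def2 in Hnear. lra. }
      assert (Mx0 : 0 < Rmax (INR m) y) by (eapply Rlt_le_trans; [exact Py|apply Rmax_r]).
      assert (HI : I <= 4 * (INR N / delta)).
      { eapply Rle_trans; [apply Cmod_CInt_cis_u; nra|].
        replace (4 * (INR N / delta)) with (2 / (delta / (2 * INR N))) by (field; lra).
        apply Rmult_le_compat_l; [lra|]. apply Rinv_le_contravar; [apply Rdiv_lt_0_compat; lra|].
        rewrite Rabs_mult, (Rabs_pos_eq A) by lra.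
        apply Rle_trans with (d / Rmax (INR m) y).
        - apply Rmult_le_compat; try lra; [apply Rlt_le, Rinv_0_lt_compat; lra|]. apply Rinv_le_contravar; auto.
        - pose proof (Rabs_pos (ln y - ln (INR m))). nra. }
      assert (pair_weight k m * I <= 2 * / INR k * (4 * (INR N / delta))) by (apply Rmult_le_compat; lra).
      assert (2 * / INR k * (4 * (INR N / delta)) * 1 <= 2 * / INR k * (4 * (INR N / delta)) * (4 * D k m)).
      { apply Rmult_le_compat_l; auto. apply Rmult_le_pos; lra. }
      lra. }
  eapply Rle_trans.
  { apply Cmod_csum_le with (g := fun k => rsum (fun m => far_majorant alpha k m + (32 * (INR N / delta) * / INR k * D k m +
      2 * (T - T0) * (4 * (ind k m * D k m) * / INR k))) N).
    intros k Hk. apply Cmod_csum_le; intros m Hm.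
    rewrite Cmod_RtoC_mult by (apply Rlt_le, pair_weight_pos; lia). apply Key; auto. }
  rewrite (rsum_ext _ (fun k => rsum (fun m => far_majorant alpha k m) N + (32 * (INR N / delta) * / INR k * rsum (D k) N +
      2 * (T - T0) * (f k * / INR k)))).
  2: { intros k _. rewrite !rsum_plus, !rsum_scal, rsum_scal_r. reflexivity. }
  rewrite !rsum_plus, rsum_scal.
  pose proof (far_majorant_sum alpha N ltac:(lra)) as S1.
  assert (S2 : rsum (fun k => 32 * (INR N / delta) * / INR k * rsum (D k) N) N <= 256 * (INR N / delta) * harmonic N).
  { unfold harmonic. rewrite <- rsum_scal. apply rsum_le; intros k Hk.
    pose proof (rsum_inv_dist_sq (INR k * alpha) N) as S. fold (D k) in S.
    replace (256 * (INR N / delta) * / INR k) with (32 * (INR N / delta) * / INR k * 8) by ring.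
    apply Rmult_le_compat_l; auto. apply Rmult_le_pos; [|apply Rlt_le, Rinv_0_lt_compat, lt_0_INR; lia].
    assert (0 < INR N / delta) by (apply Rdiv_lt_0_compat; lra). lra. }
  assert (S3 : 2 * (T - T0) * rsum (fun k => f k * / INR k) N <= 64 * (T - T0) / INR q * harmonic N).
  { replace (64 * (T - T0) / INR q * harmonic N) with (2 * (T - T0) * (32 / INR q * harmonic N)) by (unfold Rdiv; ring).
    apply Rmult_le_compat_l; lra. }
  lra.
Qed.

(** * Continuity and mean squares of zeta on the critical line *)

Lemma geom_sum_le x n : 0 <= x <= 1 / 2 -> rsum (fun j => x ^ j) n <= 2 * x.
Proof.
  intros Hx. enough (rsum (fun j => x ^ j) n <= 2 * x - 2 * x * x ^ n).
  { pose proof (pow_le x n ltac:(lra)). nra. }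
  induction n as [|n IH]; [simpl; lra|].
  rewrite rsum_S. pose proof (pow_le x n ltac:(lra)). simpl.
  assert (0 <= x * x ^ n) by nra. nra.
Qed.

Lemma cconv_bounded u l : cconv u l -> exists B, 0 < B /\ forall n, Cmod (u n) <= B.
Proof.
  intros H. apply is_lim_seq_spec in H. destruct (H (mkposreal 1 Rlt_0_1)) as [N HN]. simpl in HN.
  exists (rsum (fun i => Cmod (u (pred i))) N + (Cmod l + 1)).
  assert (R0 : 0 <= rsum (fun i => Cmod (u (pred i))) N) by (apply rsum_ge0; intros; apply Cmod_ge_0).
  pose proof (Cmod_ge_0 l). split; [lra|].
  intros n. destruct (Nat.le_gt_cases N n) as [L|L].
  - specialize (HN n L). rewrite Rminus_0_r, Rabs_pos_eq in HN by apply Cmod_ge_0.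
    pose proof (Cmod_le_via (u n) l). lra.
  - pose proof (rsum_le_term (fun i => Cmod (u (pred i))) N (S n) (fun _ => Cmod_ge_0 _) ltac:(lia)) as T.
    simpl in T. lra.
Qed.

(** Bounded partial sums at [rho = r / 2] bound the terms [rho^n |c n|]; for [|h| < rho / 2] the
    series without its constant term is then dominated by a geometric one of size [O(|h| / rho)]. *)
Lemma powerseries_continuous (c : nat -> C) (f : C -> C) (s0 : C) (r : posreal) :
  (forall h : C, Cmod h < r -> is_pseries (K := C_AbsRing) (V := C_NormedModule) c h (f (s0 + h)%C)) ->
  forall eps, 0 < eps -> exists d, 0 < d /\ forall h, Cmod h < d -> Cmod (f (s0 + h)%C - f s0) <= eps.
Proof.
  intros H eps Heps. pose proof (cond_pos r) as Pr.
  set (rho := r / 2).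
  assert (E : forall h, Cmod h < r -> cconv (csum (fun j => Cpow h (pred j) * c (pred j))%C) (f (s0 + h)%C)).
  { intros h Hh. apply is_series_cconv.
    apply (is_series_ext (fun n => scal (K := C_AbsRing) (V := C_NormedModule) (pow_n (K := C_AbsRing) h n) (c n))).
    - intros n. reflexivity.
    - apply H; auto. }
  assert (Hrho : Cmod (RtoC rho) < r) by (rewrite Cmod_R; unfold rho; rewrite Rabs_pos_eq; lra).
  destruct (cconv_bounded _ _ (E _ Hrho)) as [Bd [B0 HB]].
  assert (Hc : forall n, rho ^ n * Cmod (c n) <= 2 * Bd).
  { intros n. pose proof (HB (S n)) as H1. pose proof (HB n) as H2. rewrite csum_S in H1.
    replace (rho ^ n * Cmod (c n)) with (Cmod (Cpow (RtoC rho) n * c n)).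
    - simpl pred in H1. set (S := csum _ n) in *.
      replace (Cpow (RtoC rho) n * c n)%C with ((S + Cpow (RtoC rho) n * c n) - S)%C by ring.
      eapply Rle_trans; [apply Cmod_minus_le|]. lra.
    - rewrite Cmod_mult, Cmod_pow, Cmod_R, Rabs_pos_eq by (unfold rho; lra). reflexivity. }
  assert (E0 : f s0 = c 0%nat).
  { assert (Hz : Cmod 0 < r) by (rewrite Cmod_0; lra).
    replace (f s0) with (f (s0 + 0)%C) by (f_equal; ring).
    apply (cconv_unique _ _ _ (E 0%C Hz)).
    apply cconv_incr_1. apply cconv_ext with (fun _ => c 0%nat); [|apply cconv_const].
    intros n. induction n as [|n IH]; [simpl; ring|].
    rewrite csum_S, <- IH. simpl. ring. }
  set (d := Rmin (rho / 2) (eps * rho / (4 * Bd))).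
  assert (Prho : 0 < rho) by (unfold rho; lra).
  exists d. split.
  { apply Rmin_pos; [lra|]. apply Rdiv_lt_0_compat; nra. }
  intros h Hh.
  assert (Hh1 : Cmod h < rho / 2) by (eapply Rlt_le_trans; [exact Hh|apply Rmin_l]).
  assert (Hh2 : Cmod h < eps * rho / (4 * Bd)) by (eapply Rlt_le_trans; [exact Hh|apply Rmin_r]).
  assert (Hhr : Cmod h < r) by (unfold rho in *; lra).
  rewrite E0.
  apply cconv_bound with (fun n => csum (fun j => Cpow h (pred j) * c (pred j))%C (S n) - c 0%nat)%C.
  { apply cconv_minus; [apply cconv_incr_1'; auto|apply cconv_const]. }
  intros n.
  assert (F : (csum (fun j => Cpow h (pred j) * c (pred j)) (S n) - c 0%nat)%C =
    csum (fun j => Cpow h j * c j)%C n).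
  { induction n as [|n IH]; [simpl; ring|].
    rewrite csum_S, (csum_S (fun j => Cpow h j * c j)%C), <- IH. simpl pred. ring. }
  rewrite F. pose proof (Cmod_ge_0 h) as h0.
  set (x := Cmod h / rho).
  assert (Hx : 0 <= x <= 1 / 2).
  { unfold x. split; [apply Rmult_le_pos; [auto|apply Rlt_le, Rinv_0_lt_compat; auto]|].
    apply (Rmult_le_reg_r rho); auto. replace (Cmod h / rho * rho) with (Cmod h) by (field; lra). lra. }
  apply Rle_trans with (2 * Bd * rsum (fun j => x ^ j) n).
  - rewrite <- rsum_scal. apply Cmod_csum_le; intros j Hj. rewrite Cmod_mult, Cmod_pow.
    replace (Cmod h ^ j) with (x ^ j * rho ^ j).
    + rewrite Rmult_assoc, Rmult_comm. apply Rmult_le_compat_r; auto. apply pow_le; lra.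
    + rewrite <- Rpow_mult_distr. f_equal. unfold x. field; lra.
  - pose proof (geom_sum_le x n Hx).
    apply Rle_trans with (2 * Bd * (2 * x)); [apply Rmult_le_compat_l; lra|].
    unfold x. apply (Rmult_le_reg_r (rho / (4 * Bd))); [apply Rdiv_lt_0_compat; lra|].
    replace (2 * Bd * (2 * (Cmod h / rho)) * (rho / (4 * Bd))) with (Cmod h) by (field; lra).
    unfold Rdiv in *. lra.
Qed.

Lemma zeta_line_cont zeta : is_Riemann_zeta zeta -> ccont (fun t => zeta (1 / 2, t)).
Proof.
  intros [_ Ha].
  assert (K : forall t0 eps, 0 < eps -> exists d, 0 < d /\ forall t, Rabs (t - t0) < d ->
    Cmod (zeta (1 / 2, t) - zeta (1 / 2, t0)) <= eps).
  { intros t0 eps Heps. destruct (Ha (1 / 2, t0)) as [c [r Hc]].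
    { intros E. apply (f_equal fst) in E. simpl in E. lra. }
    destruct (powerseries_continuous c zeta (1 / 2, t0) r Hc eps Heps) as [d [Hd H]].
    exists d. split; auto. intros t Ht.
    specialize (H (Ci * RtoC (t - t0))%C). rewrite Cmod_Ci_R in H. specialize (H Ht).
    replace ((1 / 2)%R, t) with (((1 / 2)%R, t0) + Ci * RtoC (t - t0))%C; auto.
    apply injective_projections; simpl; ring. }
  assert (G : forall P : C -> R, (forall z, Rabs (P z) <= Cmod z) -> (forall u v, P (u - v)%C = P u - P v) ->
    cont (fun t => P (zeta (1 / 2, t)))).
  { intros P P1 P2 t0. apply filterlim_locally. intros eps. pose proof (cond_pos eps) as Pe.
    destruct (K t0 (eps / 2) ltac:(lra)) as [d [Hd H]].
    exists (mkposreal d Hd). intros t Ht. change (Rabs (t - t0) < d) in Ht.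
    change (Rabs (P (zeta (1 / 2, t)) - P (zeta (1 / 2, t0))) < eps).
    rewrite <- P2. eapply Rle_lt_trans; [apply P1|]. eapply Rle_lt_trans; [exact (H t Ht)|lra]. }
  split.
  - apply (G fst); [apply re_le_Cmod|reflexivity].
  - apply (G snd); [apply Im_le_Cmod_abs|reflexivity].
Qed.

Lemma cont_scale c : cont (fun t => c * t).
Proof. apply cont_mult; auto using cont_const, cont_id. Qed.

Lemma ccont_zeta_line zeta c : is_Riemann_zeta zeta -> ccont (fun t => zeta (1 / 2, c * t)).
Proof.
  intros H. apply (ccont_comp (fun t => c * t) (fun t => zeta (1 / 2, t))); auto using cont_scale, zeta_line_cont.
Qed.

Lemma cont_Cmod2 f : ccont f -> cont (fun t => Cmod (f t) ^ 2).
Proof.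
  intros H. apply cont_Cmod in H. simpl. apply cont_mult; auto. apply cont_mult; auto using cont_const.
Qed.

(* The height is T = v^40; the part below v^24 = T^(3/5) is negligible. *)
Definition main_length (B v : R) (M : nat) := B * v ^ 40 <= INR M <= B * v ^ 40 + 1.

(** [sqrt M / t] is at most [2 B v^20 / v^24]: the cutoff at [v^24] is what produces the saving
    [v^(-4)]. The bound [|c| <= B] keeps [|c t|] below the length [M]. *)
Lemma zeta_dpoly_close zeta B c v M t : is_Riemann_zeta zeta -> 1 <= B -> 1 <= v -> 1 <= Rabs c <= B ->
  main_length B v M -> v ^ 24 <= t <= v ^ 40 ->
  Cmod (zeta (1 / 2, c * t) - dpoly M (c * t)) <= 604 * B / v ^ 4.
Proof.
  intros Hz HB Hv Hc HM Ht. unfold main_length in HM.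
  assert (P : forall n, 1 <= v ^ n) by (intros; apply pow_R1_Rle; auto).
  pose proof (P 24%nat) as P24. pose proof (P 4%nat) as P4.
  assert (Ec : Rabs (c * t) = Rabs c * t) by (rewrite Rabs_mult, (Rabs_pos_eq t); lra).
  assert (L1 : v ^ 24 <= Rabs (c * t)) by (rewrite Ec; nra).
  eapply Rle_trans; [apply zeta_approx; auto; [lra|rewrite Ec; nra]|].
  assert (S1 : sqrt (INR M) <= 2 * B * v ^ 20).
  { apply Rsqr_incr_0_var; [|nra]. unfold Rsqr.
    rewrite sqrt_sqrt by apply pos_INR.
    replace (2 * B * v ^ 20 * (2 * B * v ^ 20)) with (2 * B * v ^ 40 * (2 * B)) by (simpl; ring). nra. }
  apply Rle_trans with (302 * (2 * B * v ^ 20) / v ^ 24).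
  - unfold Rdiv. apply Rmult_le_compat; [pose proof (sqrt_pos (INR M)); lra|apply Rlt_le, Rinv_0_lt_compat; lra|lra|].
    apply Rinv_le_contravar; lra.
  - apply Req_le. replace (v ^ 24) with (v ^ 20 * v ^ 4) by (simpl; ring). field. lra.
Qed.

Lemma RInt_weaken f a b c : cont f -> a <= b <= c -> (forall t, 0 <= f t) -> RInt f b c <= RInt f a c.
Proof.
  intros F H P. rewrite <- (RInt_ChaslesR f a b c) by auto.
  pose proof (RInt_ge0R f a b F ltac:(lra) (fun t _ => P t)). lra.
Qed.

Lemma RInt_constR c a b : RInt (fun _ => c) a b = c * (b - a).
Proof. rewrite (RInt_const (V := R_CompleteNormedModule)). unfold scal; simpl. unfold mult; simpl. ring. Qed.

Lemma dpoly_diff_sign M N c t :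
  Cmod (dpoly M (c * t) - dpoly N (c * t)) = Cmod (dpoly M (Rabs c * t) - dpoly N (Rabs c * t)).
Proof.
  unfold Rabs. destruct Rcase_abs; auto.
  rewrite <- Ropp_mult_distr_l, <- !dpoly_conj.
  rewrite <- Cmod_conj. f_equal. unfold Cconj. apply injective_projections; simpl; ring.
Qed.

Lemma dpoly_diff_ms B c v M N : 1 <= B -> 1 <= v -> 1 <= Rabs c -> main_length B v M -> (N <= M)%nat ->
  RInt (fun t => Cmod (dpoly M (c * t) - dpoly N (c * t)) ^ 2) (v ^ 24) (v ^ 40) <=
  64 * (1 + 4 * (B * B)) * v ^ 40 * (harmonic M - harmonic N).
Proof.
  intros HB Hv Hc HM HN. unfold main_length in HM.
  assert (P : forall n, 1 <= v ^ n) by (intros; apply pow_R1_Rle; auto).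
  pose proof (P 24%nat) as P24.
  assert (V24 : v ^ 24 <= v ^ 40) by (apply Rle_pow; [auto|lia]).
  assert (HM1 : (1 <= M)%nat) by (destruct M; [simpl in HM; nra|lia]).
  assert (C0 : cont (fun t => Cmod (dpoly M (Rabs c * t) - dpoly N (Rabs c * t)) ^ 2)).
  { apply cont_Cmod2, ccont_minus; apply ccont_dpoly. }
  rewrite (RInt_ext _ (fun t => Cmod (dpoly M (Rabs c * t) - dpoly N (Rabs c * t)) ^ 2)).
  2: { intros t _. rewrite dpoly_diff_sign. reflexivity. }
  eapply Rle_trans; [apply (RInt_weaken _ 0); auto; [lra|intros; apply pow2_ge_0]|].
  eapply Rle_trans; [apply dpoly_mean_square; auto; lra|].
  assert (H0 : 0 <= harmonic M - harmonic N).
  { unfold harmonic. pose proof (rsum_incr (fun i => / INR i) N M) as I.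
    assert (forall i, 0 <= / INR i).
    { intros [|i]; [simpl; rewrite Rinv_0; lra|apply Rlt_le, Rinv_0_lt_compat, INR_S_pos]. }
    specialize (I H HN). lra. }
  apply Rmult_le_compat_r; auto. rewrite Rmult_assoc. apply Rmult_le_compat_l; [lra|].
  rewrite Rmult_plus_distr_r, Rmult_1_l. apply Rplus_le_compat_l.
  apply (Rmult_le_reg_r (v ^ 40)); [lra|].
  replace (INR M * INR M / v ^ 40 * v ^ 40) with (INR M * INR M) by (field; lra).
  assert (INR M <= 2 * B * v ^ 40) by nra.
  replace (4 * (B * B) * v ^ 40 * v ^ 40) with ((2 * B * v ^ 40) * (2 * B * v ^ 40)) by ring.
  apply Rmult_le_compat; lra.
Qed.

Lemma harmonic_main B v M : 1 <= B -> 1 <= v -> main_length B v M ->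
  harmonic M <= (2 + ln (2 * B)) * (1 + ln (v ^ 40)).
Proof.
  intros HB Hv HM. unfold main_length in HM.
  assert (P40 : 1 <= v ^ 40) by (apply pow_R1_Rle; auto).
  assert (HM1 : (1 <= M)%nat) by (destruct M; [simpl in HM; nra|lia]).
  eapply Rle_trans; [apply harmonic_upper; auto|].
  assert (L : ln (INR M) <= ln (2 * B) + ln (v ^ 40)).
  { rewrite <- ln_mult by lra. apply ln_le; [apply lt_0_INR; auto|nra]. }
  assert (0 <= ln (2 * B)) by (apply ln_nonneg; lra).
  assert (0 <= ln (v ^ 40)) by (apply ln_nonneg; lra). nra.
Qed.

Lemma dpoly_ms B : 1 <= B -> exists C, 0 < C /\ forall c v M, 1 <= v -> 1 <= Rabs c -> main_length B v M ->
  RInt (fun t => Cmod (dpoly M (c * t)) ^ 2) (v ^ 24) (v ^ 40) <= C * (v ^ 40 * (1 + ln (v ^ 40))).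
Proof.
  intros HB. assert (L0 : 0 <= ln (2 * B)) by (apply ln_nonneg; lra).
  exists (64 * (1 + 4 * (B * B)) * (2 + ln (2 * B))). split.
  { apply Rmult_lt_0_compat; nra. }
  intros c v M Hv Hc HM.
  rewrite (RInt_ext _ (fun t => Cmod (dpoly M (c * t) - dpoly 0 (c * t)) ^ 2)).
  2: { intros t _. do 2 f_equal. unfold dpoly. simpl (csum _ 0). ring. }
  eapply Rle_trans; [apply (dpoly_diff_ms B); auto; lia|].
  change (harmonic 0) with 0. rewrite Rminus_0_r.
  pose proof (harmonic_main B v M HB Hv HM) as H.
  replace (64 * (1 + 4 * (B * B)) * (2 + ln (2 * B)) * (v ^ 40 * (1 + ln (v ^ 40)))) with
    (64 * (1 + 4 * (B * B)) * v ^ 40 * ((2 + ln (2 * B)) * (1 + ln (v ^ 40)))) by ring.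
  apply Rmult_le_compat_l; nra.
Qed.

Lemma sqr_triangle (x y z : R) : 0 <= x -> x <= y + z -> 0 <= y -> 0 <= z -> x ^ 2 <= 2 * y ^ 2 + 2 * z ^ 2.
Proof. intros. simpl. pose proof (Rle_0_sqr (y - z)) as S. unfold Rsqr in S. nra. Qed.

Lemma zeta_diff_ms zeta B c v M N : is_Riemann_zeta zeta -> 1 <= B -> 1 <= v -> 1 <= Rabs c <= B ->
  main_length B v M ->
  RInt (fun t => Cmod (zeta (1 / 2, c * t) - dpoly N (c * t)) ^ 2) (v ^ 24) (v ^ 40) <=
  2 * (604 * B) ^ 2 * v ^ 40 + 2 * RInt (fun t => Cmod (dpoly M (c * t) - dpoly N (c * t)) ^ 2) (v ^ 24) (v ^ 40).
Proof.
  intros Hz HB Hv Hc HM.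
  assert (P : forall n, 1 <= v ^ n) by (intros; apply pow_R1_Rle; auto).
  pose proof (P 24%nat) as P24. pose proof (P 4%nat) as P4.
  assert (V24 : v ^ 24 <= v ^ 40) by (apply Rle_pow; [auto|lia]).
  assert (C0 : cont (fun t => Cmod (dpoly M (c * t) - dpoly N (c * t)) ^ 2)).
  { apply cont_Cmod2, ccont_minus; apply ccont_dpoly. }
  assert (C1 : cont (fun t => Cmod (zeta (1 / 2, c * t) - dpoly N (c * t)) ^ 2)).
  { apply cont_Cmod2, ccont_minus; [apply ccont_zeta_line; auto|apply ccont_dpoly]. }
  apply Rle_trans with (RInt (fun t => 2 * (604 * B) ^ 2 + 2 * (Cmod (dpoly M (c * t) - dpoly N (c * t)) ^ 2)) (v ^ 24) (v ^ 40)).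
  - apply RInt_leR; auto.
    + apply cont_plus; [apply cont_const|]. apply cont_mult; auto using cont_const.
    + intros t Ht. apply sqr_triangle; try apply Cmod_ge_0; [|lra].
      replace (zeta ((1 / 2)%R, (c * t)%R) - dpoly N (c * t))%C with
        ((zeta ((1 / 2)%R, (c * t)%R) - dpoly M (c * t)) + (dpoly M (c * t) - dpoly N (c * t)))%C by ring.
      eapply Rle_trans; [apply Cmod_triangle|]. apply Rplus_le_compat_r.
      eapply Rle_trans; [apply (zeta_dpoly_close zeta B c v M t); auto|].
      rewrite <- (Rmult_1_r (604 * B)) at 2. apply Rmult_le_compat_l; [lra|].
      rewrite <- Rinv_1. apply Rinv_le_contravar; lra.
  - rewrite RInt_plusR, RInt_constR, RInt_scalR; auto using cont_const.
    + apply Rplus_le_compat_r. apply Rmult_le_compat_l; [|lra].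
      pose proof (pow2_ge_0 (604 * B)). lra.
    + apply cont_mult; auto using cont_const.
Qed.

Lemma zeta_ms zeta B : is_Riemann_zeta zeta -> 1 <= B ->
  exists C, 0 < C /\ forall c v, 1 <= v -> 1 <= Rabs c <= B ->
  RInt (fun t => Cmod (zeta (1 / 2, c * t)) ^ 2) (v ^ 24) (v ^ 40) <= C * (v ^ 40 * (1 + ln (v ^ 40))).
Proof.
  intros Hz HB. destruct (dpoly_ms B HB) as [C [HC H]].
  exists (2 * (604 * B) ^ 2 + 2 * C). split; [pose proof (pow2_ge_0 (604 * B)); lra|].
  intros c v Hv Hc.
  assert (P40 : 1 <= v ^ 40) by (apply pow_R1_Rle; auto).
  destruct (nceil_ex (B * v ^ 40)) as [M HM]; [nra|].
  pose proof (zeta_diff_ms zeta B c v M 0 Hz HB Hv Hc HM) as D.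
  assert (E0 : forall z t, Cmod (z - dpoly 0 t) = Cmod z) by (intros; unfold dpoly; simpl; f_equal; ring).
  rewrite (RInt_ext _ (fun t => Cmod (zeta ((1 / 2)%R, (c * t)%R) - dpoly 0 (c * t)) ^ 2)).
  2: { intros t _. rewrite E0. reflexivity. }
  eapply Rle_trans; [exact D|].
  rewrite (RInt_ext (fun t => Cmod (dpoly M (c * t) - dpoly 0 (c * t)) ^ 2) (fun t => Cmod (dpoly M (c * t)) ^ 2)).
  2: { intros t _. rewrite E0. reflexivity. }
  specialize (H c v M Hv (proj1 Hc) HM).
  assert (L : 0 <= ln (v ^ 40)) by (apply ln_nonneg; auto).
  assert (2 * (604 * B) ^ 2 * v ^ 40 <= 2 * (604 * B) ^ 2 * (v ^ 40 * (1 + ln (v ^ 40)))).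
  { apply Rmult_le_compat_l; [pose proof (pow2_ge_0 (604 * B)); lra|]. nra. }
  lra.
Qed.

(** The logarithm disappears because the harmonic sum from [N >= rho T] to [M] is bounded in terms
    of [rho]. *)
Lemma zeta_diff_ms_short zeta B rho : is_Riemann_zeta zeta -> 1 <= B -> 0 < rho -> exists C, 0 < C /\
  forall c v N, 1 <= v -> 1 <= Rabs c <= B -> (1 <= N)%nat -> rho * v ^ 40 <= INR N <= v ^ 40 ->
  RInt (fun t => Cmod (zeta (1 / 2, c * t) - dpoly N (c * t)) ^ 2) (v ^ 24) (v ^ 40) <= C * v ^ 40.
Proof.
  intros Hz HB Hrho.
  set (L := Rabs (ln (2 * B / rho))). assert (L0 : 0 <= L) by apply Rabs_pos.
  set (D := 64 * (1 + 4 * (B * B))). assert (D0 : 0 < D) by (unfold D; nra).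
  exists (2 * (604 * B) ^ 2 + 2 * (D * L) + 1). split.
  { pose proof (pow2_ge_0 (604 * B)). nra. }
  intros c v N Hv Hc HN HN2.
  assert (P40 : 1 <= v ^ 40) by (apply pow_R1_Rle; auto).
  destruct (nceil_ex (B * v ^ 40)) as [M HM]; [nra|].
  eapply Rle_trans; [apply (zeta_diff_ms zeta B c v M N); auto|].
  assert (HNM : (N <= M)%nat) by (apply INR_le; nra).
  pose proof (dpoly_diff_ms B c v M N HB Hv (proj1 Hc) HM HNM) as E. fold D in E.
  assert (H : harmonic M - harmonic N <= L).
  { eapply Rle_trans; [apply harmonic_diff; lia|].
    pose proof (INR_ge1 N HN) as PN. assert (1 <= INR M) by (apply INR_ge1; lia).
    eapply Rle_trans; [|apply Rle_abs].
    rewrite <- ln_div by lra. apply ln_le; [apply Rdiv_lt_0_compat; lra|].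
    apply (Rmult_le_reg_r (INR N)); [lra|].
    replace (INR M / INR N * INR N) with (INR M) by (field; lra).
    apply Rle_trans with (2 * B / rho * (rho * v ^ 40)).
    - replace (2 * B / rho * (rho * v ^ 40)) with (2 * B * v ^ 40) by (field; lra). nra.
    - apply Rmult_le_compat_l; [apply Rlt_le, Rdiv_lt_0_compat; lra|lra]. }
  assert (D * v ^ 40 * (harmonic M - harmonic N) <= D * v ^ 40 * L) by (apply Rmult_le_compat_l; nra).
  nra.
Qed.

Lemma ln_pow40_large K : exists v0, 1 <= v0 /\ forall v, v0 <= v -> K <= ln (v ^ 40).
Proof.
  exists (Rmax 1 (exp K)). split; [apply Rmax_l|]. intros v Hv.
  pose proof (Rmax_l 1 (exp K)). pose proof (Rmax_r 1 (exp K)).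
  assert (L : K <= ln v) by (rewrite <- (ln_exp K); apply ln_le; [apply exp_pos|lra]).
  assert (0 <= ln v) by (apply ln_nonneg; lra).
  rewrite ln_pow by lra. replace (INR 40) with 40 by (simpl; ring). lra.
Qed.

(** * Twisted second moments of zeta at a fixed frequency *)

Lemma amgm_eta (x y eta : R) : 0 < eta -> x * y <= / eta * x ^ 2 + eta * y ^ 2.
Proof.
  intros H. pose proof (Rinv_0_lt_compat _ H).
  assert (E : / eta * (x - eta * y / 2) ^ 2 = / eta * x ^ 2 - x * y + eta * y ^ 2 / 4) by (field; lra).
  pose proof (pow2_ge_0 (x - eta * y / 2)).
  nra.
Qed.

(** This is |zeta(1/2 + iAt)|^2, left as a product so that no reflection principle has to be
    invoked. *)
Definition zz (zeta : C -> C) (A t : R) : C := (zeta (1 / 2, (A * t))%R * zeta (1 / 2, (- A * t))%R)%C.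

Lemma ccont_zz zeta A : is_Riemann_zeta zeta -> ccont (zz zeta A).
Proof. intros H. apply ccont_mult; apply ccont_zeta_line; auto. Qed.

(** The mean square of zeta is [O(T log T)] and that of the error [O(T)]. The cross terms, split by
    [amgm_eta] with a small [eta], are therefore [o(T log T)], uniformly in [theta]. *)
Lemma zz_replace zeta A rho eps : is_Riemann_zeta zeta -> 1 <= A -> 0 < rho -> 0 < eps ->
  exists v0, 1 <= v0 /\ forall v N theta, v0 <= v -> (1 <= N)%nat -> rho * v ^ 40 <= INR N <= v ^ 40 ->
  Cmod (CInt (fun t => zz zeta A t * cis (theta * t))%C (v ^ 24) (v ^ 40) -
    CInt (fun t => dpoly N (A * t) * dpoly N (- (A * t)) * cis (theta * t))%C (v ^ 24) (v ^ 40)) <=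
  eps * (v ^ 40 * ln (v ^ 40)).
Proof.
  intros Hz HA Hrho Heps.
  destruct (zeta_ms zeta A Hz HA) as [C1 [HC1 H1]].
  destruct (zeta_diff_ms_short zeta A rho Hz HA Hrho) as [C2 [HC2 H2]].
  set (eta := Rmin 1 (eps / (8 * C1))).
  assert (He : 0 < eta) by (apply Rmin_pos; [lra|apply Rdiv_lt_0_compat; lra]).
  assert (He2 : eta * (8 * C1) <= eps).
  { apply Rle_trans with (eps / (8 * C1) * (8 * C1)); [apply Rmult_le_compat_r; [lra|apply Rmin_r]|].
    apply Req_le. field. lra. }
  assert (Pe : 0 < / eta) by (apply Rinv_0_lt_compat; auto).
  set (C3 := 2 * (/ eta + 1) * C2).
  destruct (ln_pow40_large (Rmax 1 (2 * C3 / eps))) as [v0 [Hv0 Hl]].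
  exists v0. split; auto. intros v N theta Hv HN HNr.
  assert (Hv1 : 1 <= v) by lra. specialize (Hl v Hv).
  assert (l1 : 1 <= ln (v ^ 40)) by (eapply Rle_trans; [apply Rmax_l|exact Hl]).
  assert (l2 : 2 * C3 / eps <= ln (v ^ 40)) by (eapply Rle_trans; [apply Rmax_r|exact Hl]).
  set (l := ln (v ^ 40)) in *.
  assert (P40 : 1 <= v ^ 40) by (apply pow_R1_Rle; auto).
  assert (V24 : v ^ 24 <= v ^ 40) by (apply Rle_pow; [auto|lia]).
  assert (a1 : 1 <= Rabs A <= A) by (rewrite Rabs_pos_eq; lra).
  assert (a2 : 1 <= Rabs (- A) <= A) by (rewrite Rabs_Ropp; auto).
  set (z1 := fun t => zeta ((1 / 2)%R, (A * t)%R)). set (z2 := fun t => zeta ((1 / 2)%R, (- A * t)%R)).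
  set (d1 := fun t => dpoly N (A * t)). set (d2 := fun t => dpoly N (- A * t)).
  assert (Cz1 : ccont z1) by (apply ccont_zeta_line; auto).
  assert (Cz2 : ccont z2) by (apply ccont_zeta_line; auto).
  assert (Cd1 : ccont d1) by apply ccont_dpoly.
  assert (Cd2 : ccont d2) by apply ccont_dpoly.
  rewrite (CInt_ext (fun t => dpoly N (A * t) * dpoly N (- (A * t)) * cis (theta * t))%C
     (fun t => d1 t * d2 t * cis (theta * t))%C).
  2: { intros t. unfold d1, d2. do 3 f_equal. ring. }
  assert (Cc := ccont_cis_lin theta).
  assert (Cp : ccont (fun t => z1 t * z2 t * cis (theta * t))%C).
  { apply (ccont_mult (fun t => z1 t * z2 t)%C (fun t => cis (theta * t))); [apply (ccont_mult z1 z2)|]; auto. }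
  assert (Cq : ccont (fun t => d1 t * d2 t * cis (theta * t))%C).
  { apply (ccont_mult (fun t => d1 t * d2 t)%C (fun t => cis (theta * t))); [apply (ccont_mult d1 d2)|]; auto. }
  change (fun t => zz zeta A t * cis (theta * t))%C with (fun t => z1 t * z2 t * cis (theta * t))%C.
  rewrite <- CInt_minus by auto.
  set (x := fun t => Cmod (z1 t - d1 t) ^ 2). set (y := fun t => Cmod (z2 t - d2 t) ^ 2).
  set (p := fun t => Cmod (z1 t) ^ 2). set (q := fun t => Cmod (z2 t) ^ 2).
  assert (Cx : cont x) by (apply cont_Cmod2, ccont_minus; auto).
  assert (Cy : cont y) by (apply cont_Cmod2, ccont_minus; auto).
  assert (Cpp : cont p) by (apply cont_Cmod2; auto).
  assert (Cqq : cont q) by (apply cont_Cmod2; auto).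
  eapply Rle_trans.
  { apply (Cmod_CInt_le _ (fun t => (/ eta + 1) * (x t + y t) + eta * (p t + q t))); auto.
    - apply ccont_minus; auto.
    - apply cont_plus; apply cont_mult; auto using cont_const, cont_plus.
    - intros t _.
      replace (z1 t * z2 t * cis (theta * t) - d1 t * d2 t * cis (theta * t))%C with
        (((z1 t - d1 t) * z2 t + (z2 t - d2 t) * z1 t - (z1 t - d1 t) * (z2 t - d2 t)) * cis (theta * t))%C by ring.
      rewrite Cmod_mult, Cmod_cis, Rmult_1_r.
      eapply Rle_trans; [apply Cmod_minus_le|].
      eapply Rle_trans; [apply Rplus_le_compat_r, Cmod_triangle|].
      rewrite !Cmod_mult.
      pose proof (amgm_eta (Cmod (z1 t - d1 t)) (Cmod (z2 t)) eta He) as I1.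
      pose proof (amgm_eta (Cmod (z2 t - d2 t)) (Cmod (z1 t)) eta He) as I2.
      pose proof (amgm_eta (Cmod (z1 t - d1 t)) (Cmod (z2 t - d2 t)) 1 Rlt_0_1) as I3.
      rewrite Rinv_1 in I3. unfold x, y, p, q in *. lra. }
  rewrite RInt_plusR, !RInt_scalR, !RInt_plusR
    by (auto using cont_plus; apply cont_mult; auto using cont_const, cont_plus).
  pose proof (H1 A v Hv1 a1) as B1. pose proof (H1 (- A) v Hv1 a2) as B2.
  pose proof (H2 A v N Hv1 a1 HN HNr) as B3. pose proof (H2 (- A) v N Hv1 a2 HN HNr) as B4.
  fold l in B1, B2.
  change (RInt x (v ^ 24) (v ^ 40) <= C2 * v ^ 40) in B3.
  change (RInt y (v ^ 24) (v ^ 40) <= C2 * v ^ 40) in B4.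
  change (RInt p (v ^ 24) (v ^ 40) <= C1 * (v ^ 40 * (1 + l))) in B1.
  change (RInt q (v ^ 24) (v ^ 40) <= C1 * (v ^ 40 * (1 + l))) in B2.
  assert (D1 : (/ eta + 1) * (RInt x (v ^ 24) (v ^ 40) + RInt y (v ^ 24) (v ^ 40)) <= C3 * v ^ 40).
  { apply Rle_trans with ((/ eta + 1) * (C2 * v ^ 40 + C2 * v ^ 40)).
    - apply Rmult_le_compat_l; lra.
    - apply Req_le. unfold C3. ring. }
  assert (D2 : eta * (RInt p (v ^ 24) (v ^ 40) + RInt q (v ^ 24) (v ^ 40)) <= eps / 2 * (v ^ 40 * l)).
  { apply Rle_trans with (eta * (2 * (C1 * (v ^ 40 * (1 + l))))).
    - apply Rmult_le_compat_l; lra.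
    - apply Rle_trans with (eta * (2 * (C1 * (v ^ 40 * (2 * l))))).
      + apply Rmult_le_compat_l; [lra|]. apply Rmult_le_compat_l; [lra|]. apply Rmult_le_compat_l; [lra|].
        apply Rmult_le_compat_l; lra.
      + replace (eta * (2 * (C1 * (v ^ 40 * (2 * l))))) with (eta * (8 * C1) / 2 * (v ^ 40 * l)) by field.
        apply Rmult_le_compat_r; [nra|lra]. }
  assert (D3 : C3 * v ^ 40 <= eps / 2 * (v ^ 40 * l)).
  { assert (C3 <= eps / 2 * l).
    { apply Rle_trans with (eps / 2 * (2 * C3 / eps)); [apply Req_le; field; lra|].
      apply Rmult_le_compat_l; lra. }
    replace (eps / 2 * (v ^ 40 * l)) with (eps / 2 * l * v ^ 40) by ring. apply Rmult_le_compat_r; lra. }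
  lra.
Qed.

Lemma short_length rho : 0 < rho <= 1 -> forall v, 1 <= v -> 2 / rho <= v ->
  exists N, (1 <= N)%nat /\ rho / 2 * v ^ 40 <= INR N <= rho * v ^ 40.
Proof.
  intros Hr v Hv Hv2.
  assert (V : v <= v ^ 40) by (rewrite <- (pow_1 v) at 1; apply Rle_pow; [auto|lia]).
  assert (R2 : 2 <= rho * v ^ 40).
  { apply Rle_trans with (rho * (2 / rho)); [apply Req_le; field; lra|]. apply Rmult_le_compat_l; lra. }
  destruct (nfloor_ex (rho * v ^ 40)) as [N [N1 N2]]; [lra|].
  exists N. split; [destruct N; [simpl in N2; lra|lia]|]. lra.
Qed.

Lemma harmonic_short N v : (1 <= N)%nat -> 1 <= v -> INR N <= v ^ 40 -> harmonic N <= 1 + ln (v ^ 40).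
Proof.
  intros HN Hv H. eapply Rle_trans; [apply harmonic_upper; auto|].
  apply Rplus_le_compat_l, ln_le; auto. apply lt_0_INR; auto.
Qed.

(** The order of the choices matters: [q] makes near coincidences rare, [delta] depends on [q]
    through irrationality, [rho] is small enough to absorb [1 / delta], and only then does [v]
    grow. *)
Lemma twisted_irrational zeta A alpha eps : is_Riemann_zeta zeta -> 1 <= A -> 1 <= alpha -> 0 < eps ->
  (forall k m : nat, (1 <= k)%nat -> INR k * alpha <> INR m) ->
  exists v0, 1 <= v0 /\ forall v, v0 <= v ->
  Cmod (CInt (fun t => zz zeta A t * cis (A * ln alpha * t))%C (v ^ 24) (v ^ 40)) <= eps * (v ^ 40 * ln (v ^ 40)).
Proof.
  intros Hz HA Ha Heps Hirr.
  (* 512 is 64 times 8, which gives the contribution [64 / q] of the near coincidences a share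
     [eps / 8]. *)
  destruct (nceil_ex (512 / eps)) as [q0 [Hq0 _]]; [apply Rlt_le, Rdiv_lt_0_compat; lra|].
  set (q := S q0). assert (Hq : 512 / eps <= INR q) by (unfold q; rewrite S_INR; lra).
  assert (Pq : 0 < INR q) by (apply lt_0_INR; unfold q; lia).
  assert (Hq8 : 64 / INR q <= eps / 8).
  { apply (Rmult_le_reg_r (INR q)); auto. replace (64 / INR q * INR q) with 64 by (field; lra).
    apply Rle_trans with (eps / 8 * (512 / eps)); [apply Req_le; field; lra|]. apply Rmult_le_compat_l; lra. }
  destruct (multiples_dist alpha q) as [d [Hd Hdist]].
  { intros k z Hk E. 
    destruct (Z.lt_ge_cases z 0) as [L|L].
    - apply IZR_lt in L. pose proof (lt_0_INR k Hk). nra.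
    - apply (Hirr k (Z.to_nat z) Hk). rewrite E, INR_IZR_INZ, Z2Nat.id by auto. reflexivity. }
  set (delta := Rmin 1 (d / 2)).
  assert (Hdel : 0 < delta <= 1) by (split; [apply Rmin_pos; lra|apply Rmin_l]).
  assert (Hdel2 : 2 * delta <= d) by (pose proof (Rmin_r 1 (d / 2)); unfold delta; lra).
  set (W := 8 + 8 * sqrt alpha + 256 / delta).
  assert (PW : 8 <= W).
  { unfold W. pose proof (sqrt_pos alpha). assert (0 < 256 / delta) by (apply Rdiv_lt_0_compat; lra). lra. }
  set (rho := Rmin 1 (eps / (8 * W))).
  assert (Hrho : 0 < rho <= 1) by (split; [apply Rmin_pos; [lra|apply Rdiv_lt_0_compat; lra]|apply Rmin_l]).
  assert (HrW : rho * W <= eps / 8).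
  { apply Rle_trans with (eps / (8 * W) * W); [apply Rmult_le_compat_r; [lra|apply Rmin_r]|]. apply Req_le; field; lra. }
  destruct (zz_replace zeta A (rho / 2) (eps / 2) Hz HA ltac:(lra) ltac:(lra)) as [v1 [Hv1 Hrep]].
  destruct (ln_pow40_large 1) as [v2 [Hv2 Hl]].
  assert (P2r : 0 < 2 / rho) by (apply Rdiv_lt_0_compat; lra).
  exists (v1 + v2 + 2 / rho). split; [lra|]. intros v Hv.
  assert (V1 : 1 <= v) by lra.
  assert (P40 : 1 <= v ^ 40) by (apply pow_R1_Rle; auto).
  assert (V24 : v ^ 24 <= v ^ 40) by (apply Rle_pow; [auto|lia]).
  assert (P24 : 1 <= v ^ 24) by (apply pow_R1_Rle; auto).
  specialize (Hl v ltac:(lra)).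
  destruct (short_length rho Hrho v V1 ltac:(lra)) as [N [HN1 HN2]].
  assert (HN3 : INR N <= v ^ 40) by nra.
  specialize (Hrep v N (A * ln alpha) ltac:(lra) HN1 ltac:(lra)).
  pose proof (pair_int_irrational A alpha delta (v ^ 24) (v ^ 40) q N HA Ha V24 Hdel ltac:(unfold q; lia) HN1 Hirr) as Hp.
  assert (Hp' := Hp (fun k z Hk => Rle_trans _ _ _ Hdel2 (Hdist k z Hk))). clear Hp.
  pose proof (harmonic_short N v HN1 V1 HN3) as HH. pose proof (harmonic_ge0 N) as HH0.
  set (l := ln (v ^ 40)) in *.
  eapply Rle_trans; [apply (Cmod_le_via _ (CInt (fun t => dpoly N (A * t) * dpoly N (- (A * t)) * cis (A * ln alpha * t))%C (v ^ 24) (v ^ 40)))|].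
  assert (F : 8 * INR N + 8 * sqrt alpha * (INR N * harmonic N) + 256 * (INR N / delta) * harmonic N +
    64 * (v ^ 40 - v ^ 24) / INR q * harmonic N <= eps / 2 * (v ^ 40 * l)).
  { set (H := 1 + l) in *. assert (H1 : 1 <= H) by (unfold H; lra).
    pose proof (pos_INR N) as N0. pose proof (sqrt_pos alpha) as Sa.
    assert (Pd : 0 < / delta) by (apply Rinv_0_lt_compat; lra).
    assert (Pqi : 0 < / INR q) by (apply Rinv_0_lt_compat; lra).
    assert (T1 : 8 * INR N + 8 * sqrt alpha * (INR N * harmonic N) + 256 * (INR N / delta) * harmonic N <=
       W * (INR N * H)).
    { assert (INR N * harmonic N <= INR N * H) by (apply Rmult_le_compat_l; lra).
      assert (INR N * 1 <= INR N * H) by (apply Rmult_le_compat_l; lra).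
      unfold W. replace (256 * (INR N / delta) * harmonic N) with (256 / delta * (INR N * harmonic N)) by (unfold Rdiv; ring).
      assert (0 < 256 / delta) by (apply Rdiv_lt_0_compat; lra). nra. }
    assert (T2 : W * (INR N * H) <= eps / 8 * (v ^ 40 * H)).
    { apply Rle_trans with (W * (rho * v ^ 40 * H)).
      - apply Rmult_le_compat_l; [lra|]. apply Rmult_le_compat_r; lra.
      - replace (W * (rho * v ^ 40 * H)) with (rho * W * (v ^ 40 * H)) by ring. apply Rmult_le_compat_r; [nra|lra]. }
    assert (T3 : 64 * (v ^ 40 - v ^ 24) / INR q * harmonic N <= eps / 8 * (v ^ 40 * H)).
    { replace (64 * (v ^ 40 - v ^ 24) / INR q * harmonic N) with (64 / INR q * ((v ^ 40 - v ^ 24) * harmonic N)) by (unfold Rdiv; ring).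
      apply Rmult_le_compat; auto.
      - apply Rlt_le, Rdiv_lt_0_compat; lra.
      - apply Rmult_le_pos; lra.
      - apply Rmult_le_compat; lra. }
    assert (v ^ 40 * H <= v ^ 40 * (2 * l)) by (apply Rmult_le_compat_l; unfold H; lra). nra. }
  lra.
Qed.

(** The diagonal yields [harmonic (N / alpha)]. As [N] is a fixed proportion of [T], this is [log T]
    up to a constant [K], so shortening the polynomials does not affect the order [T log T]. *)
Lemma twisted_integer zeta A (alpha : nat) eps : is_Riemann_zeta zeta -> 1 <= A -> (1 <= alpha)%nat -> 0 < eps ->
  exists v0, 1 <= v0 /\ forall v, v0 <= v ->
  Cmod (CInt (fun t => zz zeta A t * cis (A * ln (INR alpha) * t))%C (v ^ 24) (v ^ 40) -
    RtoC (/ sqrt (INR alpha) * (v ^ 40 * ln (v ^ 40)))) <= eps * (v ^ 40 * ln (v ^ 40)).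
Proof.
  intros Hz HA Ha Heps. pose proof (INR_ge1 alpha Ha) as Pa.
  set (W := 8 + 8 * sqrt (INR alpha)).
  assert (Sa : 1 <= sqrt (INR alpha)) by (rewrite <- sqrt_1; apply sqrt_le_1; lra).
  set (rho := Rmin 1 (eps / (16 * W))).
  assert (PW : 8 <= W) by (unfold W; lra).
  assert (Hrho : 0 < rho <= 1) by (split; [apply Rmin_pos; [lra|apply Rdiv_lt_0_compat; lra]|apply Rmin_l]).
  assert (HrW : rho * W <= eps / 16).
  { apply Rle_trans with (eps / (16 * W) * W); [apply Rmult_le_compat_r; [lra|apply Rmin_r]|]. apply Req_le; field; lra. }
  destruct (zz_replace zeta A (rho / 2) (eps / 2) Hz HA ltac:(lra) ltac:(lra)) as [v1 [Hv1 Hrep]].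
  set (K := 1 + Rabs (ln (rho / (2 * INR alpha)))).
  assert (K0 : 1 <= K) by (unfold K; pose proof (Rabs_pos (ln (rho / (2 * INR alpha)))); lra).
  destruct (ln_pow40_large (Rmax 1 (8 * K / eps))) as [v2 [Hv2 Hl]].
  assert (P2r : 0 < 2 / rho) by (apply Rdiv_lt_0_compat; lra).
  assert (P16e : 0 < 16 / eps) by (apply Rdiv_lt_0_compat; lra).
  exists (v1 + v2 + 2 / rho + 16 / eps). split; [lra|]. intros v Hv.
  assert (V1 : 1 <= v) by lra.
  assert (P40 : 1 <= v ^ 40) by (apply pow_R1_Rle; auto).
  assert (P24 : 1 <= v ^ 24) by (apply pow_R1_Rle; auto).
  assert (V24 : v ^ 24 <= v ^ 40) by (apply Rle_pow; [auto|lia]).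
  specialize (Hl v ltac:(lra)).
  assert (l1 : 1 <= ln (v ^ 40)) by (eapply Rle_trans; [apply Rmax_l|exact Hl]).
  assert (l2 : 8 * K / eps <= ln (v ^ 40)) by (eapply Rle_trans; [apply Rmax_r|exact Hl]).
  destruct (short_length rho Hrho v V1 ltac:(lra)) as [N [HN1 HN2]].
  assert (HN3 : INR N <= v ^ 40) by nra.
  specialize (Hrep v N (A * ln (INR alpha)) ltac:(lra) HN1 ltac:(lra)).
  pose proof (pair_int_diag alpha N A (v ^ 24) (v ^ 40) HA Ha V24) as Hp.
  pose proof (harmonic_short N v HN1 V1 HN3) as HH. pose proof (harmonic_ge0 N) as HH0.
  set (j := (N / alpha)%nat) in *.
  assert (J0 : 0 <= harmonic j) by apply harmonic_ge0.
  assert (J1 : harmonic j <= 1 + ln (v ^ 40)).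
  { destruct (Nat.eq_dec j 0) as [Ej|Ej]; [rewrite Ej; change (harmonic 0) with 0; lra|].
    apply harmonic_short; auto; [lia|].
    apply Rle_trans with (INR N); auto. apply le_INR. unfold j. apply Nat.Div0.div_le_upper_bound; nia. }
  assert (J2 : ln (v ^ 40) - K <= harmonic j).
  { apply Rle_trans with (ln (INR (S j))); [|apply harmonic_lower].
    apply Rle_trans with (ln (rho / (2 * INR alpha) * v ^ 40)).
    - rewrite ln_mult by (try apply Rdiv_lt_0_compat; lra).
      unfold K. pose proof (Rle_abs (- ln (rho / (2 * INR alpha)))) as R1. rewrite Rabs_Ropp in R1. lra.
    - apply ln_le; [apply Rmult_lt_0_compat; [apply Rdiv_lt_0_compat; lra|lra]|].
      apply (Rmult_le_reg_l (INR alpha)); [lra|].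
      replace (INR alpha * (rho / (2 * INR alpha) * v ^ 40)) with (rho / 2 * v ^ 40) by (field; lra).
      apply Rle_trans with (INR N); [lra|]. rewrite <- mult_INR. apply le_INR.
      apply Nat.lt_le_incl. unfold j. apply Nat.mul_succ_div_gt. lia. }
  set (l := ln (v ^ 40)) in *.
  set (I0 := CInt (fun t => zz zeta A t * cis (A * ln (INR alpha) * t))%C (v ^ 24) (v ^ 40)) in *.
  set (I1 := CInt _ (v ^ 24) (v ^ 40)) in Hrep, Hp.
  set (m1 := (v ^ 40 - v ^ 24) * (/ sqrt (INR alpha) * harmonic j)) in *.
  set (m2 := / sqrt (INR alpha) * (v ^ 40 * l)) in *.
  replace (I0 - RtoC m2)%C with ((I0 - I1) + (I1 - RtoC m1) + RtoC (m1 - m2))%C by (rewrite RtoC_minus; ring).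
  eapply Rle_trans; [apply Cmod_triangle|]. eapply Rle_trans; [apply Rplus_le_compat_r, Cmod_triangle|].
  rewrite Cmod_R.
  assert (Si : 0 < / sqrt (INR alpha) <= 1).
  { split; [apply Rinv_0_lt_compat; lra|]. rewrite <- Rinv_1. apply Rinv_le_contravar; lra. }
  assert (E1 : 8 * INR N + 8 * sqrt (INR alpha) * (INR N * harmonic N) <= eps / 8 * (v ^ 40 * l)).
  { apply Rle_trans with (W * (INR N * (2 * l))).
    - unfold W. pose proof (pos_INR N).
      assert (INR N * harmonic N <= INR N * (2 * l)) by (apply Rmult_le_compat_l; lra).
      assert (INR N * 1 <= INR N * (2 * l)) by (apply Rmult_le_compat_l; lra). nra.
    - apply Rle_trans with (W * (rho * v ^ 40 * (2 * l))).
      + apply Rmult_le_compat_l; [lra|]. apply Rmult_le_compat_r; lra.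
      + replace (W * (rho * v ^ 40 * (2 * l))) with (rho * W * 2 * (v ^ 40 * l)) by ring.
        apply Rmult_le_compat_r; [nra|lra]. }
  assert (E2 : Rabs (m1 - m2) <= v ^ 40 * K + v ^ 24 * (2 * l)).
  { replace (m1 - m2) with (/ sqrt (INR alpha) * (v ^ 40 * (harmonic j - l) - v ^ 24 * harmonic j)) by (unfold m1, m2; ring).
    rewrite Rabs_mult, (Rabs_pos_eq (/ sqrt (INR alpha))) by lra.
    rewrite <- (Rmult_1_l (v ^ 40 * K + v ^ 24 * (2 * l))).
    apply Rmult_le_compat; try lra; [apply Rabs_pos|].
    eapply Rle_trans; [apply Rabs_triang|]. rewrite Rabs_Ropp, !Rabs_mult.
    rewrite (Rabs_pos_eq (v ^ 40)), (Rabs_pos_eq (v ^ 24)), (Rabs_pos_eq (harmonic j)) by lra.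
    apply Rplus_le_compat; (apply Rmult_le_compat_l; [lra|]); [|lra]. apply Rabs_le. lra. }
  assert (E3 : v ^ 40 * K <= eps / 8 * (v ^ 40 * l)).
  { replace (eps / 8 * (v ^ 40 * l)) with (v ^ 40 * (eps / 8 * l)) by ring. apply Rmult_le_compat_l; [lra|].
    apply Rle_trans with (eps / 8 * (8 * K / eps)); [apply Req_le; field; lra|]. apply Rmult_le_compat_l; lra. }
  assert (E4 : v ^ 24 * (2 * l) <= eps / 8 * (v ^ 40 * l)).
  { assert (P15 : 1 <= v ^ 15) by (apply pow_R1_Rle; auto).
    replace (v ^ 40) with (v ^ 24 * (v * v ^ 15)) by (simpl; ring).
    replace (eps / 8 * (v ^ 24 * (v * v ^ 15) * l)) with (v ^ 24 * (eps / 8 * (v * v ^ 15) * l)) by ring.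
    apply Rmult_le_compat_l; [lra|]. apply Rmult_le_compat_r; [lra|].
    apply Rle_trans with (eps / 8 * (16 / eps * 1)); [apply Req_le; field; lra|].
    apply Rmult_le_compat_l; [lra|]. apply Rmult_le_compat; lra. }
  nra.
Qed.

(** * Perfect powers and the main term *)

Lemma coprime_divide_pow x y k : Nat.gcd x y = 1%nat -> Nat.divide x (y ^ k) -> x = 1%nat.
Proof.
  intros Hg. induction k as [|k IH]; intros Hd.
  - apply Nat.divide_1_r. exact Hd.
  - apply IH. apply (Nat.gauss x y); auto.
Qed.

Lemma pow_divide x y a : (1 <= a)%nat -> (1 <= x)%nat -> Nat.divide (x ^ a) (y ^ a) -> Nat.divide x y.
Proof.
  intros Ha Hx Hd.
  assert (Hg : Nat.gcd x y <> 0%nat) by (intros E; apply Nat.gcd_eq_0 in E; lia).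
  set (g := Nat.gcd x y) in *.
  destruct (Nat.gcd_divide_l x y) as [x' Ex]. destruct (Nat.gcd_divide_r x y) as [y' Ey]. fold g in Ex, Ey.
  assert (Hc : Nat.gcd x' y' = 1%nat).
  { apply (Nat.mul_cancel_r _ _ g); auto. rewrite <- Nat.gcd_mul_mono_r, <- Ex, <- Ey. fold g. lia. }
  assert (Hx1 : x' = 1%nat).
  { apply (coprime_divide_pow x' y' a); auto.
    apply Nat.divide_trans with (x' ^ a)%nat.
    - destruct a as [|a]; [lia|]. simpl. apply Nat.divide_factor_l.
    - rewrite Ex, Ey, !Nat.pow_mul_l in Hd.
      apply (Nat.mul_divide_cancel_r _ _ (g ^ a)); auto. apply Nat.pow_nonzero; auto. }
  exists y'. rewrite Ey. rewrite Hx1 in Ex. f_equal. lia.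
Qed.

(** If [k n^(b/a)] is an integer, then [n] is an [a]-th power. Cancelling [k] leaves [n^b = j^a],
    and a Bezout relation [u b = 1 + v a] writes [n] as a quotient of two [a]-th powers. *)
Lemma perfect_power a b k n m : (1 <= a)%nat -> (1 <= b)%nat -> Nat.gcd a b = 1%nat ->
  (1 <= k)%nat -> (1 <= n)%nat -> (k ^ a * n ^ b = m ^ a)%nat -> exists l, n = (l ^ a)%nat.
Proof.
  intros Ha Hb Hg Hk Hn E.
  destruct (pow_divide k m a Ha Hk) as [j Ej]; [exists (n ^ b)%nat; lia|].
  assert (E1 : (n ^ b = j ^ a)%nat).
  { apply (Nat.mul_cancel_l _ _ (k ^ a)); [apply Nat.pow_nonzero; lia|].
    rewrite E, Ej, Nat.pow_mul_l. lia. }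
  destruct (Nat.gcd_bezout_pos b a) as [u [v Euv]]; [lia|].
  rewrite Nat.gcd_comm, Hg in Euv.
  assert (E2 : (n * (n ^ v) ^ a = (j ^ u) ^ a)%nat).
  { transitivity (n ^ (1 + v * a))%nat.
    - rewrite Nat.pow_add_r, Nat.pow_1_r, Nat.pow_mul_r. reflexivity.
    - rewrite <- Euv, Nat.mul_comm, Nat.pow_mul_r, E1, <- !Nat.pow_mul_r. f_equal. lia. }
  destruct (pow_divide (n ^ v) (j ^ u) a Ha) as [l El].
  - assert (n ^ v <> 0)%nat by (apply Nat.pow_nonzero; lia). lia.
  - exists n. lia.
  - exists l. apply (Nat.mul_cancel_r _ _ ((n ^ v) ^ a)).
    + apply Nat.pow_nonzero, Nat.pow_nonzero; lia.
    + rewrite E2, El, Nat.pow_mul_l. reflexivity.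
Qed.

Lemma Rpower_ratio_pow (n a b : nat) : (1 <= n)%nat -> (1 <= a)%nat ->
  Rpower (INR n) (INR b / INR a) ^ a = INR n ^ b.
Proof.
  intros Hn Ha. pose proof (lt_0_INR n Hn). pose proof (lt_0_INR a Ha).
  rewrite <- Rpower_pow, Rpower_mult by apply Rpower_gt0.
  rewrite <- Rpower_pow by auto. f_equal. field. lra.
Qed.

Lemma Rpower_perfect (l a b : nat) : (1 <= l)%nat -> (1 <= a)%nat ->
  Rpower (INR (l ^ a)) (INR b / INR a) = INR (l ^ b).
Proof.
  intros Hl Ha. pose proof (lt_0_INR l Hl). pose proof (lt_0_INR a Ha).
  rewrite !pow_INR, <- !Rpower_pow, Rpower_mult by auto. f_equal. field. lra.
Qed.

(* The mean value of |zeta(1/2+iat)|^2 n^(ibt), in units of T log T. *)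
Definition twist_mean (a b n0 n : nat) : R :=
  rsum (fun l => if Nat.eqb (l ^ a) n then / sqrt (INR (l ^ b)) else 0) n0.

Lemma pow_le_base l a : (1 <= a)%nat -> (l <= l ^ a)%nat.
Proof.
  intros Ha. destruct a as [|a]; [lia|]. simpl. destruct l as [|l]; [lia|].
  assert (S l ^ a <> 0)%nat by (apply Nat.pow_nonzero; lia). nia.
Qed.

Lemma twist_mean_power a b n0 l : (1 <= a)%nat -> (1 <= l)%nat -> (l <= n0)%nat ->
  twist_mean a b n0 (l ^ a) = / sqrt (INR (l ^ b)).
Proof.
  intros Ha Hl Hln.
  assert (F : forall n, rsum (fun i => if Nat.eqb (i ^ a) (l ^ a) then / sqrt (INR (i ^ b)) else 0) n =
    if Nat.leb l n then / sqrt (INR (l ^ b)) else 0).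
  { induction n as [|n IH]; [simpl rsum; case Nat.leb_spec; intros; [lia|reflexivity]|].
    rewrite rsum_S, IH. case (Nat.eqb_spec (S n ^ a) (l ^ a)); intros E.
    - assert (S n = l) by (apply (Nat.pow_inj_l _ _ a); lia). subst l.
      case Nat.leb_spec; intros; [lia|]. case Nat.leb_spec; intros; [ring|lia].
    - assert (S n <> l) by congruence.
      case Nat.leb_spec; intros; case Nat.leb_spec; intros; try lia; ring. }
  unfold twist_mean. rewrite F. case Nat.leb_spec; intros; [reflexivity|lia].
Qed.

Lemma twist_mean_nonpower a b n0 n : (forall l, n <> (l ^ a)%nat) -> twist_mean a b n0 n = 0.
Proof.
  intros H. unfold twist_mean. rewrite (rsum_ext _ (fun _ => 0)), rsum_const; [ring|].
  intros l _. case Nat.eqb_spec; intros; [exfalso; apply (H l); auto|reflexivity].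
Qed.

(** With the cutoff [L^a] the [a]-th powers in range are exactly those of [l <= L], so that
    interchanging the sums leaves a partial sum of the series for zeta((a + b)/2). *)
Lemma twist_mean_sum a b L : (1 <= a)%nat ->
  rsum (fun n => / sqrt (INR n) * twist_mean a b (L ^ a) n) (L ^ a) =
  rsum (fun l => Rpower (INR l) (- ((INR a + INR b) / 2))) L.
Proof.
  intros Ha. set (n0 := (L ^ a)%nat).
  assert (HL : (L <= n0)%nat) by (apply pow_le_base; auto).
  rewrite (rsum_ext _ (fun n => rsum (fun l => / sqrt (INR n) * (if Nat.eqb (l ^ a) n then / sqrt (INR (l ^ b)) else 0)) n0)).
  2: { intros n _. rewrite rsum_scal. reflexivity. }
  rewrite rsum_swap.
  assert (F : forall l N, (1 <= l)%nat ->
    rsum (fun n => / sqrt (INR n) * (if Nat.eqb (l ^ a) n then / sqrt (INR (l ^ b)) else 0)) N =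
    if Nat.leb (l ^ a) N then Rpower (INR l) (- ((INR a + INR b) / 2)) else 0).
  { intros l N Hl. assert (Hla : (l ^ a <> 0)%nat) by (apply Nat.pow_nonzero; lia).
    pose proof (lt_0_INR l Hl) as Pl.
    induction N as [|N IH]; [simpl rsum; case Nat.leb_spec; intros; [lia|reflexivity]|].
    rewrite rsum_S, IH. case Nat.eqb_spec; intros E.
    - rewrite <- E. case Nat.leb_spec; intros; [lia|]. case Nat.leb_spec; intros; [|lia].
      rewrite Rplus_0_l, !pow_INR, <- !Rpower_sqrt by (apply pow_lt; auto).
      rewrite <- !Rpower_pow, !Rpower_mult, <- !Rpower_Ropp, <- Rpower_plus by auto.
      f_equal. field.
    - case Nat.leb_spec; intros; case Nat.leb_spec; intros; try lia; ring. }
  rewrite (rsum_ext _ (fun l => if Nat.leb l L then Rpower (INR l) (- ((INR a + INR b) / 2)) else 0)).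
  2: { intros l Hl. rewrite F by lia.
       case Nat.leb_spec; intros H1; case Nat.leb_spec; intros H2; auto; exfalso.
       - assert (L ^ a < l ^ a)%nat by (apply Nat.pow_lt_mono_l; lia). unfold n0 in H1. lia.
       - assert (l ^ a <= L ^ a)%nat by (apply Nat.pow_le_mono_l; lia). unfold n0 in H1. lia. }
  assert (G : forall N, (L <= N)%nat ->
    rsum (fun l => if Nat.leb l L then Rpower (INR l) (- ((INR a + INR b) / 2)) else 0) N =
    rsum (fun l => Rpower (INR l) (- ((INR a + INR b) / 2))) L).
  { induction 1 as [|N HN IH].
    - apply rsum_ext; intros. case Nat.leb_spec; intros; [reflexivity|lia].
    - rewrite rsum_S, IH. case Nat.leb_spec; intros; [lia|ring]. }
  apply G; auto.
Qed.

Lemma twisted_mean zeta a b n0 n eps : is_Riemann_zeta zeta -> (1 <= a)%nat -> (1 <= b)%nat ->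
  Nat.gcd a b = 1%nat -> (1 <= n <= n0)%nat -> 0 < eps ->
  exists v0, 1 <= v0 /\ forall v, v0 <= v ->
  Cmod (CInt (fun t => zz zeta (INR a) t * cis (INR b * ln (INR n) * t))%C (v ^ 24) (v ^ 40) -
    RtoC (twist_mean a b n0 n * (v ^ 40 * ln (v ^ 40)))) <= eps * (v ^ 40 * ln (v ^ 40)).
Proof.
  intros Hz Ha Hb Hg Hn Heps.
  pose proof (INR_ge1 a Ha) as PA. pose proof (lt_0_INR n ltac:(lia)) as Pn.
  set (alpha := Rpower (INR n) (INR b / INR a)).
  (* The frequency [b ln n] is rewritten as [a ln alpha], so that frequency 0 reads
     [m = k alpha]. *)
  assert (El : INR b * ln (INR n) = INR a * ln alpha).
  { unfold alpha. rewrite ln_Rpower. field. lra. }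
  rewrite El.
  destruct (classic (exists l, n = (l ^ a)%nat)) as [[l Hl]|Hnl].
  - assert (Hl1 : (1 <= l)%nat).
    { destruct l as [|l]; [|lia]. rewrite Nat.pow_0_l in Hl by lia. lia. }
    assert (Ea : alpha = INR (l ^ b)) by (unfold alpha; rewrite Hl; apply Rpower_perfect; auto).
    rewrite Ea, Hl, twist_mean_power by (auto; pose proof (pow_le_base l a Ha); lia).
    apply twisted_integer; auto.
    assert (l ^ b <> 0)%nat by (apply Nat.pow_nonzero; lia). lia.
  - rewrite twist_mean_nonpower by (intros l E; apply Hnl; exists l; auto).
    destruct (twisted_irrational zeta (INR a) alpha eps Hz PA) as [v0 [Hv0 H]]; auto.
    + unfold alpha. rewrite <- (Rpower_O (INR n)) by auto. apply Rle_Rpower; [apply INR_ge1; lia|].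
      apply Rmult_le_pos; [apply pos_INR|apply Rlt_le, Rinv_0_lt_compat; lra].
    + intros k m Hk E. apply Hnl.
      apply (perfect_power a b k n m); auto; [lia|].
      apply INR_eq. rewrite mult_INR, !pow_INR, <- E, Rpow_mult_distr.
      f_equal. symmetry. apply Rpower_ratio_pow; auto. lia.
    + exists v0. split; auto. intros v Hv. rewrite Rmult_0_l.
      match goal with |- Cmod (?x - _) <= _ => replace (x - RtoC 0)%C with x by ring end. auto.
Qed.

(** * Assembling the moment *)

Definition moment_integrand (zeta : C -> C) (A B t : R) : C :=
  (zz zeta A t * zeta (1 / 2, (- B * t))%R)%C.

Lemma ccont_moment zeta A B : is_Riemann_zeta zeta -> ccont (moment_integrand zeta A B).
Proof. intros H. apply ccont_mult; [apply ccont_zz; auto|apply ccont_zeta_line; auto]. Qed.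

(** A trivial bound, valid from [t = 1] on. The constant is twice [302 + 2]: the approximation error
    and the trivial bound for a polynomial of length about [|c| t]. *)
Lemma zeta_crude zeta B c t : is_Riemann_zeta zeta -> 1 <= B -> 1 <= Rabs c <= B -> 1 <= t ->
  Cmod (zeta (1 / 2, c * t)) <= 608 * B * sqrt t.
Proof.
  intros Hz HB Hc Ht.
  assert (Ec : Rabs (c * t) = Rabs c * t) by (rewrite Rabs_mult, (Rabs_pos_eq t); lra).
  destruct (nceil_ex (Rabs c * t)) as [M [HM1 HM2]]; [nra|].
  pose proof (zeta_approx zeta (c * t) M Hz ltac:(rewrite Ec; nra) ltac:(rewrite Ec; lra)) as Z.
  eapply Rle_trans; [apply (Cmod_le_via _ (dpoly M (c * t)))|].
  pose proof (Cmod_dpoly_trivial M (c * t)) as D.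
  assert (S1 : sqrt (INR M) <= 2 * B * sqrt t).
  { apply Rsqr_incr_0_var; [|pose proof (sqrt_pos t); nra]. unfold Rsqr.
    rewrite sqrt_sqrt by apply pos_INR.
    replace (2 * B * sqrt t * (2 * B * sqrt t)) with (4 * B * B * (sqrt t * sqrt t)) by ring.
    rewrite sqrt_sqrt by lra.
    assert (Rabs c * t <= B * t) by (apply Rmult_le_compat_r; lra).
    assert (1 * t <= B * t) by (apply Rmult_le_compat_r; lra).
    assert (1 * (B * t) <= B * (B * t)) by (apply Rmult_le_compat_r; lra). lra. }
  assert (Z2 : 302 * sqrt (INR M) / Rabs (c * t) <= 302 * sqrt (INR M)).
  { rewrite <- (Rmult_1_r (302 * sqrt (INR M))) at 2. pose proof (sqrt_pos (INR M)).
    apply Rmult_le_compat_l; [lra|]. rewrite <- Rinv_1. apply Rinv_le_contravar; [lra|rewrite Ec; nra]. }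
  lra.
Qed.

Lemma sqrt_pow_even w n : 0 <= w -> sqrt (w ^ (n + n)) = w ^ n.
Proof. intros H. rewrite pow_add. apply sqrt_square, pow_le; auto. Qed.

(** With [T = w^200] the range ends at [T^(3/5)]. From [w^72] on, the trivial bound [w^60] for one
    factor meets the mean square of the others with [v = w^3], of order [w^120] up to a logarithm;
    below [w^72] three trivial bounds give [w^108 w^72]. Both products are [w^180]. *)
Lemma moment_low zeta A B : is_Riemann_zeta zeta -> 1 <= A -> A < B -> exists C, 0 < C /\
  forall w, 1 <= w -> Cmod (CInt (moment_integrand zeta A B) 1 (w ^ 120)) <= C * (w ^ 180 * (1 + ln (w ^ 120))).
Proof.
  intros Hz HA HB. destruct (zeta_ms zeta B Hz ltac:(lra)) as [C1 [HC1 H1]].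
  set (K := 608 * B). assert (HK : 1 <= K) by (unfold K; lra).
  assert (K3 : 0 < K ^ 3) by (apply pow_lt; lra).
  exists (K ^ 3 + 2 * K * C1). split; [nra|]. intros w Hw.
  assert (P : forall n, 1 <= w ^ n) by (intros; apply pow_R1_Rle; auto).
  assert (L72 : w ^ 72 <= w ^ 120) by (apply Rle_pow; [auto|lia]).
  pose proof (P 72%nat) as P72. pose proof (P 120%nat) as P120. pose proof (P 36%nat) as P36.
  pose proof (P 60%nat) as P60. pose proof (P 180%nat) as P180.
  assert (l0 : 0 <= ln (w ^ 120)) by (apply ln_nonneg; auto).
  assert (aA : 1 <= Rabs A <= B) by (rewrite Rabs_pos_eq; lra).
  assert (aA' : 1 <= Rabs (- A) <= B) by (rewrite Rabs_Ropp; auto).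
  assert (aB : 1 <= Rabs (- B) <= B) by (rewrite Rabs_Ropp, Rabs_pos_eq; lra).
  assert (CM := ccont_moment zeta A B Hz).
  rewrite <- (CInt_Chasles _ 1 (w ^ 72) (w ^ 120)) by auto.
  eapply Rle_trans; [apply Cmod_triangle|]. rewrite Rmult_plus_distr_r. apply Rplus_le_compat.
  - apply Rle_trans with (K ^ 3 * w ^ 108 * (w ^ 72 - 1)).
    + apply Cmod_CInt_const; auto. intros t Ht.
      unfold moment_integrand, zz. rewrite !Cmod_mult.
      assert (S : sqrt t <= w ^ 36).
      { rewrite <- (sqrt_pow_even w 36) by lra. apply sqrt_le_1; try lra. apply pow_le; lra. apply Ht. }
      pose proof (zeta_crude zeta B A t Hz ltac:(lra) aA ltac:(lra)) as Z1.
      pose proof (zeta_crude zeta B (- A) t Hz ltac:(lra) aA' ltac:(lra)) as Z2.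
      pose proof (zeta_crude zeta B (- B) t Hz ltac:(lra) aB ltac:(lra)) as Z3.
      fold K in Z1, Z2, Z3. pose proof (sqrt_pos t).
      assert (KS : K * sqrt t <= K * w ^ 36) by (apply Rmult_le_compat_l; lra).
      replace (K ^ 3 * w ^ 108) with ((K * w ^ 36) * (K * w ^ 36) * (K * w ^ 36)) by (simpl; ring).
      apply Rmult_le_compat; try lra; try apply Cmod_ge_0.
      * apply Rmult_le_pos; apply Cmod_ge_0.
      * apply Rmult_le_compat; try lra; apply Cmod_ge_0.
    + replace (w ^ 180) with (w ^ 108 * w ^ 72) by (rewrite <- pow_add; reflexivity).
      pose proof (P 108%nat). rewrite Rmult_assoc. apply Rmult_le_compat_l; [lra|].
      rewrite Rmult_assoc. apply Rmult_le_compat_l; [lra|]. nra.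
  - set (z1 := fun t => Cmod (zeta ((1 / 2)%R, (A * t)%R)) ^ 2).
    set (z2 := fun t => Cmod (zeta ((1 / 2)%R, (- A * t)%R)) ^ 2).
    assert (C1z : cont z1) by (apply cont_Cmod2, ccont_zeta_line; auto).
    assert (C2z : cont z2) by (apply cont_Cmod2, ccont_zeta_line; auto).
    assert (E72 : (w ^ 3) ^ 24 = w ^ 72) by (rewrite <- pow_mult; reflexivity).
    assert (E120 : (w ^ 3) ^ 40 = w ^ 120) by (rewrite <- pow_mult; reflexivity).
    pose proof (H1 A (w ^ 3) (P 3%nat) aA) as I1. pose proof (H1 (- A) (w ^ 3) (P 3%nat) aA') as I2.
    rewrite E72, E120 in I1, I2. fold z1 in I1. fold z2 in I2.
    eapply Rle_trans.
    { apply (Cmod_CInt_le _ (fun t => K * w ^ 60 * (z1 t + z2 t))); auto.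
      - apply cont_mult; auto using cont_const, cont_plus.
      - intros t Ht. unfold moment_integrand, zz. rewrite !Cmod_mult.
        assert (S : sqrt t <= w ^ 60).
        { rewrite <- (sqrt_pow_even w 60) by lra. apply sqrt_le_1; try lra. apply pow_le; lra. apply Ht. }
        pose proof (zeta_crude zeta B (- B) t Hz ltac:(lra) aB ltac:(lra)) as Z3. fold K in Z3.
        pose proof (sqrt_pos t).
        assert (KS : K * sqrt t <= K * w ^ 60) by (apply Rmult_le_compat_l; lra).
        rewrite Rmult_comm. apply Rmult_le_compat; try lra; try apply Cmod_ge_0.
        + apply Rmult_le_pos; apply Cmod_ge_0.
        + unfold z1, z2. set (x := Cmod _). set (y := Cmod _).
          pose proof (Rle_0_sqr (x - y)) as Q. unfold Rsqr in Q. simpl.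
          assert (0 <= x * x) by apply Rle_0_sqr. assert (0 <= y * y) by apply Rle_0_sqr. nra. }
    rewrite RInt_scalR, RInt_plusR by auto using cont_plus.
    replace (w ^ 180) with (w ^ 60 * w ^ 120) by (rewrite <- pow_add; reflexivity).
    replace (2 * K * C1 * (w ^ 60 * w ^ 120 * (1 + ln (w ^ 120)))) with
      (K * w ^ 60 * (C1 * (w ^ 120 * (1 + ln (w ^ 120))) + C1 * (w ^ 120 * (1 + ln (w ^ 120))))) by ring.
    apply Rmult_le_compat_l; [nra|lra].
Qed.

(* Replacing zeta by Dirichlet polynomials costs a factor O(v^-4) = O(T^(-1/10)) against mean squares. *)
Lemma moment_replace zeta A B : is_Riemann_zeta zeta -> 1 <= A -> A < B -> exists C, 0 < C /\
  forall v M n0, 1 <= v -> main_length B v M -> (n0 <= M)%nat ->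
  Cmod (CInt (moment_integrand zeta A B) (v ^ 24) (v ^ 40) -
    (CInt (fun t => zz zeta A t * dpoly n0 (- B * t))%C (v ^ 24) (v ^ 40) +
     CInt (fun t => dpoly M (A * t) * dpoly M (- A * t) * (dpoly M (- B * t) - dpoly n0 (- B * t)))%C (v ^ 24) (v ^ 40)))
  <= C * (v ^ 36 * (1 + ln (v ^ 40))).
Proof.
  intros Hz HA HB. destruct (zeta_ms zeta B Hz ltac:(lra)) as [C1 [HC1 H1]].
  destruct (dpoly_ms B ltac:(lra)) as [C2 [HC2 H2]].
  set (E := 604 * B). set (D := 64 * (1 + 4 * (B * B)) * (2 + ln (2 * B))).
  assert (L0 : 0 <= ln (2 * B)) by (apply ln_nonneg; lra).
  assert (HD : 0 < D) by (unfold D; apply Rmult_lt_0_compat; nra).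
  assert (HE : 1 <= E) by (unfold E; lra).
  exists (E * (3 * C1 + C2 + D)). split; [apply Rmult_lt_0_compat; lra|].
  intros v M n0 Hv HM Hn0.
  assert (P : forall n, 1 <= v ^ n) by (intros; apply pow_R1_Rle; auto).
  assert (V24 : v ^ 24 <= v ^ 40) by (apply Rle_pow; [auto|lia]).
  pose proof (P 24%nat) as P24. pose proof (P 40%nat) as P40. pose proof (P 4%nat) as P4. pose proof (P 36%nat) as P36.
  assert (aA : 1 <= Rabs A <= B) by (rewrite Rabs_pos_eq; lra).
  assert (aA' : 1 <= Rabs (- A) <= B) by (rewrite Rabs_Ropp; auto).
  assert (aB : 1 <= Rabs (- B) <= B) by (rewrite Rabs_Ropp, Rabs_pos_eq; lra).
  set (z1 := fun t => zeta ((1 / 2)%R, (A * t)%R)). set (z2 := fun t => zeta ((1 / 2)%R, (- A * t)%R)).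
  set (z3 := fun t => zeta ((1 / 2)%R, (- B * t)%R)).
  set (d1 := fun t => dpoly M (A * t)). set (d2 := fun t => dpoly M (- A * t)). set (d3 := fun t => dpoly M (- B * t)).
  set (p := fun t => dpoly n0 (- B * t)).
  assert (Cz1 : ccont z1) by (apply ccont_zeta_line; auto).
  assert (Cz2 : ccont z2) by (apply ccont_zeta_line; auto).
  assert (Cz3 : ccont z3) by (apply ccont_zeta_line; auto).
  assert (Cd1 : ccont d1) by apply ccont_dpoly. assert (Cd2 : ccont d2) by apply ccont_dpoly.
  assert (Cd3 : ccont d3) by apply ccont_dpoly. assert (Cp : ccont p) by apply ccont_dpoly.
  change (moment_integrand zeta A B) with (fun t => z1 t * z2 t * z3 t)%C.
  change (fun t => zz zeta A t * dpoly n0 (- B * t))%C with (fun t => z1 t * z2 t * p t)%C.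
  change (fun t => dpoly M (A * t) * dpoly M (- A * t) * (dpoly M (- B * t) - dpoly n0 (- B * t)))%C with
    (fun t => d1 t * d2 t * (d3 t - p t))%C.
  assert (Cz12 : ccont (fun t => z1 t * z2 t)%C) by (apply (ccont_mult z1 z2); auto).
  assert (Cd12 : ccont (fun t => d1 t * d2 t)%C) by (apply (ccont_mult d1 d2); auto).
  assert (Cs : ccont (fun t => d3 t - p t)%C) by (apply (ccont_minus d3 p); auto).
  assert (CA : ccont (fun t => z1 t * z2 t * z3 t)%C) by (apply (ccont_mult (fun t => z1 t * z2 t)%C z3); auto).
  assert (CB : ccont (fun t => z1 t * z2 t * p t)%C) by (apply (ccont_mult (fun t => z1 t * z2 t)%C p); auto).
  assert (CC : ccont (fun t => d1 t * d2 t * (d3 t - p t))%C)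
    by (apply (ccont_mult (fun t => d1 t * d2 t)%C (fun t => d3 t - p t)%C); auto).
  assert (CBC : ccont (fun t => z1 t * z2 t * p t + d1 t * d2 t * (d3 t - p t))%C)
    by (apply (ccont_plus (fun t => z1 t * z2 t * p t)%C (fun t => d1 t * d2 t * (d3 t - p t))%C); auto).
  rewrite <- (CInt_plus (fun t => z1 t * z2 t * p t)%C) by auto. rewrite <- CInt_minus by auto.
  set (q1 := fun t => Cmod (z1 t) ^ 2). set (q2 := fun t => Cmod (z2 t) ^ 2).
  set (q3 := fun t => Cmod (d1 t) ^ 2). set (q4 := fun t => Cmod (d3 t - p t) ^ 2).
  assert (Cq1 : cont q1) by (apply cont_Cmod2; auto). assert (Cq2 : cont q2) by (apply cont_Cmod2; auto).
  assert (Cq3 : cont q3) by (apply cont_Cmod2; auto). assert (Cq4 : cont q4) by (apply cont_Cmod2; auto).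
  eapply Rle_trans.
  { apply (Cmod_CInt_le _ (fun t => E / v ^ 4 * ((q1 t + (q2 t + q2 t)) + (q3 t + q4 t)))); auto.
    - apply (ccont_minus (fun t => z1 t * z2 t * z3 t)%C); auto.
    - apply cont_mult; auto using cont_const, cont_plus.
    - intros t Ht.
      (* In front of [p] the first two factors stay zeta, as the fixed frequencies need them. Each
         of the three differences stands beside two factors whose mean squares are known. *)
      replace (z1 t * z2 t * z3 t - (z1 t * z2 t * p t + d1 t * d2 t * (d3 t - p t)))%C with
        (z1 t * z2 t * (z3 t - d3 t) + ((z1 t - d1 t) * z2 t * (d3 t - p t) + d1 t * (z2 t - d2 t) * (d3 t - p t)))%C by ring.
      eapply Rle_trans; [apply Cmod_triangle|]. eapply Rle_trans; [apply Rplus_le_compat_l, Cmod_triangle|].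
      rewrite !Cmod_mult.
      pose proof (zeta_dpoly_close zeta B A v M t Hz ltac:(lra) Hv aA HM Ht) as E1.
      pose proof (zeta_dpoly_close zeta B (- A) v M t Hz ltac:(lra) Hv aA' HM Ht) as E2.
      pose proof (zeta_dpoly_close zeta B (- B) v M t Hz ltac:(lra) Hv aB HM Ht) as E3.
      change (Cmod (z1 t - d1 t) <= E / v ^ 4) in E1. change (Cmod (z2 t - d2 t) <= E / v ^ 4) in E2.
      change (Cmod (z3 t - d3 t) <= E / v ^ 4) in E3.
      unfold q1, q2, q3, q4. set (e := E / v ^ 4) in *.
      set (x1 := Cmod (z1 t)). set (x2 := Cmod (z2 t)). set (x3 := Cmod (d1 t)). set (x4 := Cmod (d3 t - p t)).
      assert (X1 : 0 <= x1) by apply Cmod_ge_0. assert (X2 : 0 <= x2) by apply Cmod_ge_0.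
      assert (X3 : 0 <= x3) by apply Cmod_ge_0. assert (X4 : 0 <= x4) by apply Cmod_ge_0.
      pose proof (Cmod_ge_0 (z1 t - d1 t)). pose proof (Cmod_ge_0 (z2 t - d2 t)). pose proof (Cmod_ge_0 (z3 t - d3 t)).
      assert (e0 : 0 <= e) by lra.
      assert (T1 : x1 * x2 * Cmod (z3 t - d3 t) <= e * (x1 * x2)).
      { rewrite Rmult_comm. apply Rmult_le_compat_r; [apply Rmult_le_pos; auto|auto]. }
      assert (T2 : Cmod (z1 t - d1 t) * x2 * x4 <= e * (x2 * x4)).
      { rewrite Rmult_assoc. apply Rmult_le_compat_r; [apply Rmult_le_pos; auto|auto]. }
      assert (T3 : x3 * Cmod (z2 t - d2 t) * x4 <= e * (x3 * x4)).
      { replace (x3 * Cmod (z2 t - d2 t) * x4) with (Cmod (z2 t - d2 t) * (x3 * x4)) by ring.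
        apply Rmult_le_compat_r; [apply Rmult_le_pos; auto|auto]. }
      assert (T4 : x1 * x2 + x2 * x4 + x3 * x4 <= x1 ^ 2 + (x2 ^ 2 + x2 ^ 2) + (x3 ^ 2 + x4 ^ 2)).
      { pose proof (Rle_0_sqr (x1 - x2)) as Q1. pose proof (Rle_0_sqr (x2 - x4)) as Q2.
        pose proof (Rle_0_sqr (x3 - x4)) as Q3. unfold Rsqr in *. simpl. nra. }
      apply Rle_trans with (e * (x1 * x2 + x2 * x4 + x3 * x4)); [lra|]. apply Rmult_le_compat_l; auto. }
  rewrite RInt_scalR, !RInt_plusR by auto 6 using cont_plus.
  pose proof (H1 A v Hv aA) as I1. pose proof (H1 (- A) v Hv aA') as I2.
  pose proof (H2 A v M Hv (proj1 aA) HM) as I3.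
  pose proof (dpoly_diff_ms B (- B) v M n0 ltac:(lra) Hv (proj1 aB) HM Hn0) as I4.
  change (RInt q1 (v ^ 24) (v ^ 40) <= C1 * (v ^ 40 * (1 + ln (v ^ 40)))) in I1.
  change (RInt q2 (v ^ 24) (v ^ 40) <= C1 * (v ^ 40 * (1 + ln (v ^ 40)))) in I2.
  change (RInt q3 (v ^ 24) (v ^ 40) <= C2 * (v ^ 40 * (1 + ln (v ^ 40)))) in I3.
  change (RInt q4 (v ^ 24) (v ^ 40) <= 64 * (1 + 4 * (B * B)) * v ^ 40 * (harmonic M - harmonic n0)) in I4.
  pose proof (harmonic_main B v M ltac:(lra) Hv HM) as HH. pose proof (harmonic_ge0 n0) as H0.
  set (l := ln (v ^ 40)) in *.
  assert (I5 : RInt q4 (v ^ 24) (v ^ 40) <= D * (v ^ 40 * (1 + l))).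
  { eapply Rle_trans; [exact I4|]. unfold D.
    replace (64 * (1 + 4 * (B * B)) * (2 + ln (2 * B)) * (v ^ 40 * (1 + l))) with
      (64 * (1 + 4 * (B * B)) * v ^ 40 * ((2 + ln (2 * B)) * (1 + l))) by ring.
    apply Rmult_le_compat_l; [nra|lra]. }
  apply Rle_trans with (E / v ^ 4 * ((3 * C1 + C2 + D) * (v ^ 40 * (1 + l)))).
  - apply Rmult_le_compat_l; [apply Rlt_le, Rdiv_lt_0_compat; lra|]. lra.
  - apply Req_le. replace (v ^ 40) with (v ^ 36 * v ^ 4) by (rewrite <- pow_add; reflexivity). field. lra.
Qed.

Lemma eventually_finite (Q : nat -> R -> Prop) n0 :
  (forall n, (1 <= n <= n0)%nat -> exists v0, 1 <= v0 /\ forall v, v0 <= v -> Q n v) ->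
  exists v0, 1 <= v0 /\ forall v, v0 <= v -> forall n, (1 <= n <= n0)%nat -> Q n v.
Proof.
  induction n0 as [|n0 IH]; intros H.
  - exists 1. split; [lra|]. intros; lia.
  - destruct IH as [v1 [Hv1 H1]]; [intros; apply H; lia|].
    destruct (H (S n0) ltac:(lia)) as [v2 [Hv2 H2]].
    exists (v1 + v2). split; [lra|]. intros v Hv n Hn.
    destruct (Nat.eq_dec n (S n0)) as [->|]; [apply H2; lra|apply H1; [lra|lia]].
Qed.

Lemma twisted_sum zeta a b n0 eps : is_Riemann_zeta zeta -> (1 <= a)%nat -> (1 <= b)%nat -> Nat.gcd a b = 1%nat ->
  (1 <= n0)%nat -> 0 < eps -> exists v0, 1 <= v0 /\ forall v, v0 <= v ->
  Cmod (CInt (fun t => zz zeta (INR a) t * dpoly n0 (- INR b * t))%C (v ^ 24) (v ^ 40) -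
    RtoC (rsum (fun n => / sqrt (INR n) * twist_mean a b n0 n) n0 * (v ^ 40 * ln (v ^ 40)))) <=
  eps * (v ^ 40 * ln (v ^ 40)).
Proof.
  intros Hz Ha Hb Hg Hn0 Heps. pose proof (lt_0_INR n0 Hn0) as Pn0.
  destruct (eventually_finite (fun n v =>
    Cmod (CInt (fun t => zz zeta (INR a) t * cis (INR b * ln (INR n) * t))%C (v ^ 24) (v ^ 40) -
    RtoC (twist_mean a b n0 n * (v ^ 40 * ln (v ^ 40)))) <= eps / INR n0 * (v ^ 40 * ln (v ^ 40))) n0) as [v0 [Hv0 H]].
  { intros n Hn. apply twisted_mean; auto. apply Rdiv_lt_0_compat; lra. }
  exists v0. split; auto. intros v Hv. specialize (H v Hv).
  assert (P40 : 1 <= v ^ 40) by (apply pow_R1_Rle; lra).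
  assert (l0 : 0 <= ln (v ^ 40)) by (apply ln_nonneg; auto).
  set (TL := v ^ 40 * ln (v ^ 40)) in *.
  assert (Cz := ccont_zz zeta (INR a) Hz).
  assert (Cn : forall n, ccont (fun t => zz zeta (INR a) t * cis (INR b * ln (INR n) * t))%C).
  { intros n. apply (ccont_mult (zz zeta (INR a))); auto. apply ccont_cis_lin. }
  rewrite (CInt_ext _ (fun t => csum (fun n => RtoC (/ sqrt (INR n)) * (zz zeta (INR a) t * cis (INR b * ln (INR n) * t)))%C n0)).
  2: { intros t. unfold dpoly. rewrite <- csum_scal. apply csum_ext; intros n _.
       replace (- (- INR b * t * ln (INR n))) with (INR b * ln (INR n) * t) by ring. ring. }
  rewrite CInt_csum.
  2: { intros n. apply (ccont_mult (fun _ => RtoC (/ sqrt (INR n)))); auto using ccont_const. }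
  rewrite <- rsum_scal_r, <- csum_RtoC, <- csum_minus.
  replace (eps * TL) with (INR n0 * (eps / INR n0 * TL)) by (field; lra).
  rewrite <- rsum_const. apply Cmod_csum_le; intros n Hn.
  rewrite CInt_scal by auto. rewrite Rmult_assoc, RtoC_mult.
  match goal with |- Cmod (?r * ?x - ?r * ?y) <= _ => replace (r * x - r * y)%C with (r * (x - y))%C by ring end.
  assert (S1 : 1 <= sqrt (INR n)).
  { rewrite <- sqrt_1. apply sqrt_le_1; try lra; [apply pos_INR|apply INR_ge1; lia]. }
  assert (S2 : 0 < / sqrt (INR n) <= 1).
  { split; [apply Rinv_0_lt_compat; lra|]. rewrite <- Rinv_1. apply Rinv_le_contravar; lra. }
  rewrite Cmod_RtoC_mult by lra. specialize (H n Hn).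
  match goal with |- _ * ?c <= _ => pose proof (Cmod_ge_0 (CInt (fun t => zz zeta (INR a) t * cis (INR b * ln (INR n) * t))%C (v ^ 24) (v ^ 40) -
    RtoC (twist_mean a b n0 n * TL))) end. nra.
Qed.

Lemma zeta_real_series zeta x : is_Riemann_zeta zeta -> 1 < x ->
  cconv (fun L => RtoC (rsum (fun l => Rpower (INR l) (- x)) L)) (zeta (RtoC x)).
Proof.
  intros [Hz _] Hx. specialize (Hz (RtoC x) Hx).
  apply (is_series_cconv (fun n => Rpow_C (INR n) (- RtoC x))) in Hz.
  eapply cconv_ext; [|exact Hz]. intros L. simpl. rewrite <- csum_RtoC. apply csum_ext; intros l _.
  rewrite <- RtoC_opp, Rpow_C_real. reflexivity.
Qed.

(** Asymptotic equivalence measures the error against the main term, whose coefficient must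
    therefore stay away from 0; the term [l = 1] of the series provides this. *)
Lemma zeta_real_ge1 zeta x : is_Riemann_zeta zeta -> 1 < x -> 1 <= Cmod (zeta (RtoC x)).
Proof.
  intros Hz Hx. pose proof (zeta_real_series zeta x Hz Hx) as H.
  apply cconv_incr_1' in H.
  enough (Rbar_le 1 (Cmod (zeta (RtoC x)) + 0)) by (simpl in H0; lra).
  apply is_lim_seq_le with (fun _ => 1) (fun L => Cmod (zeta (RtoC x)) +
    Cmod (RtoC (rsum (fun l => Rpower (INR l) (- x)) (S L)) - zeta (RtoC x))).
  - intros L. set (u := rsum _ (S L)).
    assert (U : 1 <= u).
    { unfold u. apply Rle_trans with (Rpower (INR 1) (- x)).
      - unfold Rpower. simpl INR. rewrite ln_1, Rmult_0_r, exp_0. lra.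
      - apply (rsum_le_term (fun l => Rpower (INR l) (- x))); [intros; apply Rlt_le, Rpower_gt0|lia]. }
    eapply Rle_trans; [exact U|]. rewrite <- (Rabs_pos_eq u) at 1 by lra. rewrite <- Cmod_R.
    apply Cmod_le_via.
  - apply is_lim_seq_const.
  - apply is_lim_seq_plus'; [apply is_lim_seq_const|exact H].
Qed.

Lemma Rpower_neg_small g eps : 0 < g -> 0 < eps -> exists L0 : nat, (1 <= L0)%nat /\
  forall L, (L0 <= L)%nat -> Rpower (INR L) (- g) <= eps.
Proof.
  intros Hg He. destruct (nceil_ex (Rpower (/ eps) (/ g))) as [n [Hn _]]; [apply Rlt_le, Rpower_gt0|].
  exists (S n). split; [lia|]. intros L HL.
  assert (H1 : Rpower (/ eps) (/ g) <= INR L).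
  { eapply Rle_trans; [exact Hn|]. apply le_INR; lia. }
  rewrite Rpower_Ropp. rewrite <- (Rinv_inv eps). apply Rinv_le_contravar; [apply Rinv_0_lt_compat; auto|].
  apply Rle_trans with (Rpower (Rpower (/ eps) (/ g)) g).
  - rewrite Rpower_mult, Rinv_l, Rpower_1; [lra|apply Rinv_0_lt_compat; auto|lra].
  - apply Rle_Rpower_l; [lra|]. split; [apply Rpower_gt0|auto].
Qed.

(** [L], and with it [n0 = L^a], is fixed first and makes both the terms with large [n] and the tail
    of the series for zeta((a + b)/2) small. The other errors then become small relative to
    [T log T] as [v] grows. *)
Lemma moment_high zeta a b eps : is_Riemann_zeta zeta -> (1 <= a)%nat -> (a < b)%nat -> Nat.gcd a b = 1%nat ->
  0 < eps -> exists v0, 1 <= v0 /\ forall v, v0 <= v ->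
  Cmod (CInt (moment_integrand zeta (INR a) (INR b)) (v ^ 24) (v ^ 40) -
    zeta (RtoC ((INR a + INR b) / 2)) * RtoC (v ^ 40 * ln (v ^ 40))) <= eps * (v ^ 40 * ln (v ^ 40)).
Proof.
  intros Hz Ha Hab Hg Heps.
  assert (HA : 1 <= INR a) by (apply INR_ge1; auto).
  assert (HB : INR a + 1 <= INR b) by (rewrite <- S_INR; apply le_INR; lia).
  set (A := INR a) in *. set (B := INR b) in *. set (x := (A + B) / 2).
  assert (Hx : 1 < x) by (unfold x; lra).
  set (g := (B - A) / (2 * A)). assert (Pg : 0 < g) by (apply Rdiv_lt_0_compat; lra).
  destruct (tail_bound A B HA ltac:(lra)) as [K [HK Htail]].
  destruct (moment_replace zeta A B Hz HA ltac:(lra)) as [C1 [HC1 Hrep]].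
  assert (LB : 0 <= ln (2 * B)) by (apply ln_nonneg; lra).
  set (HL := 2 + ln (2 * B)). assert (PHL : 2 <= HL) by (unfold HL; lra).
  pose proof (zeta_real_series zeta x Hz Hx) as Hser.
  apply is_lim_seq_spec in Hser. destruct (Hser (mkposreal (eps / 8) ltac:(lra))) as [L1 HL1]. simpl in HL1.
  destruct (Rpower_neg_small g (eps / (16 * K * HL)) Pg) as [L2 [HL2 Hsmall]].
  { apply Rdiv_lt_0_compat; nra. }
  set (L := (L1 + L2)%nat). set (n0 := (L ^ a)%nat).
  assert (HLn : (L <= n0)%nat) by (apply pow_le_base; auto).
  assert (Hn0 : (1 <= n0)%nat) by (unfold L in *; lia).
  assert (Hsm : K * HL * Rpower (INR n0) (- g) <= eps / 16).
  { apply Rle_trans with (K * HL * (eps / (16 * K * HL))).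
    - apply Rmult_le_compat_l; [nra|]. apply Hsmall. unfold L in *; lia.
    - apply Req_le. field. split; lra. }
  specialize (HL1 L ltac:(unfold L; lia)). rewrite Rminus_0_r, Rabs_pos_eq in HL1 by apply Cmod_ge_0.
  set (S := rsum (fun l => Rpower (INR l) (- x)) L) in *.
  destruct (Htail n0 Hn0) as [C2 [v1 [HC2 [Hv1 Ht]]]].
  destruct (twisted_sum zeta a b n0 (eps / 8) Hz Ha ltac:(lia) Hg Hn0 ltac:(lra)) as [v2 [Hv2 Htw]].
  destruct (ln_pow40_large 1) as [v3 [Hv3 Hl]].
  assert (Q1 : 0 < 16 * C1 / eps) by (apply Rdiv_lt_0_compat; lra).
  assert (Q2 : 0 < 8 * C2 / eps) by (apply Rdiv_lt_0_compat; lra).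
  pose proof (pos_INR n0) as Pn0.
  exists (v1 + v2 + v3 + INR n0 + 16 * C1 / eps + 8 * C2 / eps). split; [lra|].
  intros v Hv. assert (V1 : 1 <= v) by lra.
  assert (P : forall n, 1 <= v ^ n) by (intros; apply pow_R1_Rle; auto).
  pose proof (P 40%nat) as P40. pose proof (P 24%nat) as P24. pose proof (P 36%nat) as P36. pose proof (P 38%nat) as P38.
  assert (V40 : v <= v ^ 40) by (rewrite <- (pow_1 v) at 1; apply Rle_pow; [auto|lia]).
  specialize (Hl v ltac:(lra)).
  destruct (nceil_ex (B * v ^ 40)) as [M HM]; [nra|].
  assert (HnM : (n0 <= M)%nat) by (apply INR_le; nra).
  specialize (Hrep v M n0 V1 HM HnM). specialize (Ht v M ltac:(lra) HM). specialize (Htw v ltac:(lra)).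
  assert (ES : rsum (fun n => / sqrt (INR n) * twist_mean a b n0 n) n0 = S).
  { unfold S, x, A, B, n0. apply twist_mean_sum; auto. }
  rewrite ES in Htw. fold A B in Htw. fold g in Ht.
  pose proof (harmonic_main B v M ltac:(lra) V1 HM) as HH. fold HL in HH.
  set (l := ln (v ^ 40)) in *. set (TL := v ^ 40 * l) in *.
  assert (TL0 : 0 <= TL) by (unfold TL; nra).
  set (I := CInt (moment_integrand zeta A B) (v ^ 24) (v ^ 40)) in *.
  set (I1 := CInt (fun t => zz zeta A t * dpoly n0 (- B * t))%C (v ^ 24) (v ^ 40)) in *.
  rewrite (CInt_ext _ (fun t => dpoly M (A * t) * dpoly M (- A * t) * (dpoly M (- B * t) - dpoly n0 (- B * t)))%C) in Ht.
  2: { intros t. rewrite <- !Ropp_mult_distr_l. reflexivity. }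
  set (I2 := CInt (fun t => dpoly M (A * t) * dpoly M (- A * t) * (dpoly M (- B * t) - dpoly n0 (- B * t)))%C (v ^ 24) (v ^ 40)) in *.
  replace (I - zeta (RtoC x) * RtoC TL)%C with
    ((I - (I1 + I2)) + I2 + (I1 - RtoC (S * TL)) + (RtoC S - zeta (RtoC x)) * RtoC TL)%C
    by (rewrite RtoC_mult; ring).
  eapply Rle_trans; [apply Cmod_triangle|].
  eapply Rle_trans; [apply Rplus_le_compat_r, Cmod_triangle|].
  eapply Rle_trans; [apply Rplus_le_compat_r, Rplus_le_compat_r, Cmod_triangle|].
  rewrite Cmod_mult, Cmod_R, (Rabs_pos_eq TL) by auto.
  assert (R1 : C1 * (v ^ 36 * (1 + l)) <= eps / 8 * TL).
  { unfold TL. replace (v ^ 40) with (v ^ 36 * (v * v ^ 3)) by (simpl; ring).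
    assert (16 * C1 / eps <= v * v ^ 3) by (pose proof (P 3%nat); nra).
    apply Rle_trans with (C1 * (v ^ 36 * (2 * l))); [apply Rmult_le_compat_l; [lra|]; apply Rmult_le_compat_l; lra|].
    replace (eps / 8 * (v ^ 36 * (v * v ^ 3) * l)) with (eps / 8 * (v * v ^ 3) * (v ^ 36 * l)) by ring.
    replace (C1 * (v ^ 36 * (2 * l))) with (eps / 8 * (16 * C1 / eps) * (v ^ 36 * l)) by (field; lra).
    apply Rmult_le_compat_r; [nra|]. apply Rmult_le_compat_l; lra. }
  assert (R2 : C2 * v ^ 38 <= eps / 8 * TL).
  { unfold TL. replace (v ^ 40) with (v ^ 38 * (v * v)) by (simpl; ring).
    assert (8 * C2 / eps <= v * v * l) by nra.
    replace (eps / 8 * (v ^ 38 * (v * v) * l)) with (eps / 8 * (v * v * l) * v ^ 38) by ring.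
    apply Rmult_le_compat_r; [lra|].
    apply Rle_trans with (eps / 8 * (8 * C2 / eps)); [apply Req_le; field; lra|]. apply Rmult_le_compat_l; lra. }
  assert (R3 : K * v ^ 40 * harmonic M * Rpower (INR n0) (- g) <= eps / 8 * TL).
  { pose proof (Rpower_gt0 (INR n0) (- g)) as Rp. set (rp := Rpower (INR n0) (- g)) in *.
    apply Rle_trans with (K * v ^ 40 * (HL * (2 * l)) * rp).
    - apply Rmult_le_compat_r; [lra|]. apply Rmult_le_compat_l; [nra|].
      eapply Rle_trans; [exact HH|]. apply Rmult_le_compat_l; lra.
    - replace (K * v ^ 40 * (HL * (2 * l)) * rp) with (2 * (K * HL * rp) * TL) by (unfold TL; ring).
      apply Rmult_le_compat_r; [auto|lra]. }
  assert (R4 : Cmod (RtoC S - zeta (RtoC x)) * TL <= eps / 8 * TL) by (apply Rmult_le_compat_r; lra).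
  pose proof (Rmult_le_pos eps TL ltac:(lra) TL0). lra.
Qed.

(** With [T = w^200] and [v = w^5] the lower limit [v^24 = w^120] is again a 40th power, that of
    [w^3], so the same mean square bound serves the part below it. *)
Lemma moment_asymptotic zeta a b eps : is_Riemann_zeta zeta -> (1 <= a)%nat -> (a < b)%nat -> Nat.gcd a b = 1%nat ->
  0 < eps -> exists w0, 1 <= w0 /\ forall w, w0 <= w ->
  Cmod (CInt (moment_integrand zeta (INR a) (INR b)) 0 (w ^ 200) -
    zeta (RtoC ((INR a + INR b) / 2)) * RtoC (w ^ 200 * ln (w ^ 200))) <= eps * (w ^ 200 * ln (w ^ 200)).
Proof.
  intros Hz Ha Hab Hg Heps.
  assert (HA : 1 <= INR a) by (apply INR_ge1; auto).
  assert (HB : INR a < INR b) by (apply lt_INR; auto).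
  destruct (moment_high zeta a b (eps / 2) Hz Ha Hab Hg ltac:(lra)) as [v0 [Hv0 Hhigh]].
  destruct (moment_low zeta (INR a) (INR b) Hz HA HB) as [C1 [HC1 Hlow]].
  destruct (ln_pow40_large 1) as [v1 [Hv1 Hl]].
  set (C0 := Cmod (CInt (moment_integrand zeta (INR a) (INR b)) 0 1)).
  assert (HC0 : 0 <= C0) by apply Cmod_ge_0.
  assert (Q1 : 0 < 8 * C1 / eps) by (apply Rdiv_lt_0_compat; lra).
  assert (Q2 : 0 <= 4 * C0 / eps) by (apply Rmult_le_pos; [lra|apply Rlt_le, Rinv_0_lt_compat; lra]).
  exists (v0 + v1 + 8 * C1 / eps + 4 * C0 / eps). split; [lra|]. intros w Hw.
  assert (W1 : 1 <= w) by lra.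
  assert (P : forall n, 1 <= w ^ n) by (intros; apply pow_R1_Rle; auto).
  pose proof (P 180%nat) as P180. pose proof (P 120%nat) as P120.
  assert (W5 : w <= w ^ 5) by (rewrite <- (pow_1 w) at 1; apply Rle_pow; [auto|lia]).
  assert (W20 : w <= w ^ 20) by (rewrite <- (pow_1 w) at 1; apply Rle_pow; [auto|lia]).
  assert (W200 : w <= w ^ 200) by (rewrite <- (pow_1 w) at 1; apply Rle_pow; [auto|lia]).
  specialize (Hhigh (w ^ 5) ltac:(lra)). specialize (Hlow w W1). specialize (Hl (w ^ 5) ltac:(lra)).
  assert (E120 : (w ^ 5) ^ 24 = w ^ 120) by (rewrite <- pow_mult; reflexivity).
  assert (E200 : (w ^ 5) ^ 40 = w ^ 200) by (rewrite <- pow_mult; reflexivity).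
  rewrite E120, E200 in Hhigh. rewrite E200 in Hl.
  assert (L120 : ln (w ^ 120) <= ln (w ^ 200)) by (apply ln_le; [lra|apply Rle_pow; [auto|lia]]).
  set (l := ln (w ^ 200)) in *.
  assert (CM := ccont_moment zeta (INR a) (INR b) Hz).
  rewrite <- (CInt_Chasles _ 0 (w ^ 120) (w ^ 200)) by auto.
  rewrite <- (CInt_Chasles _ 0 1 (w ^ 120)) by auto.
  set (I0 := CInt (moment_integrand zeta (INR a) (INR b)) 0 1) in *.
  set (I1 := CInt (moment_integrand zeta (INR a) (INR b)) 1 (w ^ 120)) in *.
  set (I2 := CInt (moment_integrand zeta (INR a) (INR b)) (w ^ 120) (w ^ 200)) in *.
  set (Z := zeta (RtoC ((INR a + INR b) / 2))) in *.
  replace (I0 + I1 + I2 - Z * RtoC (w ^ 200 * l))%C with (I0 + I1 + (I2 - Z * RtoC (w ^ 200 * l)))%C by ring.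
  eapply Rle_trans; [apply Cmod_triangle|]. eapply Rle_trans; [apply Rplus_le_compat_r, Cmod_triangle|].
  fold C0.
  assert (R1 : C1 * (w ^ 180 * (1 + ln (w ^ 120))) <= eps / 4 * (w ^ 200 * l)).
  { apply Rle_trans with (C1 * (w ^ 180 * (2 * l))).
    - apply Rmult_le_compat_l; [lra|]. apply Rmult_le_compat_l; lra.
    - replace (w ^ 200) with (w ^ 180 * w ^ 20) by (rewrite <- pow_add; reflexivity).
      replace (C1 * (w ^ 180 * (2 * l))) with (eps / 4 * (8 * C1 / eps) * (w ^ 180 * l)) by (field; lra).
      replace (eps / 4 * (w ^ 180 * w ^ 20 * l)) with (eps / 4 * w ^ 20 * (w ^ 180 * l)) by ring.
      apply Rmult_le_compat_r; [nra|]. apply Rmult_le_compat_l; lra. }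
  assert (R2 : C0 <= eps / 4 * (w ^ 200 * l)).
  { apply Rle_trans with (eps / 4 * (4 * C0 / eps)); [apply Req_le; field; lra|].
    apply Rmult_le_compat_l; [lra|]. nra. }
  lra.
Qed.

Theorem theorem1p3 :
  forall zeta : C -> C, is_Riemann_zeta zeta ->
  forall a b : nat, (0 < a)%nat -> (a < b)%nat -> Nat.gcd a b = 1%nat ->
  is_equiv (K := C_AbsRing) (V := C_NormedModule) (Rbar_locally p_infty)
    (fun T : R => zeta_moment zeta (INR a) (INR b) (INR a) T)
    (fun T : R => (zeta ((INR a + INR b) / 2) * T * ln T)%C).
Proof.
  intros zeta Hz a b Ha Hab Hg eps. pose proof (cond_pos eps) as Pe.
  destruct (moment_asymptotic zeta a b eps Hz Ha Hab Hg Pe) as [w0 [Hw0 H]].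
  exists (w0 ^ 200). intros T HT.
  assert (P200 : 1 <= w0 ^ 200) by (apply pow_R1_Rle; auto).
  set (w := Rpower T (/ 200)).
  assert (E200 : w ^ 200 = T).
  { unfold w. rewrite <- Rpower_pow, Rpower_mult by apply Rpower_gt0.
    replace (/ 200 * INR 200) with 1 by (rewrite INR_IZR_INZ; simpl; field). apply Rpower_1; lra. }
  assert (Hw : w0 <= w).
  { replace w0 with (Rpower (w0 ^ 200) (/ 200)).
    - apply Rle_Rpower_l; lra.
    - rewrite <- Rpower_pow, Rpower_mult by lra.
      replace (INR 200 * / 200) with 1 by (rewrite INR_IZR_INZ; simpl; field). apply Rpower_1; lra. }
  specialize (H w Hw). rewrite E200 in H.
  assert (EM : zeta_moment zeta (INR a) (INR b) (INR a) T = CInt (moment_integrand zeta (INR a) (INR b)) 0 T).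
  { rewrite <- CInt_RInt by (apply ccont_moment; auto). unfold zeta_moment. apply (RInt_ext (V := C_R_CompleteNormedModule)). intros t _.
    unfold moment_integrand, zz.
    (* The last two factors are exchanged, because [zz] joins the two arguments with [a]. *)
    rewrite <- Cmult_assoc, (Cmult_comm (zeta _) (zeta (1 / 2 - Ci * INR a * t)%C)), Cmult_assoc.
    do 3 f_equal; apply injective_projections; simpl; field. }
  assert (ES : ((INR a + INR b) / 2)%C = RtoC ((INR a + INR b) / 2)).
  { apply injective_projections; simpl; field. }
  rewrite EM, ES.
  set (I := CInt _ 0 T) in *. set (Z := zeta _) in *.
  assert (HZ : 1 <= Cmod Z).
  { apply zeta_real_ge1; auto. pose proof (INR_ge1 a Ha).
    assert (INR a < INR b) by (apply lt_INR; auto). lra. }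
  assert (l0 : 0 <= ln T) by (apply ln_nonneg; lra).
  change (Cmod (Z * RtoC T * RtoC (ln T) - I)%C <= eps * Cmod (Z * RtoC T * RtoC (ln T))%C).
  rewrite <- !Cmult_assoc, <- RtoC_mult, Cmod_minus_sym.
  eapply Rle_trans; [exact H|]. apply Rmult_le_compat_l; [lra|].
  rewrite Cmod_mult, Cmod_R, Rabs_pos_eq by (apply Rmult_le_pos; lra).
  assert (0 <= T * ln T) by (apply Rmult_le_pos; lra). nra.
Qed.
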